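(* There is a deterministic algorithm which, given an $n$-vertex $d$-degenerate graph $G=(V,E)$, an edge weight function $w\colon E\to\mathbb{R}^+$, and an integer $k>0$, runs in time $2^{kd+k}(kd)^{O(\log(kd))}\, n^{O(1)}$ and outputs a set $S\subseteq V$ with $|S|=k$ such that $E_G(S)$ is maximum among all $k$-element subsets of $V$.
   Context: A graph $G$ is $d$-degenerate if every subgraph of $G$ has a vertex of degree at most $d$; equivalently, the vertices admit an ordering in which every vertex has at most $d$ neighbors that come later in the ordering. For an edge-weighted graph $G$ and $S\subseteq V$, $E_G(S)$ denotes the total weight of all edges having at least one end-point in $S$. All graphs are finite, simple and undirected. *)

(* Defs.v *)
From mathcomp Require Import all_boot all_order all_algebra.
From mathcomp Require Import reals.

Set Implicit Arguments.
Unset Strict Implicit.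
Unset Printing Implicit Defensive.

Import Order.TTheory GRing.Theory Num.Theory.

Record sgraph (T : finType) := SGraph {
  edges : {set {set T}};
  card_edge : forall e, e \in edges -> #|e| = 2 }.

Section Graphs.
Variables (T : finType) (G : sgraph T).

(* (U, F) is a subgraph of G, not necessarily induced. *)
Definition subgraph (U : {set T}) (F : {set {set T}}) : Prop :=
  F \subset edges G /\ forall e, e \in F -> e \subset U.

Definition degree (F : {set {set T}}) (v : T) : nat :=
  #|[set e in F | v \in e]|.

Definition degenerate (d : nat) : Prop :=
  forall U F, subgraph U F -> U != set0 ->
    exists2 v, v \in U & degree F v <= d.

(* E_G(S); only the values of w on the edges of G matter. *)
Definition covered_weight (R : realType) (w : {set T} -> R) (S : {set T}) : R :=
  (\sum_(e in edges G | e :&: S != set0) w e)%R.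

Definition max_cover (R : realType) (w : {set T} -> R) (k : nat) (S : {set T}) :
    Prop :=
  #|S| = k /\
  forall S' : {set T}, #|S'| = k ->
    (covered_weight w S' <= covered_weight w S)%R.

End Graphs.

(* Model of computation: a random access machine with natural-number memory    *)
(* and real-number memory, programmed by structured commands. Each memory is   *)
(* divided into banks; the bank is fixed by the program text, the address      *)
(* within it is computed. Real numbers can only be moved, added, subtracted    *)
(* and compared. Time is the logarithmic cost for natural numbers (every       *)
(* evaluation step is charged the number of binary digits of its result, so    *)
(* large numbers give no hidden parallelism) and unit cost for real numbers.   *)

Inductive nexpr :=
  | NConst of nat
  | NLoad of nat & nexpr
  | NAdd of nexpr & nexpr
  | NSub of nexpr & nexpr
  | NMul of nexpr & nexpr
  | NDiv of nexpr & nexpr.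

Inductive rexpr :=
  | RZero
  | RLoad of nat & nexpr
  | RAdd of rexpr & rexpr
  | RSub of rexpr & rexpr.

Inductive bexpr :=
  | BLeN of nexpr & nexpr
  | BLeR of rexpr & rexpr
  | BNot of bexpr.

Inductive cmd :=
  | Skip
  | NStore of nat & nexpr & nexpr
  | RStore of nat & nexpr & rexpr
  | Seq of cmd & cmd
  | If of bexpr & cmd & cmd
  | While of bexpr & cmd.

Section Machine.
Variable R : realType.

(* nmem s a i is the content of cell i of bank a. *)
Record state := State { nmem : nat -> nat -> nat; rmem : nat -> nat -> R }.

Definition upd (A : Type) (m : nat -> nat -> A) (a i : nat) (x : A) :
    nat -> nat -> A :=
  fun b j => if (b == a) && (j == i) then x else m b j.

(* Number of binary digits, with bitlen 0 = 1. *)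
Definition bitlen (m : nat) : nat := (trunc_log 2 m).+1.

Fixpoint neval (s : state) (e : nexpr) : nat :=
  match e with
  | NConst m => m
  | NLoad a e1 => nmem s a (neval s e1)
  | NAdd e1 e2 => neval s e1 + neval s e2
  | NSub e1 e2 => neval s e1 - neval s e2
  | NMul e1 e2 => neval s e1 * neval s e2
  | NDiv e1 e2 => neval s e1 %/ neval s e2
  end.

Fixpoint ncost (s : state) (e : nexpr) : nat :=
  bitlen (neval s e) +
  match e with
  | NConst _ => 0
  | NLoad _ e1 => ncost s e1
  | NAdd e1 e2 | NSub e1 e2 | NMul e1 e2 | NDiv e1 e2 => ncost s e1 + ncost s e2
  end.

Fixpoint reval (s : state) (e : rexpr) : R :=
  match e with
  | RZero => 0%R
  | RLoad a e1 => rmem s a (neval s e1)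
  | RAdd e1 e2 => (reval s e1 + reval s e2)%R
  | RSub e1 e2 => (reval s e1 - reval s e2)%R
  end.

Fixpoint rcost (s : state) (e : rexpr) : nat :=
  1 +
  match e with
  | RZero => 0
  | RLoad _ e1 => ncost s e1
  | RAdd e1 e2 | RSub e1 e2 => rcost s e1 + rcost s e2
  end.

Fixpoint beval (s : state) (b : bexpr) : bool :=
  match b with
  | BLeN e1 e2 => neval s e1 <= neval s e2
  | BLeR e1 e2 => (reval s e1 <= reval s e2)%R
  | BNot b1 => ~~ beval s b1
  end.

Fixpoint bcost (s : state) (b : bexpr) : nat :=
  1 +
  match b with
  | BLeN e1 e2 => ncost s e1 + ncost s e2
  | BLeR e1 e2 => rcost s e1 + rcost s e2
  | BNot b1 => bcost s b1
  end.

(* exec c s t s': started in s, the command c halts in s' after time t. *)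
Inductive exec : cmd -> state -> nat -> state -> Prop :=
  | ExecSkip s : exec Skip s 1 s
  | ExecNStore s a i e :
      exec (NStore a i e) s (1 + ncost s i + ncost s e)
        (State (upd (nmem s) a (neval s i) (neval s e)) (rmem s))
  | ExecRStore s a i e :
      exec (RStore a i e) s (1 + ncost s i + rcost s e)
        (State (nmem s) (upd (rmem s) a (neval s i) (reval s e)))
  | ExecSeq c1 c2 s1 s2 s3 t1 t2 :
      exec c1 s1 t1 s2 -> exec c2 s2 t2 s3 ->
      exec (Seq c1 c2) s1 (t1 + t2) s3
  | ExecIfTrue b c1 c2 s s' t :
      beval s b -> exec c1 s t s' ->
      exec (If b c1 c2) s (bcost s b + t) s'
  | ExecIfFalse b c1 c2 s s' t :
      ~~ beval s b -> exec c2 s t s' ->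
      exec (If b c1 c2) s (bcost s b + t) s'
  | ExecWhileFalse b c s :
      ~~ beval s b -> exec (While b c) s (bcost s b) s
  | ExecWhileTrue b c s1 s2 s3 t1 t2 :
      beval s1 b -> exec c s1 t1 s2 -> exec (While b c) s2 t2 s3 ->
      exec (While b c) s1 (bcost s1 b + t1 + t2) s3.

Lemma exec_deterministic c s t1 s1 t2 s2 :
  exec c s t1 s1 -> exec c s t2 s2 -> t1 = t2 /\ s1 = s2.
Proof.
move=> h; elim: h t2 s2 => {c s t1 s1}.
- by move=> s t2 s2 h; inversion h.
- by move=> s a i e t2 s2 h; inversion h.
- by move=> s a i e t2 s2 h; inversion h.
- move=> c1 c2 s1 s2 s3 t1 t2 _ IH1 _ IH2 t s h.
  inversion h as [| | |? ? ? ? ? ? ? h1 h2| | | |]; subst.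
  by case: (IH1 _ _ h1) => ? ?; subst; case: (IH2 _ _ h2) => ? ?; subst.
- move=> b c1 c2 s s' t hb _ IH t2 s2 h.
  inversion h as [| | | |? ? ? ? ? ? hb' h'|? ? ? ? ? ? hb' h'| |]; subst.
    by case: (IH _ _ h') => -> ->.
  by rewrite hb in hb'.
- move=> b c1 c2 s s' t hb _ IH t2 s2 h.
  inversion h as [| | | |? ? ? ? ? ? hb' h'|? ? ? ? ? ? hb' h'| |]; subst.
    by rewrite hb' in hb.
  by case: (IH _ _ h') => -> ->.
- move=> b c s hb t2 s2 h.
  inversion h as [| | | | | |? ? ? hb'|? ? ? ? ? ? ? hb']; subst=> //.
  by rewrite hb' in hb.
- move=> b c s1 s2 s3 t1 t2 hb _ IH1 _ IH2 t s h.
  inversion h as [| | | | | |? ? ? hb'|? ? ? ? ? ? ? hb' h1 h2]; subst.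
    by rewrite hb in hb'.
  by case: (IH1 _ _ h1) => ? ?; subst; case: (IH2 _ _ h2) => ? ?; subst.
Qed.

(* The edge at position p = i * n + j of the n x n adjacency matrix, if any. *)
Definition edge_at (n : nat) (G : sgraph 'I_n) (p : nat) : option {set 'I_n} :=
  match insub (p %/ n), insub (p %% n) with
  | Some i, Some j => if [set i; j] \in edges G then Some [set i; j] else None
  | _, _ => None
  end.

(* Cells 0 and 1 of natural bank 0 hold n and k, natural bank 1 holds the      *)
(* adjacency matrix of G and real bank 0 the matrix of weights; every other    *)
(* cell is 0. The degeneracy bound d is not part of the input.                 *)
Definition input (n : nat) (G : sgraph 'I_n) (w : {set 'I_n} -> R) (k : nat) :
    state :=
  State
    (fun a p => match a, p with
                | 0, 0 => n
                | 0, 1 => k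
                | 1, _ => isSome (edge_at G p)
                | _, _ => 0
                end)
    (fun a p => match a with
                | 0 => oapp w 0%R (edge_at G p)
                | _ => 0%R
                end).

(* The result is left in natural bank 2 as a characteristic vector. *)
Definition output (n : nat) (s : state) : {set 'I_n} :=
  [set v : 'I_n | nmem s 2 v != 0].

End Machine.

(* trunc_log 2 m is the integer part of log_2 m for m > 0; since               *)
(* trunc_log 2 0 = 0, the middle factor is 1 when k * d = 0. The constant C    *)
(* is the one hidden in n^{O(1)}, which n ^ C alone misses for n = 1.          *)
Definition time_bound (C n d k : nat) : nat :=
  C * 2 ^ (k * d + k) * (k * d) ^ (C * trunc_log 2 (k * d)) * n ^ C.

(* Main.v *)
Require Import Defs.
From mathcomp Require Import all_boot all_order all_algebra.
From mathcomp Require Import reals.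
From mathcomp Require Import boolp zify.

(**
Fix an ordering in which every vertex has at most [D <= d] later neighbours. For
a colouring of the vertices let [val v] be the weight of the edges at [v],
except those towards later red neighbours. Then [E_G(S)] is at least the sum of
[val] over [S] for every red set [S], with equality when the later neighbours of
[S] outside [S] are not red. Hence the best value of "the [k] red vertices of
largest [val]" over a family of colourings is the optimum, as soon as the family
separates every [S] with [#|S| = k] from its at most [k * D] later neighbours.

Such a family is obtained as follows, with [tau = k * D + k + O(log n)] and
[lam ~ log tau]. Some modulus [q <= 2 ^ (3 * lam + 1)] is injective on the [tau]
vertices, since otherwise [lcm (1, ..., 2 ^ (3 * lam + 1))] would divide the
product of their differences. The residues are cut into [b = O(lam)] intervals
containing at most [s ~ tau / b] of them each, and on each interval the colouring
is one of [2 ^ s * poly (tau)] functions, found greedily by the method of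
conditional expectations so that every pattern on [s] points occurs. All choices
of the modulus, the cuts and the functions number [2 ^ (tau + O(lam ^ 2))].

The algorithm is written with side-effect free expressions that have bounded
sums, compiled to the machine once and for all; nearly everything is recomputed
instead of stored.
*)

(** The exponent must be [k * d + k] with coefficient one, so the family of colourings may exceed
    [2 ^ tau] only by a lower-order factor. The greedy method run on all residues at once would give
    such a family, but it enumerates every pattern on [tau] points, which costs [2 ^ O(tau * lam)].
    Cutting is what makes the enumeration affordable: it then concerns only [s] points, and
    [(9 * lam + 10) * s] is at most [tau + O(lam)]. The price is [O(lam)] bits per interval, for its
    cut and for the surplus in the index of its function, thus [O(lam ^ 2)] bits in all. This is the
    origin of the factor [(k * d) ^ O(log (k * d))].

    The summand [O(log n)] of [tau] lets the single parameter [lam] govern the hashing too, at the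
    price of a power of [n]. Since [d] is not given to the program, the ordering comes from
    repeatedly removing a vertex of minimum remaining degree, and [D] is read off the result. *)

Set Implicit Arguments.
Unset Strict Implicit.
Unset Printing Implicit Defensive.
Import Order.TTheory GRing.Theory Num.Theory.

(** * Hashing by remainders *)

(* Nair's argument: the recurrence of Leibniz' harmonic triangle.              *)
Lemma dvdn_mul_bin m n D : 0 < m -> m <= n ->
  (forall i, 0 < i <= n -> i %| D) -> m * 'C(n, m) %| D.
Proof.
elim: m n => // m IH n _ mn hD.
case: m IH mn => [|m] IH mn; first by rewrite mul1n bin1 hD //; lia.
have /dvdnP [a ha] : m.+1 * 'C(n.-1, m.+1) %| D.
  by apply: IH => //; [lia | move=> i hi; apply: hD; lia].
have /dvdnP [b hb] : m.+1 * 'C(n, m.+1) %| D.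
  by apply: IH => //; lia.
(* In reciprocals, [1/((m+2) 'C(n, m+2)) = 1/((m+1) 'C(n-1, m+1)) - 1/((m+1) 'C(n, m+1))];
   multiplied by [D], the right side is [a - b]. *)
apply/dvdnP; exists (a - b); apply/eqP; rewrite -(eqn_pmul2l (ltn0Sn m)); apply/eqP.
have h1 : m.+2 * 'C(n, m.+2) = n * 'C(n.-1, m.+1) by rewrite mul_bin_diag.
have h2 : m.+2 * 'C(n, m.+2) = (n - m.+1) * 'C(n, m.+1) by rewrite mul_bin_left.
rewrite mulnBl {1}h1 h2 mulnBr.
have -> : m.+1 * (a * (n * 'C(n.-1, m.+1))) = n * D by rewrite ha; lia.
have -> : m.+1 * (b * ((n - m.+1) * 'C(n, m.+1))) = (n - m.+1) * D by rewrite hb; lia.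
rewrite -mulnBl; congr (_ * _); lia.
Qed.

Lemma leq_pow_bin N : 2 ^ N <= 'C(N.*2, N).
Proof.
elim: N => // N IH; rewrite doubleS binS.
have -> : 'C(N.*2.+1, N.+1) = 'C(N.*2.+1, N).
  by rewrite -bin_sub; last lia; congr 'C(_, _); lia.
rewrite expnS mul2n -addnn leq_add //;
 by apply: leq_trans IH _; rewrite leq_bin2l.
Qed.

(** The lcm is represented by its divisor [N * 'C(N.*2, N)], which is at least [N * 2 ^ N]. The
    product [D] of differences has at most [t ^ 2] factors, each at most [2 ^ l], so [D <= 2 ^ N];
    [1 < N] makes the contradiction strict. *)
Lemma hash_exists n l t N (W : {set 'I_n}) :
  n <= 2 ^ l -> #|W| <= t -> l * t ^ 2 <= N -> 1 < N ->
  exists2 q, q < N.*2 & {in W &, injective (fun v : 'I_n => v %% q.+1)}.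
Proof.
move=> nl Wt hN N1.
pose inj q := [forall x in W, forall y in W, (x %% q.+1 == y %% q.+1) ==> (x == y)].
case: (boolP [exists q : 'I_N.*2, inj q]) => [/existsP [q /forall_inP hq]|].
  exists q => // x y hx hy exy; apply/eqP.
  by have /forall_inP/(_ y hy)/implyP := hq x hx; apply; apply/eqP.
rewrite negb_exists => /forallP hq; exfalso.
pose D := \prod_(x in W) \prod_(y in W | x < y) (y - x).
have D0 : 0 < D by rewrite !prodn_cond_gt0 // => x _; rewrite prodn_cond_gt0 // => y; lia.
have dv i : 0 < i <= N.*2 -> i %| D.
  case: i => // q /= hi; have := hq (Ordinal hi).
  rewrite /inj negb_forall => /existsP [x]; rewrite negb_imply => /andP [hx].
  rewrite negb_forall => /existsP [y]; rewrite negb_imply => /andP [hy].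
  rewrite negb_imply /= => /andP [exy nxy].
  have key (u v : 'I_n) : u \in W -> v \in W -> u < v -> u %% q.+1 == v %% q.+1 -> q.+1 %| D.
    move=> hu hv uv e.
    have : q.+1 %| v - u by rewrite -eqn_mod_dvd 1?eq_sym // ltnW.
    move=> h; rewrite /D (bigD1 u) //= dvdn_mulr // (bigD1 v) /=; last by rewrite hv.
    exact: dvdn_mulr.
  case: (ltngtP x y) => [h|h|/val_inj h]; first exact: (key x y).
    by apply: (key y x) => //; rewrite eq_sym.
  by rewrite h eqxx in nxy.
have h1 : N * 'C(N.*2, N) <= D.
  by apply: dvdn_leq => //; apply: dvdn_mul_bin dv; lia.
have h2 : D <= 2 ^ (l * t ^ 2).
  apply: (@leq_trans (\prod_(x in W) \prod_(y in W) 2 ^ l)).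
    apply: leq_prod => x _; rewrite big_mkcondr /=.
    apply: leq_prod => y _; case: ifP => _; last by rewrite expn_gt0.
    by apply: leq_trans nl; have := ltn_ord y; lia.
  rewrite !prod_nat_const -!expnM leq_exp2l // -?mulnA leq_mul2l -mulnn.
  by rewrite leq_mul ?orbT.
have h3 : 2 ^ (l * t ^ 2) <= 2 ^ N by rewrite leq_exp2l.
have := leq_pow_bin N; have : 0 < 2 ^ N by rewrite expn_gt0.
nia.
Qed.

(** * Greedy construction of universal colourings *)

Lemma digits_exist B c (f : nat -> nat) : (forall i, i < c -> f i < B) ->
  exists2 z, z < B ^ c & forall i, i < c -> (z %/ B ^ i) %% B = f i.
Proof.
elim: c f => [|c IH] f hf; first by exists 0.
have [i hi|z hz hd] := IH (fun i => f i.+1); first exact: hf.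
have f0 := hf 0 (ltn0Sn c).
have B0 : 0 < B by exact: leq_ltn_trans f0.
exists (z * B + f 0) => [|[|i] hi].
- by rewrite expnSr; nia.
- by rewrite expn0 divn1 modnMDl modn_small.
- by rewrite expnS divnMA divnMDl // [f 0 %/ B]divn_small // addn0 hd.
Qed.

(** The first two terms of the expansion of [((N - 1) + 1) ^ N] suffice. This is
    [(1 - 1/N) ^ N <= 1/2]; with [N = 2 ^ s] it makes [2 ^ s] greedy rows halve the number of
    unmatched constraints. *)
Lemma pow_pred_bound N : 0 < N -> 2 * N.-1 ^ N <= N ^ N.
Proof.
case: N => // N _ /=.
rewrite -[X in _ <= X ^ _](addn1 N) expnDn big_ord_recl subn0 bin0 exp1n muln1 mul1n.
rewrite big_ord_recl /= exp1n muln1 bin1 subn1 /=.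
rewrite mul2n -addnn leq_add2l; apply: leq_trans (leq_addr _ _).
by rewrite expnS leq_mul2r leqnSn orbT.
Qed.

Section Greedy.
Variables (NP F s Q : nat) (el bt : nat -> nat -> nat).
Hypothesis elQ : forall P i, el P i < Q.
Hypothesis bt2 : forall P i, bt P i < 2.
Implicit Types (T : nat -> nat) (P r j b : nat).

(** The table is flattened: entry [j] of row [r] is cell [r * Q + j]. Constraint [P] asks for colour
    [bt P i] at point [el P i]; distinct points ensure that a random row matches it with probability
    [2 ^ -s]. *)
Definition gvalid P :=
  [forall i : 'I_s, forall j : 'I_s, (el P i == el P j) ==> (i == j :> nat)].
Definition gmatch T P r := [forall i : 'I_s, T (r * Q + el P i) == bt P i].
Definition galive T P r :=
  gvalid P && [forall r' : 'I_F, (r' < r) ==> ~~ gmatch T P r'].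
Definition gcons T P r j :=
  [forall i : 'I_s, (el P i < j) ==> (T (r * Q + el P i) == bt P i)].
Definition gok P j b := [forall i : 'I_s, (el P i == j) ==> (bt P i == b)].
Definition gcnt P j := \sum_(i < s) (el P i < j).
(* The expected number of constraints, not matched by the rows before [r], that *)
(* row [r] matches if its entry [j] is [b] and the later entries are random,   *)
(* scaled by [2 ^ s].                                                          *)
Definition gphi T r j b : nat :=
  \sum_(P < NP) (galive T P r && gcons T P r j && gok P j b) * 2 ^ gcnt P j.+1.

(** The potential of an entry reads only earlier cells, so the table can be filled in increasing
    order and later stores leave the greedy choices valid. *)
Lemma gphi_ext T T' r j b : j < Q ->
  (forall x, x < r * Q + j -> T x = T' x) -> gphi T r j b = gphi T' r j b.
Proof.
move=> jQ hT; apply: eq_bigr => P _; congr (nat_of_bool _ * _).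
congr (_ && _); congr (_ && _); last first.
  apply: eq_forallb => i; case: ltnP => //= h; rewrite hT //; lia.
congr (_ && _); apply: eq_forallb => r'; case: ltnP => //= h; congr (~~ _).
apply: eq_forallb => i; rewrite hT //; have := elQ P i; nia.
Qed.

Variable T : nat -> nat.
Hypothesis greedy : forall r j, r < F -> j < Q ->
  T (r * Q + j) = (gphi T r j 0 <= gphi T r j 1).

(** The scaled expectation before entry [j] is chosen; by [gphi_split] it is the average of the two
    potentials. *)
Let psi r j := \sum_(P < NP) (galive T P r && gcons T P r j) * 2 ^ gcnt P j.

Lemma gcntS P j : gcnt P j.+1 = gcnt P j + \sum_(i < s) (el P i == j).
Proof. by rewrite -big_split; apply: eq_bigr => i _ /=; lia. Qed.

(** By validity at most one point of [P] equals [j]. If one does, a single colour agrees and the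
    count grows by one; otherwise both colours agree and the count stays. *)
Lemma gok_split P j : gvalid P ->
  gok P j 0 * 2 ^ gcnt P j.+1 + gok P j 1 * 2 ^ gcnt P j.+1 = 2 * 2 ^ gcnt P j.
Proof.
move=> /forallP vP; rewrite gcntS -mulnDl.
case: (boolP [exists i : 'I_s, el P i == j]) => [/existsP [i ei]|].
  have u (l : 'I_s) : (el P l == j) = (l == i).
    apply/idP/eqP => [/eqP el_j|->//].
    by apply/val_inj/eqP; have /forallP/(_ i)/implyP := vP l; apply; rewrite el_j eq_sym.
  have ok b : gok P j b = (bt P i == b).
    apply/forallP/idP => [/(_ i)|h l]; first by rewrite ei.
    by rewrite u; apply/implyP => /eqP ->.
  rewrite !ok (bigD1 i) //= ei big1 => [|l]; last by rewrite u => /negPf ->.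
  by have := bt2 P i; case: (bt P i) => [|[|//]] _ /=; rewrite !(addn0, add0n) expnD expn1 mul1n mulnC.
rewrite negb_exists => /forallP h.
have ok b : gok P j b by apply/forallP => i; rewrite (negPf (h i)).
by rewrite !ok big1 ?addn0 // => i _; rewrite (negPf (h i)).
Qed.

Lemma gphi_split r j : gphi T r j 0 + gphi T r j 1 = 2 * psi r j.
Proof.
rewrite -big_split big_distrr /=; apply: eq_bigr => P _.
case: (boolP (galive T P r)) => [/andP [vP _]|_] //=.
case: (gcons T P r j) => //=; rewrite mul1n; exact: gok_split.
Qed.

Lemma psiS r j : r < F -> j < Q -> psi r j.+1 = gphi T r j (T (r * Q + j)).
Proof.
move=> rF jQ; apply: eq_bigr => P _; congr (nat_of_bool _ * _).
rewrite -andbA; congr (_ && _).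
apply/forallP/andP => [h|[/forallP h1 /forallP h2] i].
  split; apply/forallP => i; apply/implyP => hi.
    by have /implyP := h i; apply; lia.
  by have /implyP := h i; rewrite (eqP hi) ltnSn eq_sym; apply.
apply/implyP; rewrite ltnS leq_eqVlt => /orP [hi|hi].
  by have /implyP/(_ hi) := h2 i; rewrite eq_sym (eqP hi).
by have /implyP := h1 i; apply.
Qed.

(** The greedy rule takes the larger potential, which is at least the average. *)
Lemma psi_mono r j : r < F -> j < Q -> psi r j <= psi r j.+1.
Proof.
move=> rF jQ; rewrite psiS // greedy //; have := gphi_split r j.
by case: (leqP (gphi T r j 0) (gphi T r j 1)) => h /=; lia.
Qed.

Let alives r := \sum_(P < NP) galive T P r.

Lemma galiveS P r : r < F -> galive T P r.+1 = galive T P r && ~~ gmatch T P r.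
Proof.
move=> rF; rewrite /galive -andbA; congr (_ && _).
apply/forallP/andP => [h|[/forallP h1 h2] r'].
  split; last by have /implyP := h (Ordinal rF); apply => /=.
  by apply/forallP => r'; apply/implyP => hr; have /implyP := h r'; apply; lia.
apply/implyP; rewrite ltnS leq_eqVlt => /orP [/eqP -> //|hr].
by have /implyP := h1 r'; apply.
Qed.

(** [psi r 0] counts the live constraints and [psi r Q] is [2 ^ s] times the number of them that row
    [r] matches. Monotonicity between the two says that the row does at least as well as a random
    one. *)
Lemma alives_step r : r < F -> 2 ^ s * alives r.+1 <= (2 ^ s).-1 * alives r.
Proof.
move=> rF.
have h0 : psi r 0 = alives r.
  apply: eq_bigr => P _.
  have -> : gcons T P r 0 by apply/forallP.
  by rewrite andbT /gcnt big1 // muln1.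
have hQ : psi r Q = 2 ^ s * \sum_(P < NP) (galive T P r && gmatch T P r).
  rewrite big_distrr /=; apply: eq_bigr => P _; rewrite mulnC; congr (_ * nat_of_bool (_ && _)).
    congr (_ ^ _); rewrite /gcnt (eq_bigr (fun=> 1)) => [|i _]; last by rewrite elQ.
    by rewrite sum_nat_const card_ord muln1.
  by apply: eq_forallb => i; rewrite elQ.
have : psi r 0 <= psi r Q.
  have : forall j, j <= Q -> psi r 0 <= psi r j.
    elim=> // j IH hj; apply: leq_trans (IH (ltnW hj)) _; exact: psi_mono.
  by apply.
rewrite h0 hQ.
have : alives r = alives r.+1 + \sum_(P < NP) (galive T P r && gmatch T P r).
  rewrite -big_split; apply: eq_bigr => P _ /=; rewrite galiveS //.
  by case: (galive _ _ _) => //; case: (gmatch _ _ _).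
have : 0 < 2 ^ s by rewrite expn_gt0.
move: (2 ^ s) (\sum_(P < NP) _) (alives r.+1) (alives r) => N m a' a N0 -> h.
case: N N0 h => // N _ /= h; nia.
Qed.

(** Each of [c + 1] rounds of [2 ^ s] rows halves the live constraints; from at most [2 ^ c] of them
    fewer than one is left. *)
Lemma greedy_universal c P : NP <= 2 ^ c -> 2 ^ s * c.+1 <= F -> P < NP -> gvalid P ->
  exists2 r, r < F & gmatch T P r.
Proof.
move=> hNP hF hP vP.
have iter r : r <= F -> (2 ^ s) ^ r * alives r <= (2 ^ s).-1 ^ r * NP.
  elim: r => [_|r IH hr].
    rewrite !mul1n; apply: (@leq_trans (\sum_(Q < NP) 1)).
      by apply: leq_sum => ? _; exact: leq_b1.
    by rewrite sum_nat_const card_ord muln1.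
  have := alives_step hr; have := IH (ltnW hr); rewrite !expnSr.
  move: (2 ^ s) (alives _) (alives _) => N a a' h1 h2.
  rewrite -mulnA; apply: leq_trans (leq_mul (leqnn _) h2) _.
  by rewrite mulnCA [N.-1 ^ r * _]mulnC -[N.-1 * _ * NP]mulnA leq_mul2l h1 orbT.
set K := 2 ^ s * c.+1 in hF.
have hK : ((2 ^ s) ^ 2 ^ s) ^ c.+1 * alives K <= ((2 ^ s).-1 ^ 2 ^ s) ^ c.+1 * NP.
  by have := iter K hF; rewrite /K !expnM.
have N0 : 0 < 2 ^ s by rewrite expn_gt0.
have hb := pow_pred_bound N0.
have a0 : alives K = 0.
  apply/eqP; rewrite -leqn0 leqNgt; apply/negP => apos.
  have h1 : 2 * 2 ^ c * ((2 ^ s).-1 ^ 2 ^ s) ^ c.+1 <= ((2 ^ s) ^ 2 ^ s) ^ c.+1.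
    by rewrite -expnS -expnMn leq_exp2r.
  (* This power vanishes only for [s = 0]. *)
  case: (posnP (((2 ^ s).-1 ^ 2 ^ s) ^ c.+1)) => [e0|p0].
    have : 0 < ((2 ^ s) ^ 2 ^ s) ^ c.+1 by rewrite !expn_gt0.
    move: hK; rewrite e0 mul0n leqn0 muln_eq0; lia.
  move: hK h1 p0.
  move: (2 ^ c) hNP (((2 ^ s) ^ 2 ^ s) ^ c.+1) (((2 ^ s).-1 ^ 2 ^ s) ^ c.+1) => C hC X Y.
  move=> h1 h2 Y0.
  have X1 : X <= X * alives K by rewrite leq_pmulr.
  have X2 : Y * NP <= Y * C by rewrite leq_mul2l hC orbT.
  have C0 : 0 < C by apply: leq_trans hC; exact: leq_ltn_trans hP.
  have : 0 < Y * C by rewrite muln_gt0 Y0.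
  nia.
have : ~~ galive T P K.
  apply/negP => hal; move: a0; rewrite /alives (bigD1 (Ordinal hP)) //= hal; lia.
rewrite /galive vP /= negb_forall => /existsP [r]; rewrite negb_imply negbK => /andP [_ hm].
by exists r.
Qed.

End Greedy.

(** * Universal colourings by hashing and cutting *)

Section Universal.
Variables lam s b : nat.

(** [hash_exists] is used with [N = 2 ^ (3 * lam)], which bounds [l * t ^ 2] as soon as [l] and [t]
    are at most [2 ^ lam]. So the predecessor of the modulus, the residues and the cuts have [mu]
    bits. There are [2 ^ phi] rows; the surplus [2 * lam + 4] over [s] pays for the logarithm of the
    number of constraints, see [phi_large]. *)
Definition mu := 3 * lam + 1.
Definition phi := s + 2 * lam + 4.

(* A constraint is a number [P] with [s] digits in base [2 ^ mu.+1]; a digit    *)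
(* is a point [uel P i] together with its prescribed colour [ubt P i].         *)
Definition uel P i := (P %/ 2 ^ (mu.+1 * i)) %% 2 ^ mu.+1 %/ 2.
Definition ubt P i := (P %/ 2 ^ (mu.+1 * i)) %% 2.

(* A colouring is a number [z] that encodes a modulus, [b] cuts and [b] indices *)
(* of functions of the table [T].                                              *)
Definition ucut z i := (z %/ 2 ^ (mu * i.+1)) %% 2 ^ mu.
Definition ufun z i := (z %/ 2 ^ (mu * b.+1 + phi * i)) %% 2 ^ phi.
Definition uhash z v := v %% (z %% 2 ^ mu).+1.
Definition ublock z y := \sum_(i < b) (ucut z i < y).
Definition ucolor (T : nat -> nat) z v :=
  T (ufun z (ublock z (uhash z v)) * 2 ^ mu + uhash z v).

Definition ugreedy (T : nat -> nat) := forall r j, r < 2 ^ phi -> j < 2 ^ mu ->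
  T (r * 2 ^ mu + j) =
  (gphi (2 ^ (mu.+1 * s)) (2 ^ phi) s (2 ^ mu) uel ubt T r j 0 <=
   gphi (2 ^ (mu.+1 * s)) (2 ^ phi) s (2 ^ mu) uel ubt T r j 1).

Lemma uel_lt P i : uel P i < 2 ^ mu.
Proof. by rewrite ltn_divLR // -expnSr ltn_mod expn_gt0. Qed.

Lemma ubt_lt P i : ubt P i < 2.
Proof. by rewrite ltn_mod. Qed.

Hypothesis lam0 : 0 < lam.
Hypothesis slam : s <= 2 ^ lam.+1.

Lemma phi_large : 2 ^ s * (mu.+1 * s).+1 <= 2 ^ phi.
Proof.
rewrite /phi -addnA expnD leq_mul2l; apply/orP; right.
have -> : 2 * lam + 4 = lam.+2 + lam.+1 + 1 by lia.
rewrite !expnD expn1 muln2 -addnn.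
have h : mu.+1 <= 2 ^ lam.+2.
  by rewrite /mu !expnS; have := ltn_expl lam (ltnSn 1); lia.
have : mu.+1 * s <= 2 ^ lam.+2 * 2 ^ lam.+1 by apply: leq_mul.
have : 0 < 2 ^ lam.+2 * 2 ^ lam.+1 by rewrite muln_gt0 !expn_gt0.
lia.
Qed.

Lemma constraint_exists (Y : {set 'I_(2 ^ mu)}) (c : 'I_(2 ^ mu) -> bool) :
  #|Y| <= s -> exists P, [/\ P < 2 ^ (mu.+1 * s), gvalid s uel P &
    forall y, y \in Y -> exists2 j, j < s & uel P j = y /\ ubt P j = c y].
Proof.
move=> Ys; set Q := 2 ^ mu.
have Q0 : 0 < Q by rewrite expn_gt0.
pose y0 : 'I_Q := Ordinal Q0.
have sQ : s <= Q.
  by apply: leq_trans slam _; rewrite leq_exp2l // /mu; lia.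
(* Points outside [Y] fill the list up to exactly [s] distinct points, as validity demands. *)
pose es := take s (enum Y ++ enum (~: Y)).
have size_es : size es = s.
  rewrite size_take size_cat -!cardE cardsC card_ord -/Q; case: ltngtP sQ => //.
have uniq_es : uniq es.
  rewrite take_uniq // cat_uniq !enum_uniq andbT /=.
  by apply/hasPn => y; rewrite !mem_enum inE.
pose f j := 2 * nth y0 es j + c (nth y0 es j).
have fB j : f j < 2 ^ mu.+1.
  by rewrite /f expnS; have := ltn_ord (nth y0 es j); rewrite -/Q; lia.
have [P hP hd] := @digits_exist (2 ^ mu.+1) s f (fun i _ => fB i).
have elP j : j < s -> uel P j = nth y0 es j.
  by move=> hj; rewrite /uel expnM hd // /f mulnC divnMDl // divn_small ?addn0 // ltnS leq_b1.
have btP j : j < s -> ubt P j = c (nth y0 es j).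
  move=> hj; rewrite /ubt expnM.
  have -> : (P %/ (2 ^ mu.+1) ^ j) %% 2 = f j %% 2.
    by rewrite -hd // modn_dvdm // expnS dvdn_mulr.
  by rewrite /f mulnC modnMDl modn_small // ltnS leq_b1.
exists P; split.
- by rewrite expnM.
- apply/forallP => i; apply/forallP => j; apply/implyP.
  rewrite !elP // => /eqP /val_inj /eqP; rewrite nth_uniq ?size_es //.
- move=> y hy; have yes : y \in es.
    rewrite /es take_cat; case: ifP => h.
      by rewrite -cardE in h; lia.
    by rewrite mem_cat mem_enum hy.
  exists (index y es); first by rewrite -size_es index_mem.
  by rewrite elP ?btP -?size_es ?index_mem // nth_index.
Qed.

Lemma digit_low x y B c i : 0 < B -> i < c -> ((x + y * B ^ c) %/ B ^ i) %% B = (x %/ B ^ i) %% B.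
Proof.
move=> B0 ic.
have -> : B ^ c = B ^ (c - i.+1) * B * B ^ i by rewrite -expnSr -expnD; congr (_ ^ _); lia.
by rewrite mulnA addnC divnMDl ?expn_gt0 ?B0 // mulnA modnMDl.
Qed.

Lemma code_exists q (c f : nat -> nat) : q < 2 ^ mu -> (forall i, c i < 2 ^ mu) ->
  (forall i, i < b -> f i < 2 ^ phi) ->
  exists2 z, z < 2 ^ (mu * b.+1 + phi * b) & [/\ forall v, uhash z v = v %% q.+1,
    forall i, i < b -> ucut z i = c i & forall i, i < b -> ufun z i = f i].
Proof.
move=> hq hc hf.
have Q0 : 0 < 2 ^ mu by rewrite expn_gt0.
have F0 : 0 < 2 ^ phi by rewrite expn_gt0.
pose g i := if i is j.+1 then c j else q.
have [|x hx dx] := @digits_exist (2 ^ mu) b.+1 g; first by case=> [|i] _; [exact: hq | exact: hc].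
have [y hy dy] := @digits_exist (2 ^ phi) b f hf.
exists (x + y * (2 ^ mu) ^ b.+1).
  by rewrite expnD ![2 ^ (_ * _)]expnM; nia.
split.
- move=> v; rewrite /uhash; congr (_ %% _.+1).
  by have := @digit_low x y (2 ^ mu) b.+1 0 Q0 isT; rewrite expn0 !divn1 => ->; have := dx 0 isT; rewrite expn0 divn1.
- by move=> i hi; rewrite /ucut expnM digit_low // dx.
- move=> i hi; rewrite /ufun expnD divnMA ![2 ^ (_ * _)]expnM.
  by rewrite addnC divnMDl ?expn_gt0 ?Q0 // [x %/ _]divn_small // addn0 dy.
Qed.

Lemma sum_ltn_min (m k : nat) : k <= m -> \sum_(i < m) (i < k) = k.
Proof.
move=> km; rewrite -(big_mkord xpredT (fun i => nat_of_bool (i < k))) /=.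
rewrite (@big_cat_nat _ _ _ k) //= (eq_big_nat _ _ (F2 := fun=> 1)); last by move=> i /andP [_ ->].
rewrite sum_nat_const_nat subn0 muln1 big_nat big1 ?addn0 // => i /andP [h _].
by rewrite ltnNge h.
Qed.

(** The cuts follow the ranks in [W]: block [i] receives the ranks from [i * s] to [i * s + s - 1],
    and [#|W| <= b * s] leaves at most [b] blocks. *)
Lemma cuts_exist n (W : {set 'I_n}) (h : 'I_n -> nat) :
  0 < s -> #|W| <= b * s -> {in W &, injective h} -> (forall v, h v < 2 ^ mu) ->
  exists2 c : nat -> nat, forall i, c i < 2 ^ mu &
    exists2 blk : nat -> nat,
     (forall v, v \in W -> \sum_(i < b) (c i < h v) = blk (h v) /\ blk (h v) < b) &
     (forall i, #|[set v in W | blk (h v) == i]| <= s).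
Proof.
move=> s0 Wbs hinj hQ; set Q := 2 ^ mu.
have Q0 : 0 < Q by rewrite expn_gt0.
pose rank y := #|[set w in W | h w < y]|.
have rank_mono y y' : y <= y' -> rank y <= rank y'.
  move=> yy; apply: subset_leq_card; apply/subsetP => w; rewrite !inE => /andP [-> /=]; lia.
have rank0 : rank 0 = 0 by apply/eqP; rewrite cards_eq0; apply/eqP/setP => w; rewrite !inE andbF.
have rank_lt v v' : v \in W -> h v < h v' -> rank (h v) < rank (h v').
  move=> vW hv; apply: proper_card; apply/properP; split.
    by apply/subsetP => w; rewrite !inE => /andP [-> /=]; lia.
  by exists v; rewrite !inE vW ?ltnn.
have rankW v : v \in W -> rank (h v) < #|W|.
  move=> vW; apply: proper_card; apply/properP; split.
    by apply/subsetP => w; rewrite !inE => /andP [].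
  by exists v => //; rewrite !inE vW ltnn.
(* The largest residue whose rank belongs to block [i] or an earlier one. For [v] in [W], [h v]
   exceeds it exactly when the block of [v] comes after [i], so the number of cuts below [h v] is
   that block. *)
pose c i := \max_(y < Q | rank y %/ s <= i) y.
exists c.
  by move=> i; apply: (big_ind (fun y => y < Q)) => // x y; rewrite gtn_max => -> ->.
exists (fun y => rank y %/ s).
- move=> v vW; have lt : rank (h v) %/ s < b.
    by rewrite ltn_divLR // (leq_trans (rankW v vW)).
  split=> //; rewrite -[RHS](@sum_ltn_min b _ (ltnW lt)); apply: eq_bigr => i _; congr nat_of_bool.
  apply/idP/idP => hi.
    rewrite ltnNge; apply/negP => hle; move: hi; rewrite ltnNge => /negP; apply.
    exact: (leq_bigmax_cond (Ordinal (hQ v))).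
  have hv0 : 0 < h v by case: (h v) hi => //; rewrite rank0 div0n.
  rewrite /c; apply: (big_ind (fun y => y < h v)) => // [x y|y hy]; first by rewrite gtn_max => -> ->.
  rewrite ltnNge; apply/negP => /rank_mono hr; move: hi; rewrite ltnNge => /negP; apply.
  by apply: leq_trans hy; apply: leq_div2r.
- move=> i; set Wi := [set _ in _ | _].
  pose g (v : 'I_n) : 'I_s := Ordinal (ltn_pmod (rank (h v)) s0).
  rewrite -[X in _ <= X]card_ord -(@card_in_imset _ _ g Wi) ?max_card // => v v'.
  rewrite !inE => /andP [vW /eqP hv] /andP [vW' /eqP hv'] /(congr1 val) /= e.
  have er : rank (h v) = rank (h v') by rewrite (divn_eq (rank (h v)) s) (divn_eq (rank (h v')) s) hv hv' e.
  apply: hinj => //; case: (ltngtP (h v) (h v')) => // hlt.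
    by have := rank_lt _ _ vW hlt; rewrite er ltnn.
  by have := rank_lt _ _ vW' hlt; rewrite er ltnn.
Qed.

Lemma ucolor_universal n l t (S U : {set 'I_n}) T :
  ugreedy T -> n <= 2 ^ l -> l <= 2 ^ lam -> t <= 2 ^ lam -> t <= b * s -> 0 < s ->
  #|S :|: U| <= t -> [disjoint S & U] ->
  exists2 z, z < 2 ^ (mu * b.+1 + phi * b) &
    (forall v, v \in S -> ucolor T z v = 1) /\ (forall v, v \in U -> ucolor T z v = 0).
Proof.
move=> gT nl ll tl tbs s0 cW dSU; set W := S :|: U in cW.
have N1 : 1 < 2 ^ (3 * lam) by rewrite -{1}(expn0 2) ltn_exp2l //; lia.
have hN : l * t ^ 2 <= 2 ^ (3 * lam).
  have -> : 2 ^ (3 * lam) = 2 ^ lam * (2 ^ lam) ^ 2.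
    by rewrite -expnM -expnD; congr (_ ^ _); lia.
  by apply: leq_mul => //; rewrite leq_exp2r.
have [q hq hinj] := hash_exists nl cW hN N1.
have qQ : q < 2 ^ mu by rewrite /mu addn1 expnS mul2n.
have hQ (v : 'I_n) : v %% q.+1 < 2 ^ mu by apply: leq_trans qQ; rewrite ltn_mod.
have [c cQ [blk hblk cblk]] := @cuts_exist n W (fun v : 'I_n => v %% q.+1) s0 (leq_trans cW tbs) hinj hQ.
pose hh v : 'I_(2 ^ mu) := Ordinal (hQ v).
have ex (i : 'I_b) : exists r, r < 2 ^ phi /\
    forall v, v \in W -> blk (v %% q.+1) = i -> T (r * 2 ^ mu + v %% q.+1) = (v \in S).
  have [|P [hP vP hy]] := @constraint_exists (hh @: [set v in W | blk (v %% q.+1) == i])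
     (fun y => y \in hh @: S).
    exact: leq_trans (leq_imset_card _ _) (cblk _).
  have [r hr /forallP hm] := greedy_universal uel_lt ubt_lt gT (leqnn _) phi_large hP vP.
  exists r; split=> // v vW bv.
  have [|j js [e1 e2]] := hy (hh v); first by apply: imset_f; rewrite inE vW bv eqxx.
  have := hm (Ordinal js); rewrite /= e1 e2 /= => /eqP ->; congr nat_of_bool.
  apply/imsetP/idP => [[u uS /(congr1 val) /= e]|vS]; last by exists v.
  by rewrite (hinj v u vW _ e) // inE uS.
have [f hf] := fin_all_exists ex.
pose f' i := if insub i is Some j then f j else 0.
have f'E (i : 'I_b) : f' i = f i by rewrite /f' valK.
have [|z hz [z1 z2 z3]] := @code_exists q c f' qQ cQ.
  by move=> i hi; rewrite -[i]/(val (Ordinal hi)) f'E; case: (hf (Ordinal hi)).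
exists z => //.
have key v : v \in W -> ucolor T z v = (v \in S).
  move=> vW; rewrite /ucolor z1; have [h1 h2] := hblk v vW.
  have -> : ublock z (v %% q.+1) = blk (v %% q.+1).
    by rewrite -h1; apply: eq_bigr => i _; rewrite z2.
  rewrite z3 // -[blk _]/(val (Ordinal h2)) f'E.
  by have [_] := hf (Ordinal h2); apply.
split=> v hv; rewrite key ?inE ?hv ?orbT //.
by rewrite (disjointFl dSU hv).
Qed.

End Universal.

(** * Covered weight and vertex values *)

Section TopK.
Variables (R : realType) (n : nat) (val : 'I_n -> R) (red : pred 'I_n) (k : nat).

(** Only [<=] is used on reals, the one comparison of the machine. Ties go to the smaller index,
    which gives a strict total order and makes the selection unique. *)
Definition beats (u v : 'I_n) :=
  ~~ (val u <= val v)%R || (u < v) && (val v <= val u)%R.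
Definition rank v := #|[set u | red u && beats u v]|.
Definition topk := [set v | red v && (rank v < k)].

Lemma beats_irr v : ~~ beats v v.
Proof. by rewrite /beats lexx ltnn. Qed.

Lemma beats_val u v : beats u v -> (val v <= val u)%R.
Proof. by rewrite /beats -ltNge => /orP [/ltW|/andP []]. Qed.

Lemma beats_trans v u t : beats u v -> beats v t -> beats u t.
Proof.
rewrite /beats -!ltNge => /orP [h1|/andP [h1 h1']] /orP [h2|/andP [h2 h2']].
- by rewrite (lt_trans h2 h1).
- by rewrite (le_lt_trans h2' h1).
- by rewrite (lt_le_trans h2 h1').
- by rewrite (ltn_trans h1 h2) (le_trans h2' h1') orbT.
Qed.

Lemma beats_total u v : u != v -> beats u v || beats v u.
Proof.
rewrite /beats -!ltNge => uv; case: (ltgtP (val u) (val v)) => //= _; rewrite ?orbT //.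
by rewrite !andbT -neq_ltn.
Qed.

Lemma rank_lt u v : red u -> beats u v -> rank u < rank v.
Proof.
move=> ru uv; apply: proper_card; apply/properP; split.
  apply/subsetP => t; rewrite !inE => /andP [-> h]; exact: beats_trans h uv.
by exists u; rewrite !inE ru ?uv // negb_and beats_irr orbT.
Qed.

Lemma topk_beats u v : red u -> red v -> u \in topk -> v \notin topk -> beats u v.
Proof.
move=> ru rv hu hv; have uv : u != v by apply: contraNneq hv => <-.
have /orP [//|h] := beats_total uv.
have := rank_lt rv h; move: hu hv; rewrite !inE ru rv /=; lia.
Qed.

Variable S : {set 'I_n}.
Hypotheses (Sred : forall v, v \in S -> red v) (Sk : #|S| = k).

(** Ranks of red vertices are distinct and below the number of red vertices, so they take each value
    once. The set [S] serves to provide [k] red vertices. *)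
Lemma card_topk : #|topk| = k.
Proof.
set X := [set u | red u].
have rX v : v \in X -> rank v < #|X|.
  rewrite inE => rv; apply: proper_card; apply/properP; split.
    by apply/subsetP => t; rewrite !inE => /andP [].
  by exists v; rewrite !inE // negb_and beats_irr orbT.
have kX : k <= #|X|.
  by rewrite -Sk; apply: subset_leq_card; apply/subsetP => v /Sred; rewrite inE.
case: (posnP k) => [k0|k0].
  by rewrite k0; apply/eqP; rewrite cards_eq0; apply/eqP/setP => v; rewrite !inE k0 andbF.
pose g v : 'I_#|X| := insubd (Ordinal (leq_trans k0 kX)) (rank v).
have gE v : v \in X -> g v = rank v :> nat by move=> vX; rewrite val_insubd rX.
have ginj : {in X &, injective g}.
  move=> u v uX vX /(congr1 (@nat_of_ord _)); rewrite !gE // => e; apply/eqP.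
  apply/negPn/negP => uv; have /orP [h|h] := beats_total uv.
    by have := rank_lt (_ : red u) h; rewrite e ltnn => /(_ _)/negP; apply; move: uX; rewrite inE.
  by have := rank_lt (_ : red v) h; rewrite e ltnn => /(_ _)/negP; apply; move: vX; rewrite inE.
have gX : g @: X = setT.
  by apply/eqP; rewrite eqEcard subsetT cardsT card_ord card_in_imset ?leqnn.
have tX : {subset topk <= X} by move=> v; rewrite !inE => /andP [].
rewrite -(@card_in_imset _ _ g topk); last by move=> u v /tX uX /tX vX; exact: ginj.
have -> : g @: topk = [set i : 'I_#|X| | i < k].
  apply/setP => i; apply/imsetP/idP => [[v vt ->]|].
    by rewrite inE gE ?tX //; move: vt; rewrite inE => /andP [].
  rewrite inE => ik; have : i \in g @: X by rewrite gX inE.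
  case/imsetP => v vX e; exists v => //; rewrite inE -gE // -e ik andbT.
  by move: vX; rewrite inE.
rewrite -sum1dep_card big_mkcond -[RHS](sum_ltn_min kX).
by apply: eq_bigr => i _; case: (i < k).
Qed.

(** An exchange: the parts of [S] and of [topk] outside each other have equal size, and every
    element of the second beats every element of the first. The best value in the first part, at
    [v1], separates them. *)
Lemma topk_sum : (\sum_(v in S) val v <= \sum_(v in topk) val v)%R.
Proof.
rewrite (big_setID topk) /= [X in (_ <= X)%R](big_setID S) /= setIC lerD2l.
have cd : #|S :\: topk| = #|topk :\: S|.
  by apply/eqP; rewrite -(eqn_add2l #|S :&: topk|) cardsID setIC cardsID Sk card_topk.
case: (set_0Vmem (S :\: topk)) => [e0|[v0 hv0]].
  move: cd; rewrite e0 cards0 => /esym/eqP; rewrite cards_eq0 => /eqP ->.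
  by rewrite !big_set0.
have [v1 h1 hmax] : exists2 v1, v1 \in S :\: topk & forall v, v \in S :\: topk -> (val v <= val v1)%R.
  have [v1 h1 h2] := @arg_maxP _ _ _ v0 (fun v => v \in S :\: topk) val hv0.
  by exists v1.
apply: (@le_trans _ _ (\sum_(v in S :\: topk) val v1)%R); first by apply: ler_sum.
rewrite sumr_const cd -sumr_const; apply: ler_sum => u.
rewrite inE => /andP [uS ut]; apply: beats_val; move: h1; rewrite inE => /andP [vt vS].
by apply: topk_beats => //; [move: ut; rewrite inE => /andP [] | exact: Sred].
Qed.

End TopK.

(** * Covered weight as a sum of vertex values *)

Section Cover.
Variables (R : realType) (n : nat) (G : sgraph 'I_n) (w : {set 'I_n} -> R).
Variable lay : 'I_n -> nat.
Hypothesis lay_inj : injective lay.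
Hypothesis w_ge0 : forall e, e \in edges G -> (0 <= w e)%R.

Definition wt (v u : 'I_n) : R := if [set v; u] \in edges G then w [set v; u] else 0%R.

Lemma wtC v u : wt v u = wt u v.
Proof. by rewrite /wt setUC. Qed.

Lemma wt_ge0 v u : (0 <= wt v u)%R.
Proof. by rewrite /wt; case: ifP => // /w_ge0. Qed.

Lemma wtxx v : wt v v = 0%R.
Proof.
rewrite /wt; case: ifP => // /card_edge; rewrite setUid cards1 //.
Qed.

Definition cval (X : pred 'I_n) (v : 'I_n) : R :=
  (\sum_u if (lay v < lay u)%N && X u then 0 else wt v u)%R.

Lemma covered_weight_pairs S : covered_weight G w S =
  (\sum_v \sum_(u | (lay v < lay u)%N) if (v \in S) || (u \in S) then wt v u else 0)%R.
Proof.
pose h (p : 'I_n * 'I_n) := [set p.1; p.2].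
pose P (p : 'I_n * 'I_n) := ((lay p.1 < lay p.2)%N && (h p \in edges G)).
pose F e : R := if e :&: S != set0 then w e else 0%R.
have meet v u : ([set v; u] :&: S != set0) = (v \in S) || (u \in S).
  apply/set0Pn/orP => [[x]|[] h0]; last by exists u; rewrite !inE eqxx orbT.
    by rewrite !inE => /andP [/orP [/eqP ->|/eqP ->] ->]; [left|right].
  by exists v; rewrite !inE eqxx.
rewrite /covered_weight big_mkcondr /= -/(F _).
transitivity (\sum_(p | P p) F (h p))%R; last first.
  rewrite pair_big_dep /= [LHS]big_mkcondr /=.
  by apply: eq_bigr => [[v u]] _; rewrite /F /h /wt /= meet; case: ifP; case: ifP.
rewrite (partition_big h (fun e => e \in edges G)) => [|p /andP []//].
apply: eq_bigr => e he; have /eqP/cards2P [a [b [ab E]]] := card_edge he.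
wlog lt : a b ab E / lay a < lay b.
  move=> H; case: (ltngtP (lay a) (lay b)) => [lt|lt|/lay_inj e']; first exact: (H a b).
    by apply: (H b a) => //; rewrite 1?eq_sym // E setUC.
  by rewrite e' eqxx in ab.
rewrite (big_pred1 (a, b)) => [|[c d]]; first by rewrite /h /= -E.
rewrite /P /h /= xpair_eqE E; apply/idP/idP; last first.
  by move=> /andP [/eqP -> /eqP ->]; rewrite eqxx lt -E he.
move=> /andP [/andP [lcd _] /eqP e1].
have ha : a \in [set c; d] by rewrite e1 !inE eqxx.
have hb : b \in [set c; d] by rewrite e1 !inE eqxx orbT.
move: ha hb; rewrite !inE => /orP [/eqP ea|/eqP ea] /orP [/eqP eb|/eqP eb]; subst.
- by rewrite eqxx in ab.
- by rewrite !eqxx.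
- by have := ltn_trans lcd lt; rewrite ltnn.
- by rewrite eqxx in ab.
Qed.

(** An edge with both ends in [S] is charged to its later end, any other covered edge to its only
    end in [S]. *)
Lemma covered_weight_cval S : covered_weight G w S = (\sum_(v in S) cval (mem S) v)%R.
Proof.
rewrite covered_weight_pairs.
transitivity (\sum_v \sum_(u | (lay v < lay u)%N) ((if u \in S then wt v u else 0) +
   (if (v \in S) && (u \notin S) then wt v u else 0)))%R.
  apply: eq_bigr => v _; apply: eq_bigr => u _.
  by case: (v \in S); case: (u \in S); rewrite ?addr0 ?add0r.
transitivity (\sum_v \sum_(u | (lay v < lay u)%N) (if u \in S then wt v u else 0) +
  \sum_v \sum_(u | (lay v < lay u)%N) (if (v \in S) && (u \notin S) then wt v u else 0))%R.
  by rewrite -big_split /=; apply: eq_bigr => v _; rewrite -big_split.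
rewrite (exchange_big_dep xpredT) //= -big_split /= [RHS]big_mkcond /=.
apply: eq_bigr => v _; case: ifP => vS; last by rewrite !big1 ?addr0.
rewrite /cval [RHS](bigID (fun u => (lay v < lay u)%N)) /= addrC; congr (_ + _)%R.
  by apply: eq_bigr => u -> /=; case: (u \in S).
rewrite [RHS](bigD1 v) ?ltnn //= wtxx add0r.
apply: eq_big => [u|u h]; last first.
  by rewrite wtC (_ : (lay v < lay u) = false) //; lia.
by case: (eqVneq u v) => [->|uv]; rewrite ?ltnn //= andbT -leqNgt ltn_neqAle (inj_eq lay_inj) uv.
Qed.

Lemma cval_sub (X Y : pred 'I_n) v : subpred X Y -> (cval Y v <= cval X v)%R.
Proof.
move=> XY; apply: ler_sum => u _; case: (lay v < lay u)%N => //=.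
case: (boolP (X u)) => [/XY -> //|_]; case: ifP => // _; exact: wt_ge0.
Qed.

Lemma cval_eq (X Y : pred 'I_n) v : subpred X Y ->
  (forall u, [set v; u] \in edges G -> (lay v < lay u)%N -> ~~ X u -> ~~ Y u) ->
  cval Y v = cval X v.
Proof.
move=> XY h; apply: eq_bigr => u _; case: (boolP (lay v < lay u)%N) => //= lvu.
case: (boolP (X u)) => [/XY -> //|nX]; case: ifP => // Yu.
by rewrite /wt; case: ifP => // /h /(_ lvu nX); rewrite Yu.
Qed.

(** Separation is needed for the competitor [S] alone. The winning colouring need not separate
    anything: its set consists of red vertices, so its total is at most the weight it covers. Only
    colourings that select exactly [k] vertices enter the comparison. *)
Lemma max_cover_of_best (red : nat -> pred 'I_n) Z k best :
  #|topk (cval (red best)) (red best) k| = k ->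
  (forall z, z < Z -> #|topk (cval (red z)) (red z) k| = k ->
    (\sum_(v in topk (cval (red z)) (red z) k) cval (red z) v <=
     \sum_(v in topk (cval (red best)) (red best) k) cval (red best) v)%R) ->
  (forall S : {set 'I_n}, #|S| = k -> exists2 z, z < Z &
     (forall v, v \in S -> red z v) /\
     (forall v u, v \in S -> [set v; u] \in edges G -> lay v < lay u -> u \notin S ->
        ~~ red z u)) ->
  max_cover G w k (topk (cval (red best)) (red best) k).
Proof.
move=> cb hbest hS; split=> // S Sk; have [z zZ [h1 h2]] := hS S Sk.
rewrite !covered_weight_cval.
have sub0 : subpred (mem S) (red z) by move=> v; exact: h1.
have -> : (\sum_(v in S) cval (mem S) v = \sum_(v in S) cval (red z) v)%R.
  by apply: eq_bigr => v vS; rewrite (@cval_eq (mem S) (red z)) // => u e l; exact: (h2 v u vS e l).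
apply: le_trans (topk_sum (cval (red z)) h1 Sk) _.
apply: le_trans (hbest _ zZ (card_topk _ h1 Sk)) _.
by apply: ler_sum => v _; apply: cval_sub => u /=; rewrite inE => /andP [].
Qed.

End Cover.

(** * Expressions with bounded sums and their compilation *)

Inductive bank := BPar | BAdj | BOut | BPow | BLay | BTab.

Definition bcode (b : bank) : nat :=
  match b with
  | BPar => 0 | BAdj => 1 | BOut => 2 | BPow => 3 | BLay => 4 | BTab => 5
  end.

Definition beq (b c : bank) : bool := bcode b == bcode c.

Lemma beqP b c : reflect (b = c) (beq b c).
Proof. by apply: (iffP eqP) => [|->//]; case: b; case: c. Qed.

Inductive bop := OAdd | OSub | OMul | ODiv.

(* [XSum x a e] is the sum of [e] over [x] below the parameter cell [a]; truth  *)
(* values are 0 and 1.                                                         *)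
Inductive nx :=
  | XConst of nat
  | XVar of nat
  | XLoad of bank & nx
  | XBin of bop & nx & nx
  | XLe of nx & nx
  | XLeR of rx & rx
  | XSum of nat & nat & nx
  | XLet of nat & nx & nx
with rx :=
  | RLd of nx
  | RSum of nat & nat & rx
  | RIf of nx & rx.

Scheme nx_mut := Induction for nx Sort Prop
  with rx_mut := Induction for rx Sort Prop.
Combined Scheme nxrx_ind from nx_mut, rx_mut.

Definition bopd (o : bop) (x y : nat) : nat :=
  match o with
  | OAdd => x + y | OSub => x - y | OMul => x * y | ODiv => x %/ y
  end.

Definition setv (f : nat -> nat) (x v : nat) : nat -> nat :=
  fun y => if y == x then v else f y.

Section Denotation.
Variables (R : realType) (M : bank -> nat -> nat) (W : nat -> R).

Fixpoint nden (r : nat -> nat) (e : nx) : nat :=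
  match e with
  | XConst c => c
  | XVar x => r x
  | XLoad a e1 => M a (nden r e1)
  | XBin o e1 e2 => bopd o (nden r e1) (nden r e2)
  | XLe e1 e2 => nden r e1 <= nden r e2
  | XLeR r1 r2 => (rden r r1 <= rden r r2)%R
  | XSum x a e1 => \sum_(i < M BPar a) nden (setv r x i) e1
  | XLet x e1 e2 => nden (setv r x (nden r e1)) e2
  end
with rden (r : nat -> nat) (e : rx) : R :=
  match e with
  | RLd e1 => W (nden r e1)
  | RSum x a e1 => (\sum_(i < M BPar a) rden (setv r x i) e1)%R
  | RIf e1 e2 => if 0 < nden r e1 then rden r e2 else 0%R
  end.

End Denotation.

(** Natural bank 9 and real bank 1 serve as evaluation stacks: no [bank] has code 9, and the weights
    occupy real bank 0. Stack addresses are constants of the program text. *)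
Definition stk (h : nat) : nexpr := NLoad 9 (NConst h).
Definition push (h : nat) (e : nexpr) : cmd := NStore 9 (NConst h) e.
Definition rstk (h : nat) : rexpr := RLoad 1 (NConst h).
Definition rpush (h : nat) (e : rexpr) : cmd := RStore 1 (NConst h) e.

Definition bopc (o : bop) : nexpr -> nexpr -> nexpr :=
  match o with OAdd => NAdd | OSub => NSub | OMul => NMul | ODiv => NDiv end.

Definition for_loop (c a : nat) (body : cmd) : cmd :=
  Seq (push c (NConst 0))
    (While (BNot (BLeN (NLoad 0 (NConst a)) (stk c)))
       (Seq body (push c (NAdd (stk c) (NConst 1))))).

(* The value of the expression is left in stack cell [h]; the variable [x]     *)
(* lives in stack cell [p x].                                                  *)
Fixpoint ncomp (p : nat -> nat) (h : nat) (e : nx) : cmd :=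
  match e with
  | XConst c => push h (NConst c)
  | XVar x => push h (stk (p x))
  | XLoad a e1 => Seq (ncomp p h e1) (push h (NLoad (bcode a) (stk h)))
  | XBin o e1 e2 =>
      Seq (ncomp p h e1)
        (Seq (ncomp p h.+1 e2) (push h (bopc o (stk h) (stk h.+1))))
  | XLe e1 e2 =>
      Seq (ncomp p h e1)
        (Seq (ncomp p h.+1 e2)
          (If (BLeN (stk h) (stk h.+1))
             (push h (NConst 1)) (push h (NConst 0))))
  | XLeR r1 r2 =>
      Seq (rcomp p h r1)
        (Seq (rcomp p h.+1 r2)
          (If (BLeR (rstk h) (rstk h.+1))
             (push h (NConst 1)) (push h (NConst 0))))
  | XSum x a e1 =>
      Seq (push h (NConst 0))
        (for_loop h.+1 a
          (Seq (ncomp (setv p x h.+1) h.+2 e1)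
               (push h (NAdd (stk h) (stk h.+2)))))
  | XLet x e1 e2 =>
      Seq (ncomp p h.+1 e1)
        (Seq (ncomp (setv p x h.+1) h.+2 e2) (push h (stk h.+2)))
  end
with rcomp (p : nat -> nat) (h : nat) (e : rx) : cmd :=
  match e with
  | RLd e1 => Seq (ncomp p h e1) (rpush h (RLoad 0 (stk h)))
  | RSum x a e1 =>
      Seq (rpush h RZero)
        (for_loop h.+1 a
          (Seq (rcomp (setv p x h.+1) h.+2 e1)
               (rpush h (RAdd (rstk h) (rstk h.+2)))))
  | RIf e1 e2 =>
      Seq (ncomp p h e1)
        (Seq (rcomp p h.+1 e2)
          (If (BLeN (NConst 1) (stk h))
             (rpush h (rstk h.+1)) (rpush h RZero)))
  end.

(* Both an exponent bounding the value (see [nden_bound]) and a bound on the   *)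
(* constants and the stack cells that occur in the compiled code.              *)
Fixpoint nmd (d : nat -> nat) (e : nx) : nat :=
  match e with
  | XConst c => c.+1
  | XVar x => (d x).+1
  | XLoad a e1 => (nmd d e1).+1
  | XBin o e1 e2 => (nmd d e1 + nmd d e2).+2
  | XLe e1 e2 => (nmd d e1 + nmd d e2).+2
  | XLeR r1 r2 => (rmd d r1 + rmd d r2).+2
  | XSum x a e1 => nmd (setv d x 1) e1 + a + 4
  | XLet x e1 e2 => nmd d e1 + nmd (setv d x (nmd d e1)) e2 + 4
  end
with rmd (d : nat -> nat) (e : rx) : nat :=
  match e with
  | RLd e1 => (nmd d e1).+1
  | RSum x a e1 => rmd (setv d x 1) e1 + a + 4
  | RIf e1 e2 => (nmd d e1 + rmd d e2).+2
  end.

Fixpoint nloops (e : nx) : seq nat :=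
  match e with
  | XConst _ | XVar _ => [::]
  | XLoad _ e1 => nloops e1
  | XBin _ e1 e2 | XLe e1 e2 | XLet _ e1 e2 => nloops e1 ++ nloops e2
  | XLeR r1 r2 => rloops r1 ++ rloops r2
  | XSum _ a e1 => a :: nloops e1
  end
with rloops (e : rx) : seq nat :=
  match e with
  | RLd e1 => nloops e1
  | RSum _ a e1 => a :: rloops e1
  | RIf e1 e2 => nloops e1 ++ rloops e2
  end.

(** Running time in units of the digit length [L] when every loop has at most [A] rounds, see
    [comp_runs]. *)
Fixpoint nct (A : nat) (e : nx) : nat :=
  match e with
  | XConst _ | XVar _ => 20
  | XLoad _ e1 => nct A e1 + 20
  | XBin _ e1 e2 | XLe e1 e2 | XLet _ e1 e2 => nct A e1 + nct A e2 + 20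
  | XLeR r1 r2 => rct A r1 + rct A r2 + 20
  | XSum _ a e1 => A * (nct A e1 + 60) + 60
  end
with rct (A : nat) (e : rx) : nat :=
  match e with
  | RLd e1 => nct A e1 + 20
  | RSum _ a e1 => A * (rct A e1 + 60) + 60
  | RIf e1 e2 => nct A e1 + rct A e2 + 20
  end.

Fixpoint ndep (e : nx) : nat :=
  match e with
  | XConst _ | XVar _ => 0
  | XLoad _ e1 => ndep e1
  | XBin _ e1 e2 | XLe e1 e2 | XLet _ e1 e2 => maxn (ndep e1) (ndep e2)
  | XLeR r1 r2 => maxn (rdep r1) (rdep r2)
  | XSum _ a e1 => (ndep e1).+1
  end
with rdep (e : rx) : nat :=
  match e with
  | RLd e1 => ndep e1
  | RSum _ a e1 => (rdep e1).+1
  | RIf e1 e2 => maxn (ndep e1) (rdep e2)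
  end.

(** Nested loops multiply their lengths, so the nesting depth is the exponent of [A]; the factor
    [nct 1 e] depends on the program text only. *)
Lemma ct_le_pow A : 0 < A ->
  (forall e, nct A e <= nct 1 e * A ^ ndep e) /\
  (forall e, rct A e <= rct 1 e * A ^ rdep e).
Proof.
move=> A0.
have pos d : 0 < A ^ d by rewrite expn_gt0 A0.
have step1 x y d : x <= y * A ^ d -> x + 20 <= (y + 20) * A ^ d.
  by move=> h; rewrite mulnDl leq_add // leq_pmulr.
have step2 x1 x2 y1 y2 d1 d2 : x1 <= y1 * A ^ d1 -> x2 <= y2 * A ^ d2 ->
  x1 + x2 + 20 <= (y1 + y2 + 20) * A ^ maxn d1 d2.
  move=> h1 h2; rewrite !mulnDl !leq_add ?leq_pmulr //.
    apply: leq_trans h1 _; rewrite leq_mul2l leq_pexp2l ?leq_maxl ?orbT //.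
  apply: leq_trans h2 _; rewrite leq_mul2l leq_pexp2l ?leq_maxr ?orbT //.
have step3 x y d : x <= y * A ^ d ->
    A * (x + 60) + 60 <= (1 * (y + 60) + 60) * A ^ d.+1.
  move=> h; rewrite mul1n mulnDl leq_add ?leq_pmulr //.
  rewrite expnS mulnCA leq_mul2l mulnDl leq_add ?orbT ?leq_pmulr //.
apply: nxrx_ind => /=; auto.
all: by move=> *; rewrite ?muln1.
Qed.

Lemma bitlen_le m l : 0 < l -> m < 2 ^ l -> bitlen m <= l.
Proof.
move=> l0; case: m => [|m] h; first by rewrite /bitlen trunc_log0.
rewrite /bitlen ltnNge; apply/negP => h1.
by move: h; rewrite ltnNge (leq_trans _ (trunc_logP (ltnSn 1) (ltn0Sn m))) ?leq_exp2l.
Qed.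

(** * Total correctness with time bounds *)

Section Runs.
Variable R : realType.
Implicit Types (s : state R) (c : cmd) (Q : state R -> Prop).

Definition runs c s T Q := exists t s', [/\ exec c s t s', t <= T & Q s'].

Definition setn s a i v : state R := State (upd (nmem s) a i v) (rmem s).
Definition setr s a i v : state R := State (nmem s) (upd (rmem s) a i v).

Lemma runs_weaken c s T T' Q Q' : runs c s T Q -> T <= T' ->
  (forall s', Q s' -> Q' s') -> runs c s T' Q'.
Proof.
move=> [t [s' [h1 h2 h3]]] hT hQ; exists t, s'; split=> //; last exact: hQ.
exact: leq_trans h2 hT.
Qed.

Lemma runs_seq c1 c2 s T1 T2 T Q :
  runs c1 s T1 (fun s' => runs c2 s' T2 Q) -> T1 + T2 <= T ->
  runs (Seq c1 c2) s T Q.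
Proof.
move=> [t1 [s1 [h1 h2 [t2 [s2 [h3 h4 h5]]]]]] hT.
exists (t1 + t2), s2; split=> //; first exact: ExecSeq h1 h3.
by apply: leq_trans hT; apply: leq_add.
Qed.

Lemma runs_nstore a i e s T Q :
  1 + ncost s i + ncost s e <= T -> Q (setn s a (neval s i) (neval s e)) ->
  runs (NStore a i e) s T Q.
Proof. by move=> hT hQ; eexists _, _; split; [exact: ExecNStore| |]. Qed.

Lemma runs_rstore a i e s T Q :
  1 + ncost s i + rcost s e <= T -> Q (setr s a (neval s i) (reval s e)) ->
  runs (RStore a i e) s T Q.
Proof. by move=> hT hQ; eexists _, _; split; [exact: ExecRStore| |]. Qed.

Lemma runs_if b c1 c2 s T T' Q :
  runs (if beval s b then c1 else c2) s T Q -> bcost s b + T <= T' ->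
  runs (If b c1 c2) s T' Q.
Proof.
case: ifP => hb [t [s' [h1 h2 h3]]] hT; exists (bcost s b + t), s'; split=> //.
- exact: ExecIfTrue.
- by apply: leq_trans hT; rewrite leq_add2l.
- by apply: ExecIfFalse => //; rewrite hb.
- by apply: leq_trans hT; rewrite leq_add2l.
Qed.

Lemma runs_while (I : nat -> state R -> Prop) N b c Tb Tc s :
  (forall i s', i <= N -> I i s' -> beval s' b = (i < N) /\ bcost s' b <= Tb) ->
  (forall i s', i < N -> I i s' -> runs c s' Tc (I i.+1)) ->
  I 0 s -> runs (While b c) s (N * (Tb + Tc) + Tb) (I N).
Proof.
move=> hb hc I0.
suff key j i s' : i + j = N -> I i s' ->
    runs (While b c) s' (j * (Tb + Tc) + Tb) (I N).
  exact: (key N 0).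
elim: j i s' => [|j IH] i s' hij Ii.
  rewrite addn0 in hij; subst i.
  have [hb1 hb2] := hb _ _ (leqnn N) Ii.
  exists (bcost s' b), s'; split=> //; first by apply: ExecWhileFalse; rewrite hb1 ltnn.
have lt : i < N by lia.
have [hb1 hb2] := hb _ _ (ltnW lt) Ii.
have [t1 [s1 [e1 ht1 I1]]] := hc _ _ lt Ii.
have [|t2 [s2 [e2 ht2 I2]]] := IH i.+1 s1 _ I1; first lia.
exists (bcost s' b + t1 + t2), s2; split=> //.
  by apply: ExecWhileTrue e1 e2; rewrite hb1.
lia.
Qed.

Definition frame h s s' := [/\
  forall a i, a != 9 -> nmem s' a i = nmem s a i,
  forall i, i < h -> nmem s' 9 i = nmem s 9 i,
  forall a i, a != 1 -> rmem s' a i = rmem s a i &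
  forall i, i < h -> rmem s' 1 i = rmem s 1 i].

Lemma frame_refl h s : frame h s s.
Proof. by []. Qed.

Lemma frame_trans h h' s1 s2 s3 :
  h <= h' -> frame h s1 s2 -> frame h' s2 s3 -> frame h s1 s3.
Proof.
move=> hh [a1 a2 a3 a4] [b1 b2 b3 b4]; split=> [a i ha|i hi|a i ha|i hi].
- by rewrite b1 ?a1.
- by rewrite b2 ?a2 //; exact: leq_trans hh.
- by rewrite b3 ?a3.
- by rewrite b4 ?a4 //; exact: leq_trans hh.
Qed.

Lemma frame_setn h h' s v : h <= h' -> frame h s (setn s 9 h' v).
Proof.
move=> hh; split=> //= [a i ha|i hi]; rewrite /upd; first by rewrite (negPf ha).
by rewrite (_ : (i == h') = false) ?andbF //; lia.
Qed.

Lemma frame_setr h h' s v : h <= h' -> frame h s (setr s 1 h' v).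
Proof.
move=> hh; split=> //= [a i ha|i hi]; rewrite /upd; first by rewrite (negPf ha).
by rewrite (_ : (i == h') = false) ?andbF //; lia.
Qed.

Lemma frame_push h s s' v : frame h s s' -> frame h s (setn s' 9 h v).
Proof. by move=> fr; apply: frame_trans (leqnn h) fr (frame_setn _ _ _). Qed.

Lemma frame_rpush h s s' v : frame h s s' -> frame h s (setr s' 1 h v).
Proof. by move=> fr; apply: frame_trans (leqnn h) fr (frame_setr _ _ _). Qed.

(** [B] is to bound the memory contents, [B ^ H] all intermediate values and [A] the loop lengths;
    every charged number then has at most [L] digits. *)
Variables (B H L A : nat).
Hypotheses (B2 : 2 <= B) (BHL : B ^ H < 2 ^ L).

Lemma bitlen_val v : v <= B ^ H -> bitlen v <= L.
Proof.
move=> h; apply: bitlen_le; last exact: leq_ltn_trans BHL.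
have : 0 < B ^ H by rewrite expn_gt0 ltnW.
by case: L BHL => //; rewrite expn0; lia.
Qed.

Lemma small_val v : v <= H -> v <= B ^ H.
Proof. by move=> h; rewrite ltnW // (leq_ltn_trans h) // ltn_expl. Qed.

Lemma bitlen_small v : v <= H -> bitlen v <= L.
Proof. by move=> h; apply/bitlen_val/small_val. Qed.

Lemma L_gt0 : 0 < L.
Proof. exact: leq_trans (bitlen_small (leq0n H)). Qed.

Lemma runs_push h e s T Q :
  h <= H -> 1 + L + ncost s e <= T -> Q (setn s 9 h (neval s e)) ->
  runs (push h e) s T Q.
Proof.
move=> hh hT hQ; apply: runs_nstore => //; apply: leq_trans hT; rewrite leq_add2r /=.
by rewrite addn0 leq_add2l bitlen_small.
Qed.

Lemma runs_rpush h e s T Q :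
  h <= H -> 1 + L + rcost s e <= T -> Q (setr s 1 h (reval s e)) ->
  runs (rpush h e) s T Q.
Proof.
move=> hh hT hQ; apply: runs_rstore => //; apply: leq_trans hT; rewrite leq_add2r /=.
by rewrite addn0 leq_add2l bitlen_small.
Qed.

Lemma stk_cost s h : h <= H -> nmem s 9 h <= B ^ H -> ncost s (stk h) <= 2 * L.
Proof.
move=> h1 h2 /=; rewrite addn0 mul2n -addnn.
by apply: leq_add; [apply: bitlen_val | apply: bitlen_small].
Qed.

Lemma runs_for (c a N : nat) body (I : nat -> state R -> Prop) T s :
  nmem s 0 a = N -> N <= B ^ H -> a <= H -> 1 <= H -> c <= H ->
  (forall i s', i < N -> I i s' -> nmem s' 9 c = i -> nmem s' 0 a = N ->
     runs body s' T (fun s'' => [/\ nmem s'' 9 c = i, nmem s'' 0 a = N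
        & I i.+1 (setn s'' 9 c i.+1)])) ->
  I 0 (setn s 9 c 0) ->
  runs (for_loop c a body) s (N * (T + 20 * L) + 20 * L) (I N).
Proof.
move=> hN hNB ha hH hc hbody I0.
pose J i s' := [/\ I i s', nmem s' 9 c = i & nmem s' 0 a = N].
have L0 := L_gt0.
have b0 : bitlen 0 <= L := bitlen_small (leq0n _).
have b1 : bitlen 1 <= L := bitlen_small hH.
have ba := bitlen_small ha; have bc := bitlen_small hc.
have bv i : i <= N -> bitlen i <= L.
  by move=> h; apply: bitlen_val; apply: leq_trans hNB.
apply: (@runs_seq _ _ _ (3 * L) (N * (6 * L + (T + 6 * L)) + 6 * L)); last first.
  have : N * (6 * L + (T + 6 * L)) <= N * (T + 20 * L) by rewrite leq_mul2l; lia.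
  lia.
apply: runs_push => //; first by rewrite /=; lia.
have J0 : J 0 (setn s 9 c 0) by split=> //=; rewrite /upd ?eqxx //.
apply: (@runs_weaken _ _ _ _ (J N) _ _ (leqnn _)); last by move=> s' [].
apply: runs_while J0.
  move=> i s' hi [_ h1 h2]; split; first by rewrite /= h1 h2 -ltnNge.
  by rewrite /= h1 h2; move: (bv _ hi) (bv _ (leqnn N)); lia.
move=> i s' hi [Ii h1 h2].
apply: (@runs_seq _ _ _ T (6 * L)); last lia.
apply: runs_weaken (hbody _ _ hi Ii h1 h2) (leqnn _) _ => s'' [g1 g2 g3].
have e : i + 1 = i.+1 by rewrite addn1.
apply: runs_push => //=; rewrite ?g1 ?e.
  by move: (bv _ hi) (bv _ (ltnW hi)); lia.
by split=> //=; rewrite /upd ?eqxx.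
Qed.

(** * Correctness and cost of compiled expressions *)

Variables (M : bank -> nat -> nat) (W : nat -> R).
Hypothesis MB : forall b i, M b i <= B.

Let B0 : 0 < B := ltnW B2.

(** Values are polynomial in the memory contents: operations add exponents, and [2 <= B] absorbs the
    factor 2. Reals enter only through comparisons, with value at most 1, so their half of the
    mutual induction is trivial. *)
Lemma nden_bound :
  (forall e d r, (forall x, r x <= B ^ d x) -> nden M W r e <= B ^ nmd d e)
  /\ (forall e : rx, True).
Proof.
have pB d : 0 < B ^ d by rewrite expn_gt0 B0.
have mono d d' x : x <= B ^ d -> d <= d' -> x <= B ^ d'.
  by move=> h1 h2; apply: leq_trans h1 _; rewrite leq_pexp2l.
apply: nxrx_ind => //=.
- move=> c d r hr; apply: (mono c); last lia.
  by rewrite ltnW // ltn_expl.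
- by move=> x d r hr; apply: mono (hr x) _.
- by move=> a e IH d r hr; apply: leq_trans (MB _ _) _; rewrite expnS leq_pmulr.
- move=> o e1 IH1 e2 IH2 d r hr.
  have h1 := IH1 _ _ hr; have h2 := IH2 _ _ hr.
  have : bopd o (nden M W r e1) (nden M W r e2) <= 2 * (B ^ nmd d e1 * B ^ nmd d e2).
    have p1 := pB (nmd d e1); have p2 := pB (nmd d e2).
    case: o => /=; [nia|nia|nia|].
    by apply: leq_trans (leq_div _ _) _; nia.
  move=> h; apply: leq_trans h _; rewrite -expnD.
  by rewrite expnS; apply: leq_mul => //; rewrite leq_pexp2l.
- by move=> e1 _ e2 _ d r hr; apply: leq_trans (leq_b1 _) (pB _).
- by move=> e1 _ e2 _ d r hr; apply: leq_trans (leq_b1 _) (pB _).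
- move=> x a e IH d r hr.
  apply: (mono (nmd (setv d x 1) e).+1); last lia.
  apply: (@leq_trans (\sum_(i < M BPar a) B ^ nmd (setv d x 1) e)).
    apply: leq_sum => i _; apply: IH => y; rewrite /setv; case: ifP => // _.
    by rewrite expn1 (leq_trans (ltnW (ltn_ord i))).
  by rewrite sum_nat_const card_ord expnS leq_mul.
- move=> x e1 IH1 e2 IH2 d r hr.
  apply: (mono (nmd (setv d x (nmd d e1)) e2)); last lia.
  apply: IH2 => y; rewrite /setv; case: ifP => // _; exact: IH1.
Qed.

Definition agree s := (forall b i, nmem s (bcode b) i = M b i) /\ (forall i, rmem s 0 i = W i).

Definition pre (p d : nat -> nat) h s (r : nat -> nat) := [/\ agree s, forall x, p x < h,
  forall x, nmem s 9 (p x) = r x & forall x, r x <= B ^ d x].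

Lemma agree_frame h s s' : agree s -> frame h s s' -> agree s'.
Proof.
move=> [a1 a2] [b1 _ b3 _]; split=> [b i|i]; last by rewrite b3.
by rewrite b1 ?a1 //; case: b.
Qed.

Lemma pre_frame p d h s s' r h' : pre p d h s r -> frame h s s' -> h <= h' ->
  pre p d h' s' r.
Proof.
move=> [a1 a2 a3 a4] fr hh; split=> // [|x|x].
- exact: agree_frame fr.
- exact: leq_trans hh.
- by case: fr => _ -> //.
Qed.

Lemma pre_setv p d h s r h' x (c v k : nat) : pre p d h s r -> h <= h' -> c < h' ->
  nmem s 9 c = v -> v <= B ^ k -> pre (setv p x c) (setv d x k) h' s (setv r x v).
Proof.
move=> [a1 a2 a3 a4] hh hc hv hk; split=> // y; rewrite /setv; case: ifP => // _.
exact: leq_trans hh.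
Qed.

(** The frame has to be carried through the induction: it keeps first operands, accumulators and
    loop counters intact while the rest of an expression is evaluated above them. *)
Lemma comp_runs :
  (forall e p d h s r, pre p d h s r -> h + nmd d e <= H ->
     all (fun a => M BPar a <= A) (nloops e) ->
     runs (ncomp p h e) s (L * nct A e)
       (fun s' => frame h s s' /\ nmem s' 9 h = nden M W r e)) /\
  (forall e p d h s r, pre p d h s r -> h + rmd d e <= H ->
     all (fun a => M BPar a <= A) (rloops e) ->
     runs (rcomp p h e) s (L * rct A e)
       (fun s' => frame h s s' /\ rmem s' 1 h = rden M W r e)).
Proof.
have L0 := L_gt0.
have pB d : 0 < B ^ d by rewrite expn_gt0 B0.
have nb e d r p h s : pre p d h s r -> nmd d e <= H -> nden M W r e <= B ^ H.
  move=> [_ _ _ hr] hm; apply: leq_trans (proj1 nden_bound e d r hr) _.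
  by rewrite leq_pexp2l.
have b0 : bitlen 0 <= L := bitlen_small (leq0n _).
apply: nxrx_ind => /=.
- move=> c p d h s r hp hh _; apply: runs_push; [lia| |].
    by rewrite /=; have := @bitlen_small c; lia.
  by split; [apply: frame_setn | rewrite /= /upd !eqxx].
- move=> x p d h s r hp hh _; have [_ h1 h2 h3] := hp.
  have hx := h1 x; have hv : r x <= B ^ H.
    by have := @nb (XVar x) d r p h s hp; apply => /=; lia.
  apply: runs_push; [lia| |].
    have := @stk_cost s (p x); rewrite h2 => hc; have := hc _ hv; lia.
  by split; [apply: frame_setn | rewrite /= /upd !eqxx h2].
- move=> a e IH p d h s r hp hh hl.
  apply: (@runs_seq _ _ _ (L * nct A e) (L * 20)); last by rewrite -mulnDr.
  apply: (runs_weaken (IH _ _ _ _ _ hp _ hl) (leqnn _)) => [|s1 [fr e1]]; first lia.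
  have hp1 := pre_frame hp fr (leqnn _); have [ag1 _ _ _] := hp1.
  have hv : nden M W r e <= B ^ H by apply: nb hp1 _; lia.
  apply: runs_push; [lia| |] => /=.
    rewrite (proj1 ag1) e1.
    have := bitlen_val hv; have := @bitlen_small h.
    have : bitlen (M a (nden M W r e)) <= L.
      apply: bitlen_val; apply: leq_trans (MB _ _) _.
      by rewrite -[X in X <= _]expn1 leq_pexp2l //; lia.
    lia.
  split; first exact: frame_push fr.
  by rewrite /= /upd !eqxx (proj1 ag1) e1.
- move=> o e1 IH1 e2 IH2 p d h s r hp hh; rewrite all_cat => /andP [hl1 hl2].
  apply: (@runs_seq _ _ _ (L * nct A e1) (L * (nct A e2 + 20))); last by rewrite -mulnDr addnA.
  apply: (runs_weaken (IH1 _ _ _ _ _ hp _ hl1) (leqnn _)) => [|s1 [fr1 v1]]; first lia.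
  apply: (@runs_seq _ _ _ (L * nct A e2) (L * 20)); last by rewrite -mulnDr.
  have hp1 := pre_frame hp fr1 (leqnSn _).
  apply: (runs_weaken (IH2 _ _ _ _ _ hp1 _ hl2) (leqnn _)) => [|s2 [fr2 v2]]; first lia.
  have fr := frame_trans (leqnSn _) fr1 fr2.
  have v1' : nmem s2 9 h = nden M W r e1 by case: fr2 => _ -> //.
  have b1 : nden M W r e1 <= B ^ H by apply: nb hp _; lia.
  have b2 : nden M W r e2 <= B ^ H by apply: nb hp _; lia.
  have b3 : bopd o (nden M W r e1) (nden M W r e2) <= B ^ H.
    by apply: (nb (XBin o e1 e2)) hp _ => /=; lia.
  have ev : neval s2 (bopc o (stk h) (stk h.+1)) = bopd o (nden M W r e1) (nden M W r e2).
    by case: (o); rewrite /= v1' v2.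
  apply: runs_push; [lia| |]; rewrite ?ev.
    have c1 : ncost s2 (stk h) <= 2 * L by apply: stk_cost; rewrite ?v1' //; lia.
    have c2 : ncost s2 (stk h.+1) <= 2 * L by apply: stk_cost; rewrite ?v2 //; lia.
    have -> : ncost s2 (bopc o (stk h) (stk h.+1)) = bitlen (neval s2 (bopc o (stk h) (stk h.+1))) +
       (ncost s2 (stk h) + ncost s2 (stk h.+1)) by case: (o).
    by rewrite ev; move: (bitlen_val b3); lia.
  split; first exact: frame_push fr.
  by rewrite /= /upd !eqxx.
- move=> e1 IH1 e2 IH2 p d h s r hp hh; rewrite all_cat => /andP [hl1 hl2].
  apply: (@runs_seq _ _ _ (L * nct A e1) (L * (nct A e2 + 20))); last by rewrite -mulnDr addnA.
  apply: (runs_weaken (IH1 _ _ _ _ _ hp _ hl1) (leqnn _)) => [|s1 [fr1 v1]]; first lia.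
  apply: (@runs_seq _ _ _ (L * nct A e2) (L * 20)); last by rewrite -mulnDr.
  have hp1 := pre_frame hp fr1 (leqnSn _).
  apply: (runs_weaken (IH2 _ _ _ _ _ hp1 _ hl2) (leqnn _)) => [|s2 [fr2 v2]]; first lia.
  have fr := frame_trans (leqnSn _) fr1 fr2.
  have v1' : nmem s2 9 h = nden M W r e1 by case: fr2 => _ -> //.
  have b1 : nden M W r e1 <= B ^ H by apply: nb hp _; lia.
  have b2 : nden M W r e2 <= B ^ H by apply: nb hp _; lia.
  have c1 : ncost s2 (stk h) <= 2 * L by apply: stk_cost; rewrite ?v1' //; lia.
  have c2 : ncost s2 (stk h.+1) <= 2 * L by apply: stk_cost; rewrite ?v2 //; lia.
  apply: (@runs_if _ _ _ _ (L * 10)); last by rewrite -[bcost _ _]/(1 + (ncost s2 (stk h) + ncost s2 (stk h.+1))); lia.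
  have bb : bitlen 1 <= L by apply: bitlen_small; lia.
  have -> : beval s2 (BLeN (stk h) (stk h.+1)) = (nden M W r e1 <= nden M W r e2).
    by rewrite /= v1' v2.
  case: leqP => _; (apply: runs_push; [lia|rewrite /=; lia|];
   split; [exact: frame_push fr | by rewrite /= /upd !eqxx]).
- move=> e1 IH1 e2 IH2 p d h s r hp hh; rewrite all_cat => /andP [hl1 hl2].
  apply: (@runs_seq _ _ _ (L * rct A e1) (L * (rct A e2 + 20))); last by rewrite -mulnDr addnA.
  apply: (runs_weaken (IH1 _ _ _ _ _ hp _ hl1) (leqnn _)) => [|s1 [fr1 v1]]; first lia.
  apply: (@runs_seq _ _ _ (L * rct A e2) (L * 20)); last by rewrite -mulnDr.
  have hp1 := pre_frame hp fr1 (leqnSn _).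
  apply: (runs_weaken (IH2 _ _ _ _ _ hp1 _ hl2) (leqnn _)) => [|s2 [fr2 v2]]; first lia.
  have fr := frame_trans (leqnSn _) fr1 fr2.
  have v1' : rmem s2 1 h = rden M W r e1 by case: fr2 => _ _ _ -> //.
  have bb : bitlen 1 <= L by apply: bitlen_small; lia.
  apply: (@runs_if _ _ _ _ (L * 10)); last first.
    by rewrite /=; have := @bitlen_small h; have := @bitlen_small h.+1; lia.
  have -> : beval s2 (BLeR (rstk h) (rstk h.+1)) = (rden M W r e1 <= rden M W r e2)%R.
    by rewrite /= v1' v2.
  case: ifP => _; (apply: runs_push; [lia|rewrite /=; lia|];
   split; [exact: frame_push fr | by rewrite /= /upd !eqxx]).
- move=> x a e IH p d h s r hp hh /andP [hla hl].
  set N := M BPar a in hla *.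
  have [ag _ _ hr] := hp.
  have NB : N <= B ^ H.
    by apply: leq_trans (MB _ _) _; rewrite -[X in X <= _]expn1 leq_pexp2l //; lia.
  have bb : bitlen 1 <= L by apply: bitlen_small; lia.
  apply: (@runs_seq _ _ _ (L * 3) (N * (L * (nct A e + 20) + 20 * L) + 20 * L)); last first.
    have : N * (L * (nct A e + 20) + 20 * L) <= A * (L * (nct A e + 20) + 20 * L).
      by rewrite leq_mul2r hla orbT.
    move=> h0; apply: (leq_trans (leq_add (leqnn _) (leq_add h0 (leqnn _)))).
    rewrite !mulnDr; nia.
  apply: runs_push; [lia|rewrite /=; lia|].
  pose I i s' := frame h s s' /\ nmem s' 9 h = \sum_(j < i) nden M W (setv r x j) e.
  apply: (runs_weaken (@runs_for _ _ _ _ I _ _ _ _ _ _ _ _ _) (leqnn _)) => //; try lia.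
  + by rewrite /= /upd /= -[nmem s 0 a]/(nmem s (bcode BPar) a) (proj1 ag).
  + move=> i s' hi [fr hs] hc ha.
    have hp1 := pre_frame hp fr (leqnn _).
    have hp2 : pre (setv p x h.+1) (setv d x 1) h.+2 s' (setv r x i).
      apply: pre_setv hp1 _ _ _ _ => //; first lia.
      by rewrite expn1; apply: leq_trans (ltnW hi) (MB _ _).
    apply: (@runs_seq _ _ _ (L * nct A e) (L * 20)); last by rewrite -mulnDr.
    apply: (runs_weaken (IH _ _ _ _ _ hp2 _ hl) (leqnn _)) => [|s1 [fr1 v1]]; first lia.
    have [f1 f2 f3 f4] := fr1.
    have w1 : nmem s1 9 h = \sum_(j < i) nden M W (setv r x j) e by rewrite f2 ?hs //; lia.
    (* The accumulator is charged in every round; its partial sums are at most the full sum, which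
       [nden_bound] controls. *)
    have bs j : j <= N -> \sum_(l < j) nden M W (setv r x l) e <= B ^ H.
      move=> hj; apply: leq_trans (nb (XSum x a e) _ _ _ _ _ hp _) => /=; last lia.
      rewrite -/N -!(big_mkord xpredT (fun l => nden M W (setv r x l) e)).
      by rewrite [X in _ <= X](@big_cat_nat _ _ _ j) //= leq_addr.
    have b2 : nden M W (setv r x i) e <= B ^ H by apply: nb hp2 _; lia.
    have ev : nmem s1 9 h + nmem s1 9 h.+2 = \sum_(j < i.+1) nden M W (setv r x j) e.
      by rewrite w1 v1 big_ord_recr.
    apply: runs_push; [lia| |].
      rewrite -[ncost _ _]/(bitlen (nmem s1 9 h + nmem s1 9 h.+2) + (ncost s1 (stk h) + ncost s1 (stk h.+2))).
      rewrite ev.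
      have c1 : ncost s1 (stk h) <= 2 * L by apply: stk_cost; [lia|rewrite w1 bs // ltnW].
      have c2 : ncost s1 (stk h.+2) <= 2 * L by apply: stk_cost; rewrite ?v1 //; lia.
      by move: (bitlen_val (bs _ hi)); lia.
    split.
    * rewrite /= /upd (_ : (h.+1 == h) = false); last lia.
      by rewrite andbF f2 ?hc //.
    * by rewrite /= /upd /= f1.
    * split; last first.
        rewrite /= /upd (_ : (h == h.+1) = false); last lia.
        by rewrite !eqxx /= ev.
      apply: frame_trans (leqnSn _) _ (frame_setn _ _ (leqnn _)).
      apply: frame_trans (leqnn _) _ (frame_setn _ _ (leqnn _)).
      by apply: frame_trans fr fr1; lia.
  + split.
      apply: frame_trans (leqnSn _) _ (frame_setn _ _ (leqnn _)).
      exact: frame_setn.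
    rewrite /= /upd (_ : (h == h.+1) = false); last lia.
    by rewrite !eqxx /= big_ord0.
- move=> x e1 IH1 e2 IH2 p d h s r hp hh; rewrite all_cat => /andP [hl1 hl2].
  apply: (@runs_seq _ _ _ (L * nct A e1) (L * (nct A e2 + 20))); last by rewrite -mulnDr addnA.
  have hp0 := pre_frame hp (frame_refl _ _) (leqnSn _).
  apply: (runs_weaken (IH1 _ _ _ _ _ hp0 _ hl1) (leqnn _)) => [|s1 [fr1 v1]]; first lia.
  apply: (@runs_seq _ _ _ (L * nct A e2) (L * 20)); last by rewrite -mulnDr.
  have hp1 := pre_frame hp0 fr1 (leqnn _).
  have [_ _ _ hr] := hp.
  have hp2 : pre (setv p x h.+1) (setv d x (nmd d e1)) h.+2 s1 (setv r x (nden M W r e1)).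
    by apply: pre_setv hp1 _ _ _ _ => //; apply: (proj1 nden_bound).
  apply: (runs_weaken (IH2 _ _ _ _ _ hp2 _ hl2) (leqnn _)) => [|s2 [fr2 v2]]; first lia.
  have b2 : nden M W (setv r x (nden M W r e1)) e2 <= B ^ H by apply: nb hp2 _; lia.
  apply: runs_push; [lia| |].
    by have := @stk_cost s2 h.+2; rewrite v2 => hc; have := hc _ b2; lia.
  split; last by rewrite /= /upd !eqxx v2.
  apply: frame_trans (leqnn _) _ (frame_setn _ _ (leqnn _)).
  have fr := frame_trans (leqnSn _) fr1 fr2.
  exact: frame_trans (leqnSn _) (frame_refl _ _) fr.
- move=> e IH p d h s r hp hh hl.
  apply: (@runs_seq _ _ _ (L * nct A e) (L * 20)); last by rewrite -mulnDr.
  apply: (runs_weaken (IH _ _ _ _ _ hp _ hl) (leqnn _)) => [|s1 [fr e1]]; first lia.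
  have hp1 := pre_frame hp fr (leqnn _); have [ag1 _ _ _] := hp1.
  have hv : nden M W r e <= B ^ H by apply: nb hp1 _; lia.
  apply: runs_rpush; [lia| |] => /=.
    by rewrite e1; have := bitlen_val hv; have := @bitlen_small h; lia.
  split; first exact: frame_rpush fr.
  by rewrite /= /upd !eqxx (proj2 ag1) e1.
- move=> x a e IH p d h s r hp hh /andP [hla hl].
  set N := M BPar a in hla *.
  have [ag _ _ hr] := hp.
  have NB : N <= B ^ H.
    by apply: leq_trans (MB _ _) _; rewrite -[X in X <= _]expn1 leq_pexp2l //; lia.
  have bb : bitlen 1 <= L by apply: bitlen_small; lia.
  apply: (@runs_seq _ _ _ (L * 3) (N * (L * (rct A e + 20) + 20 * L) + 20 * L)); last first.
    have : N * (L * (rct A e + 20) + 20 * L) <= A * (L * (rct A e + 20) + 20 * L).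
      by rewrite leq_mul2r hla orbT.
    move=> h0; apply: (leq_trans (leq_add (leqnn _) (leq_add h0 (leqnn _)))).
    rewrite !mulnDr; nia.
  apply: runs_rpush; [lia|rewrite /=; lia|].
  pose I i s' := frame h s s' /\ rmem s' 1 h = (\sum_(j < i) rden M W (setv r x j) e)%R.
  apply: (runs_weaken (@runs_for _ _ _ _ I _ _ _ _ _ _ _ _ _) (leqnn _)) => //; try lia.
  + by rewrite /= -[nmem s 0 a]/(nmem s (bcode BPar) a) (proj1 ag).
  + move=> i s' hi [fr hs] hc ha.
    have hp1 := pre_frame hp fr (leqnn _).
    have hp2 : pre (setv p x h.+1) (setv d x 1) h.+2 s' (setv r x i).
      apply: pre_setv hp1 _ _ _ _ => //; first lia.
      by rewrite expn1; apply: leq_trans (ltnW hi) (MB _ _).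
    apply: (@runs_seq _ _ _ (L * rct A e) (L * 20)); last by rewrite -mulnDr.
    apply: (runs_weaken (IH _ _ _ _ _ hp2 _ hl) (leqnn _)) => [|s1 [fr1 v1]]; first lia.
    have [f1 f2 f3 f4] := fr1.
    have w1 : rmem s1 1 h = (\sum_(j < i) rden M W (setv r x j) e)%R by rewrite f4 ?hs //; lia.
    apply: runs_rpush; [lia| |].
      by rewrite /=; have := @bitlen_small h; have := @bitlen_small h.+2; lia.
    split.
    * by rewrite /= f2 ?hc //.
    * by rewrite /= f1.
    * split; last by rewrite /= /upd !eqxx /= w1 v1 big_ord_recr.
      apply: frame_trans (leqnSn _) _ (frame_setn _ _ (leqnn _)).
      apply: frame_trans (leqnn _) _ (frame_setr _ _ (leqnn _)).
      by apply: frame_trans fr fr1; lia.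
  + split.
      apply: frame_trans (leqnSn _) _ (frame_setn _ _ (leqnn _)).
      exact: frame_setr.
    by rewrite /= /upd !eqxx /= big_ord0.
- move=> e1 IH1 e2 IH2 p d h s r hp hh; rewrite all_cat => /andP [hl1 hl2].
  apply: (@runs_seq _ _ _ (L * nct A e1) (L * (rct A e2 + 20))); last by rewrite -mulnDr addnA.
  apply: (runs_weaken (IH1 _ _ _ _ _ hp _ hl1) (leqnn _)) => [|s1 [fr1 v1]]; first lia.
  apply: (@runs_seq _ _ _ (L * rct A e2) (L * 20)); last by rewrite -mulnDr.
  have hp1 := pre_frame hp fr1 (leqnSn _).
  apply: (runs_weaken (IH2 _ _ _ _ _ hp1 _ hl2) (leqnn _)) => [|s2 [fr2 v2]]; first lia.
  have fr := frame_trans (leqnSn _) fr1 fr2.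
  have v1' : nmem s2 9 h = nden M W r e1 by case: fr2 => _ -> //.
  have b1 : nden M W r e1 <= B ^ H by apply: nb hp _; lia.
  have c1 : ncost s2 (stk h) <= 2 * L by apply: stk_cost; rewrite ?v1' //; lia.
  have bb : bitlen 1 <= L by apply: bitlen_small; lia.
  apply: (@runs_if _ _ _ _ (L * 10)); last first.
    rewrite -[bcost _ _]/(1 + (bitlen 1 + 0 + ncost s2 (stk h))); lia.
  have -> : beval s2 (BLeN (NConst 1) (stk h)) = (0 < nden M W r e1).
    by rewrite /= v1'.
  case: ifP => _; (apply: runs_rpush; [lia| rewrite /=; have := @bitlen_small h.+1; lia |];
   split; [exact: frame_rpush fr | by rewrite /= /upd !eqxx]).
Qed.

End Runs.

(** * Assignments *)

Definition memory := bank -> nat -> nat.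

Definition updM (M : memory) (b : bank) (i v : nat) : memory :=
  fun b' i' => if beq b' b && (i' == i) then v else M b' i'.

(** Used in three roles. As locations, [env0 1] puts variable 0 in stack cell 1 and all others in
    cell 0; as exponents, it bounds variable 0 by [B] and the others by 1; as values, [env0 i] gives
    variable 0 the value [i] and the others 0. Hence [rep] demands that stack cell 0 hold 0. *)
Definition env0 (i : nat) : nat -> nat := setv (fun=> 0) 0 i.

Definition store (b : bank) (e1 e2 : nx) : cmd :=
  Seq (ncomp (env0 1) 2 e1)
    (Seq (ncomp (env0 1) 3 e2) (NStore (bcode b) (stk 2) (stk 3))).

Definition store_for (a : nat) (b : bank) (e1 e2 : nx) : cmd :=
  for_loop 1 a (store b e1 e2).

Definition store_md (e1 e2 : nx) : nat := 3 + nmd (env0 1) e1 + nmd (env0 1) e2.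
Definition store_ct (A : nat) (e1 e2 : nx) : nat := nct A e1 + nct A e2 + 40.

Section Items.
Variables (R : realType) (W : nat -> R) (B H L : nat).
Hypotheses (B2 : 2 <= B) (BHL : B ^ H < 2 ^ L).

Definition rep (M : memory) (s : state R) := agree M W s /\ nmem s 9 0 = 0.

Definition bounded (M : memory) := forall b i, M b i <= B.

Definition loops_le (M : memory) (A : nat) (e1 e2 : nx) :=
  all (fun a => M BPar a <= A) (nloops e1 ++ nloops e2).

Lemma store_runs M s i A b e1 e2 :
  rep M s -> nmem s 9 1 = i -> i <= B -> bounded M -> loops_le M A e1 e2 ->
  store_md e1 e2 <= H ->
  runs (store b e1 e2) s (L * (nct A e1 + nct A e2 + 20))
    (fun s' => rep (updM M b (nden M W (env0 i) e1) (nden M W (env0 i) e2)) s'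
      /\ nmem s' 9 1 = i).
Proof.
move=> [ag s0] s1 iB MB; rewrite /loops_le all_cat => /andP [hl1 hl2] hH.
rewrite /store_md in hH.
have B0 : 0 < B := ltnW B2.
have hp : pre B M W (env0 1) (env0 1) 2 s (env0 i).
  split=> // x; rewrite /env0 /setv; case: (x == 0) => //.
have [[nbd _] hr] := (nden_bound B2 BHL W MB, let: And4 _ _ _ h := hp in h).
have v1 : nden M W (env0 i) e1 <= B ^ H.
  by apply: leq_trans (nbd _ _ _ hr) _; rewrite leq_pexp2l //; lia.
have v2 : nden M W (env0 i) e2 <= B ^ H.
  by apply: leq_trans (nbd _ _ _ hr) _; rewrite leq_pexp2l //; lia.
have L0 := L_gt0 B2 BHL.
apply: (@runs_seq _ _ _ _ (L * nct A e1) (L * (nct A e2 + 20))); last by rewrite -mulnDr addnA.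
apply: (runs_weaken (proj1 (comp_runs A B2 BHL W MB) _ _ _ _ _ _ hp _ hl1) (leqnn _)) => [|t1 [fr1 w1]]; first lia.
apply: (@runs_seq _ _ _ _ (L * nct A e2) (L * 20)); last by rewrite -mulnDr.
have hp1 := pre_frame hp fr1 (leqnSn _).
apply: (runs_weaken (proj1 (comp_runs A B2 BHL W MB) _ _ _ _ _ _ hp1 _ hl2) (leqnn _)) => [|t2 [fr2 w2]]; first lia.
have fr := frame_trans (leqnSn _) fr1 fr2.
have w1' : nmem t2 9 2 = nden M W (env0 i) e1 by case: fr2 => _ -> //.
have [f1 f2 f3 f4] := fr.
apply: runs_nstore.
  have c1 : ncost t2 (stk 2) <= 2 * L by apply: (stk_cost B2 BHL); rewrite ?w1' //; lia.
  have c2 : ncost t2 (stk 3) <= 2 * L by apply: (stk_cost B2 BHL); rewrite ?w2 //; lia.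
  lia.
have nb9 c : (9 == bcode c) = false by case: c.
rewrite /= w1' w2; split; last by rewrite /= /upd nb9 f2.
split; last by rewrite /= /upd nb9 f2.
have [ag1 ag2] := agree_frame ag fr.
split=> // c j; rewrite /= /upd /updM /beq; case: ifP => // _; exact: ag1.
Qed.

Lemma store1_runs M s A b e1 e2 :
  rep M s -> bounded M -> loops_le M A e1 e2 -> store_md e1 e2 <= H ->
  runs (Seq (push 1 (NConst 0)) (store b e1 e2)) s (L * store_ct A e1 e2)
    (rep (updM M b (nden M W (env0 0) e1) (nden M W (env0 0) e2))).
Proof.
move=> [ag s0] MB hl hH.
have L0 := L_gt0 B2 BHL; have b0 := bitlen_small B2 BHL (leq0n H).
apply: (@runs_seq _ _ _ _ (L * 20) (L * (nct A e1 + nct A e2 + 20))); last first.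
  by rewrite -mulnDr leq_mul2l /store_ct; lia.
apply: (runs_push B2 BHL); [by rewrite /store_md in hH; lia|by rewrite /=; lia|].
apply: (runs_weaken (@store_runs M _ 0 A b e1 e2 _ _ _ MB hl hH)) => // [|s' []//].
split=> //; exact: agree_frame ag (@frame_setn _ 0 1 _ _ _).
Qed.

(** The loop rereads its length from the parameter bank in each round, so the invariant must
    preserve that cell. *)
Lemma store_for_runs (Inv : nat -> memory -> Prop) N M s a A b e1 e2 :
  (forall i M', i <= N -> Inv i M' ->
    [/\ bounded M', M' BPar a = N & loops_le M' A e1 e2]) ->
  (forall i M', i < N -> Inv i M' -> 
    Inv i.+1 (updM M' b (nden M' W (env0 i) e1) (nden M' W (env0 i) e2))) ->
  store_md e1 e2 + a <= H ->
  rep M s -> Inv 0 M ->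
  runs (store_for a b e1 e2) s (N.+1 * (L * store_ct A e1 e2))
    (fun s' => exists2 M', rep M' s' & Inv N M').
Proof.
move=> hI hstep hH rp I0.
have L0 := L_gt0 B2 BHL.
pose I i s' := exists2 M', rep M' s' & Inv i M'.
have [MB MN _] := hI _ _ (leq0n N) I0.
have hm : 3 <= store_md e1 e2 by rewrite /store_md; lia.
have NBH : N <= B ^ H.
  rewrite -MN; apply: leq_trans (MB _ _) _.
  by rewrite -[X in X <= _]expn1 leq_pexp2l ?(ltnW B2) //; lia.
have repset M' s' v : rep M' s' -> rep M' (setn s' 9 1 v).
  move=> [ag z]; split=> //; exact: agree_frame ag (@frame_setn _ 0 1 _ _ _).
apply: (runs_weaken (@runs_for R B H L B2 BHL 1 a N _ I _ s _ NBH _ _ _ _ _)) => //; try lia.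
- by case: rp => [[ag _] _]; rewrite -MN -(ag BPar).
- move=> i s' hi [M' rp' Ii] hc ha.
  have [MB' MN' hl'] := hI _ _ (ltnW hi) Ii.
  have iB : i <= B by rewrite (leq_trans (ltnW hi)) // -MN' MB'.
  have sH : store_md e1 e2 <= H by lia.
  apply: (runs_weaken (@store_runs M' s' i A b e1 e2 rp' hc iB MB' hl' sH) (leqnn _)).
  move=> s2 [rp2 hc2].
  have I2 := hstep _ _ hi Ii.
  split=> //; last by exists (updM M' b (nden M' W (env0 i) e1) (nden M' W (env0 i) e2)); first exact: repset.
  by have [_ <- _] := hI _ _ hi I2; case: rp2 => [[ag _] _]; rewrite -(ag BPar).
- by exists M => //; exact: repset.
- rewrite /store_ct.
  set x := nct _ _ + _.
  have -> : L * (x + 40) = L * (x + 20) + 20 * L by lia.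
  by rewrite mulSn addnC leq_add2r; lia.
Qed.

End Items.

(** * The expressions of the algorithm *)

(* Cells of the parameter bank: [n], [k], the size of the table of powers of 2, *)
(* [L] with [n < 2 ^ L <= 2 * n], [D], [tau], [lam], [s], [b], and the numbers *)
(* of constraints, table rows, table cells and codes of colourings.            *)
Definition pN := 0.
Definition pK := 1.
Definition pX := 2.
Definition pL := 3.
Definition pD := 4.
Definition pT := 5.
Definition pLam := 6.
Definition pS := 7.
Definition pB := 8.
Definition pNP := 9.
Definition pF := 10.
Definition pFQ := 11.
Definition pZ := 12.
Definition pBest := 13.

Definition Par c := XLoad BPar (XConst c).
Definition XPw e := XLoad BPow e.
Definition XAdd := XBin OAdd.
Definition XMul := XBin OMul.
Definition XDiv := XBin ODiv.
Definition XNot e := XBin OSub (XConst 1) e.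
Definition XEq e1 e2 := XBin OMul (XLe e1 e2) (XLe e2 e1).
Definition XLt e1 e2 := XNot (XLe e2 e1).
Definition XAnd := XBin OMul.
Definition XImp := XLe.
Definition XAll x a e := XLe (XSum x a (XNot e)) (XConst 0).
Definition XMod e1 e2 := XBin OSub e1 (XMul (XDiv e1 e2) e2).
(** Minimisation by counting: the number of [y] such that no [x <= y] satisfies [e] is the least
    solution, if there is one. *)
Definition XFind x y a e :=
  XSum y a (XAll x a (XNot (XAnd (XLe (XVar x) (XVar y)) e))).

(** * Values of the derived operators *)

Section Macros.
Variables (R : realType) (M : memory) (W : nat -> R).
Local Notation "[[ e ]] r" := (nden M W r e) (at level 10, r at level 9).
Implicit Types (r : nat -> nat) (e : nx) (p q : bool).

Lemma setv_eq r x v : setv r x v x = v.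
Proof. by rewrite /setv eqxx. Qed.

Lemma setv_ne r x v y : y != x -> setv r x v y = r y.
Proof. by rewrite /setv => /negPf ->. Qed.

Lemma den_not r e p : [[e]] r = p -> [[XNot e]] r = ~~ p.
Proof. by move=> /= ->; case: p. Qed.

Lemma den_and r e1 e2 p q : [[e1]] r = p -> [[e2]] r = q -> [[XAnd e1 e2]] r = p && q.
Proof. by move=> /= -> ->; case: p; case: q. Qed.

Lemma den_imp r e1 e2 p q : [[e1]] r = p -> [[e2]] r = q -> [[XImp e1 e2]] r = (p ==> q).
Proof. by move=> /= -> ->; case: p; case: q. Qed.

Lemma den_eq r e1 e2 : [[XEq e1 e2]] r = ([[e1]] r == [[e2]] r).
Proof. by rewrite /= mulnb -eqn_leq. Qed.

Lemma den_le r e1 e2 : [[XLe e1 e2]] r = ([[e1]] r <= [[e2]] r).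
Proof. by []. Qed.

Lemma den_lt r e1 e2 : [[XLt e1 e2]] r = ([[e1]] r < [[e2]] r).
Proof. by rewrite ltnNge; apply: den_not. Qed.

Lemma den_mod r e1 e2 : [[XMod e1 e2]] r = [[e1]] r %% [[e2]] r.
Proof. by rewrite /= {1}(divn_eq ([[e1]] r) ([[e2]] r)) addKn. Qed.

Lemma den_sum r x a e : [[XSum x a e]] r = \sum_(i < M BPar a) [[e]] (setv r x i).
Proof. by []. Qed.

Lemma den_mul r e1 e2 : [[XMul e1 e2]] r = [[e1]] r * [[e2]] r.
Proof. by []. Qed.

Lemma den_div r e1 e2 : [[XDiv e1 e2]] r = [[e1]] r %/ [[e2]] r.
Proof. by []. Qed.

Lemma den_let r x e1 e2 : [[XLet x e1 e2]] r = [[e2]] (setv r x ([[e1]] r)).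
Proof. by []. Qed.

Lemma den_add r e1 e2 : [[XAdd e1 e2]] r = [[e1]] r + [[e2]] r.
Proof. by []. Qed.

Lemma den_load r a e : [[XLoad a e]] r = M a ([[e]] r).
Proof. by []. Qed.

Lemma den_par r c : [[Par c]] r = M BPar c.
Proof. by []. Qed.

Lemma den_leR r (e1 e2 : rx) : [[XLeR e1 e2]] r = (rden M W r e1 <= rden M W r e2)%R.
Proof. by []. Qed.

Lemma rden_sum r x a (e : rx) : rden M W r (RSum x a e) = (\sum_(i < M BPar a) rden M W (setv r x i) e)%R.
Proof. by []. Qed.

Lemma rden_if r e1 (e2 : rx) : rden M W r (RIf e1 e2) = if 0 < [[e1]] r then rden M W r e2 else 0%R.
Proof. by []. Qed.

Lemma rden_ld r e : rden M W r (RLd e) = W ([[e]] r).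
Proof. by []. Qed.

Lemma den_all r x a e (p : nat -> bool) :
  (forall i, i < M BPar a -> [[e]] (setv r x i) = p i) ->
  [[XAll x a e]] r = [forall i : 'I_(M BPar a), p i].
Proof.
move=> h; rewrite -[LHS]/(nat_of_bool (\sum_(i < M BPar a) [[XNot e]] (setv r x i) <= 0)).
congr nat_of_bool; rewrite leqn0.
rewrite (eq_bigr (fun i : 'I__ => nat_of_bool (~~ p i))) => [|i _]; last first.
  by apply: den_not; rewrite h.
by rewrite sum_nat_eq0; apply: eq_forallb => i; case: (p i).
Qed.

Lemma den_find r x y a e (p : nat -> bool) : x != y ->
  (forall i j, i < M BPar a -> [[e]] (setv (setv r y j) x i) = p i) ->
  (exists2 i, i < M BPar a & p i) ->
  [/\ [[XFind x y a e]] r < M BPar a, p ([[XFind x y a e]] r) &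
      forall i, i < [[XFind x y a e]] r -> ~~ p i].
Proof.
move=> xy h [i0 hi0 pi0].
have ex : exists i, p i by exists i0.
suff -> : [[XFind x y a e]] r = ex_minn ex.
  case: ex_minnP => m pm hm; split=> // [|i hi]; first exact: leq_ltn_trans (hm _ pi0) hi0.
  by apply/negP => /hm; rewrite leqNgt hi.
case: ex_minnP => m pm hm.
have mN : m < M BPar a by apply: leq_ltn_trans (hm _ pi0) hi0.
rewrite -[RHS](sum_ltn_min (ltnW mN)) [LHS]den_sum.
apply: eq_bigr => j _.
rewrite (@den_all _ _ _ _ (fun i => ~~ ((i <= j) && p i))) => [|i hi]; last first.
  apply: den_not; apply: den_and; last exact: h.
  by rewrite /= setv_eq setv_ne 1?eq_sym // setv_eq.
congr nat_of_bool; apply/forallP/idP => [hj|jm i].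
  by rewrite ltnNge; apply/negP => mj; have := hj (Ordinal mN); rewrite /= mj pm.
by apply/negP => /andP [ij /hm mi]; move: jm; rewrite ltnNge (leq_trans mi ij).
Qed.

Lemma den_sum_card r x a e n (p : pred 'I_n) : M BPar a = n ->
  (forall i : 'I_n, [[e]] (setv r x i) = p i) ->
  [[XSum x a e]] r = #|[set i | p i]|.
Proof.
move=> an h; rewrite den_sum an -sum1dep_card [RHS]big_mkcond; apply: eq_bigr => i _.
by rewrite h; case: (p i).
Qed.

End Macros.

(* Bound variables are chosen larger than the variables passed as arguments, so *)
(* that no capture occurs.                                                     *)
Definition eAdj x y := XLoad BAdj (XAdd (XMul (XVar x) (Par pN)) (XVar y)).
Definition eLay x := XLoad BLay (XVar x).
(** Layer 0 marks a vertex not yet removed; the one removed in round [i] gets layer [i + 1]. *)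
Definition eUnrem x := XEq (eLay x) (XConst 0).
Definition eDeg x := XSum 9 pN (XAnd (eUnrem 9) (eAdj x 9)).
Definition ePick :=
  XAnd (eUnrem 1) (XAll 2 pN (XImp (eUnrem 2) (XLe (eDeg 1) (eDeg 2)))).
Definition eOutdeg x := XSum 9 pN (XAnd (XLt (eLay x) (eLay 9)) (eAdj x 9)).

Definition eMu := XAdd (XMul (XConst 3) (Par pLam)) (XConst 1).
Definition ePhi := XAdd (XAdd (Par pS) (XMul (XConst 2) (Par pLam))) (XConst 4).
Definition eMu1 := XAdd eMu (XConst 1).
Definition eQ := XPw eMu.

Definition eDig x i := XDiv (XVar x) (XPw (XMul eMu1 (XVar i))).
Definition eEl x i := XDiv (XMod (eDig x i) (XPw eMu1)) (XConst 2).
Definition eBt x i := XMod (eDig x i) (XConst 2).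
Definition eTab r x i := XLoad BTab (XAdd (XMul (XVar r) eQ) (eEl x i)).
Definition eMatch x r := XAll 40 pS (XEq (eTab r x 40) (eBt x 40)).
Definition eValid x := XAll 40 pS (XAll 41 pS
  (XImp (XEq (eEl x 40) (eEl x 41)) (XEq (XVar 40) (XVar 41)))).
Definition eAlive x r := XAnd (eValid x)
  (XAll 30 pF (XImp (XLt (XVar 30) (XVar r)) (XNot (eMatch x 30)))).
Definition eCons x r j := XAll 40 pS
  (XImp (XLt (eEl x 40) (XVar j)) (XEq (eTab r x 40) (eBt x 40))).
Definition eOk x j c := XAll 40 pS
  (XImp (XEq (eEl x 40) (XVar j)) (XEq (eBt x 40) (XConst c))).
Definition eCnt x j := XSum 40 pS (XLt (eEl x 40) (XAdd (XVar j) (XConst 1))).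
Definition ePotential r j c := XSum 20 pNP
  (XMul (XAnd (XAnd (eAlive 20 r) (eCons 20 r j)) (eOk 20 j c)) (XPw (eCnt 20 j))).
Definition eLeaf := XLet 1 (XDiv (XVar 0) eQ) (XLet 2 (XMod (XVar 0) eQ)
  (XLe (ePotential 1 2 0) (ePotential 1 2 1))).

Definition eHash z v := XMod (XVar v) (XAdd (XMod (XVar z) eQ) (XConst 1)).
Definition eCut z i :=
  XMod (XDiv (XVar z) (XPw (XMul eMu (XAdd (XVar i) (XConst 1))))) eQ.
Definition eFun z i := XMod (XDiv (XVar z)
  (XPw (XAdd (XMul eMu (XAdd (Par pB) (XConst 1))) (XMul ePhi (XVar i))))) (XPw ePhi).
Definition eColor z v := XLet 50 (eHash z v)
  (XLet 51 (XSum 52 pB (XLt (eCut z 52) (XVar 50)))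
    (XLoad BTab (XAdd (XMul (eFun z 51) eQ) (XVar 50)))).
(* Everything is red when [D = 0]: the universal family would then be too large *)
(* for the time bound.                                                         *)
Definition eRed z v := XImp (XLe (XConst 1) (Par pD)) (XLe (XConst 1) (eColor z v)).
Definition eVal z v := RSum 40 pN
  (RIf (XNot (XAnd (XLt (eLay v) (eLay 40)) (eRed z 40)))
       (RLd (XAdd (XMul (XVar v) (Par pN)) (XVar 40)))).
Definition eBeats z u v :=
  XImp (XLeR (eVal z u) (eVal z v))
       (XAnd (XLt (XVar u) (XVar v)) (XLeR (eVal z v) (eVal z u))).
Definition eRank z v := XSum 30 pN (XAnd (eRed z 30) (eBeats z 30 v)).
Definition eIn z v := XAnd (eRed z v) (XLt (eRank z v) (Par pK)).
Definition eTot z := RSum 20 pN (RIf (eIn z 20) (eVal z 20)).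
Definition eCard z := XEq (XSum 20 pN (eIn z 20)) (Par pK).
Definition eBetter z z' :=
  XAnd (eCard z) (XImp (eCard z') (XLeR (eTot z') (eTot z))).
(** Natural expressions have no conditional, so the choice between the new and the old code is made
    arithmetically. *)
Definition eBest := XLet 1 (Par pBest) (XLet 2 (eBetter 0 1)
  (XAdd (XMul (XVar 2) (XVar 0)) (XMul (XNot (XVar 2)) (XVar 1)))).

(** * Values of the expressions of the algorithm *)

Lemma edge_atE n (G : sgraph 'I_n) (v u : 'I_n) :
  edge_at G (v * n + u) = if [set v; u] \in edges G then Some [set v; u] else None.
Proof.
rewrite /edge_at divnMDl; last exact: leq_ltn_trans (ltn_ord v).
by rewrite (divn_small (ltn_ord u)) addn0 modnMDl (modn_small (ltn_ord u)) !valK.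
Qed.

Section Den.
Variables (R : realType) (n k : nat) (G : sgraph 'I_n) (w : {set 'I_n} -> R).
Variables (M : memory) (W : nat -> R).
Hypotheses (Wedge : forall p, W p = oapp w 0%R (edge_at G p))
  (Madj : forall p, M BAdj p = isSome (edge_at G p))
  (MN : M BPar pN = n) (MK : M BPar pK = k).
Local Notation "[[ e ]] r" := (nden M W r e) (at level 10, r at level 9).
Implicit Types (r : nat -> nat).

Lemma den_adj r x y (v u : 'I_n) : r x = v -> r y = u ->
  [[eAdj x y]] r = ([set v; u] \in edges G).
Proof. by move=> hx hy; rewrite /= MN hx hy Madj edge_atE; case: ifP. Qed.

Lemma W_edge (v u : 'I_n) : W (v * n + u) = wt G w v u.
Proof. by rewrite Wedge edge_atE /wt; case: ifP. Qed.

Definition remdeg (lay : nat -> nat) (v : 'I_n) :=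
  #|[set u : 'I_n | (lay u == 0) && ([set v; u] \in edges G)]|.
Definition outdeg (lay : nat -> nat) (v : 'I_n) :=
  #|[set u : 'I_n | (lay v < lay u) && ([set v; u] \in edges G)]|.

Lemma den_deg r x (v : 'I_n) : r x = v -> x != 9 -> [[eDeg x]] r = remdeg (M BLay) v.
Proof.
move=> hx x9; apply: den_sum_card => // u; apply: den_and; first by rewrite den_eq.
by apply: den_adj => //; rewrite setv_ne.
Qed.

Lemma den_outdeg r x (v : 'I_n) : r x = v -> x != 9 ->
  [[eOutdeg x]] r = outdeg (M BLay) v.
Proof.
move=> hx x9; apply: den_sum_card => // u; apply: den_and.
  by rewrite den_lt /= setv_eq setv_ne // hx.
by apply: den_adj => //; rewrite setv_ne.
Qed.

Definition pickable (lay : nat -> nat) (v : 'I_n) := (lay v == 0) &&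
  [forall u : 'I_n, (lay u == 0) ==> (remdeg lay v <= remdeg lay u)].

Lemma den_pick r (v : 'I_n) : r 1 = v -> [[ePick]] r = pickable (M BLay) v.
Proof.
move=> h1; apply: den_and; first by rewrite den_eq /= h1.
rewrite (@den_all _ _ _ _ _ _ _ (fun i => if insub i is Some u then
  (M BLay (nat_of_ord u) == 0) ==> (remdeg (M BLay) v <= remdeg (M BLay) u) else true)).
  by rewrite MN; congr nat_of_bool; apply: eq_forallb => u; rewrite valK.
move=> i; rewrite MN => hi; rewrite insubT; apply: den_imp; first by rewrite den_eq.
by rewrite den_le (@den_deg _ 1 v) // (@den_deg _ 2 (Ordinal hi)).
Qed.

Variables (X lam s b D : nat).
Hypotheses (MX : forall i, i <= X -> M BPow i = 2 ^ i)
  (MLam : M BPar pLam = lam) (MS : M BPar pS = s) (MB : M BPar pB = b)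
  (MF : M BPar pF = 2 ^ phi lam s) (MNP : M BPar pNP = 2 ^ ((mu lam).+1 * s))
  (MD : M BPar pD = D).
Hypothesis XZ : mu lam * b.+1 + phi lam s * b <= X.
Hypothesis XNP : (mu lam).+1 * s <= X.
Hypotheses (b0 : 0 < b) (s0 : 0 < s).

Lemma den_mu r : [[eMu]] r = mu lam.
Proof. by rewrite /= MLam. Qed.

Lemma den_mu1 r : [[eMu1]] r = (mu lam).+1.
Proof. by rewrite /= MLam /mu addn1. Qed.

Lemma den_phi r : [[ePhi]] r = phi lam s.
Proof. by rewrite /= MLam MS. Qed.

Lemma den_pw r e v : [[e]] r = v -> v <= X -> [[XPw e]] r = 2 ^ v.
Proof. by move=> /= -> h; rewrite MX. Qed.

Lemma mu_le : mu lam <= X.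
Proof. by apply: leq_trans XZ; rewrite mulnS -addnA leq_addr. Qed.

Lemma den_Q r : [[eQ]] r = 2 ^ mu lam.
Proof. by rewrite (den_pw (den_mu _)) // mu_le. Qed.

Lemma den_dig r x i : r i < s ->
  [[eDig x i]] r = r x %/ 2 ^ ((mu lam).+1 * r i).
Proof.
move=> hi; rewrite /= -/(nden M W r (XMul eMu1 (XVar i))).
have e : [[XMul eMu1 (XVar i)]] r = (mu lam).+1 * r i by rewrite /= MLam addn1.
rewrite -[M BPow _]/([[XPw (XMul eMu1 (XVar i))]] r) (den_pw e) //.
by apply: leq_trans XNP; rewrite leq_mul2l (ltnW hi) orbT.
Qed.

Lemma den_el r x i : r i < s -> [[eEl x i]] r = uel lam (r x) (r i).
Proof.
move=> hi; rewrite -[LHS]/([[XMod (eDig x i) (XPw eMu1)]] r %/ 2) den_mod den_dig //.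
rewrite (den_pw (den_mu1 _)) //.
by apply: leq_trans XNP; rewrite leq_pmulr.
Qed.

Lemma den_bt r x i : r i < s -> [[eBt x i]] r = ubt lam (r x) (r i).
Proof. by move=> hi; rewrite den_mod den_dig. Qed.

Local Notation Q := (2 ^ mu lam).
Local Notation T := (M BTab).
Local Notation el := (uel lam).
Local Notation bt := (ubt lam).

Lemma den_tab r q x i : r i < s -> [[eTab q x i]] r = T (r q * Q + el (r x) (r i)).
Proof.
by move=> hi; rewrite -[LHS]/(T ([[XVar q]] r * [[eQ]] r + [[eEl x i]] r)) den_Q den_el.
Qed.

Lemma den_alls r x e (p : nat -> bool) :
  (forall i, i < s -> [[e]] (setv r x i) = p i) ->
  [[XAll x pS e]] r = [forall i : 'I_s, p i].
Proof. by move=> h; rewrite (@den_all _ _ _ _ _ _ _ p) MS. Qed.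

Lemma den_match r x q : x < 40 -> q < 40 ->
  [[eMatch x q]] r = gmatch s Q el bt T (r x) (r q).
Proof.
move=> hx hq; apply: (@den_alls _ _ _ (fun i => T (r q * Q + el (r x) i) == bt (r x) i)) => i hi.
by rewrite den_eq den_tab ?den_bt ?setv_eq // !setv_ne //; lia.
Qed.

Lemma den_valid r x : x < 40 -> [[eValid x]] r = gvalid s el (r x).
Proof.
move=> hx; apply: (@den_alls _ _ _ (fun i => [forall j : 'I_s, (el (r x) i == el (r x) j) ==> (i == j)])) => i hi.
apply: (@den_alls _ _ _ (fun j => (el (r x) i == el (r x) j) ==> (i == j))) => j hj.
apply: den_imp; rewrite den_eq ?den_el /= ?setv_eq //; rewrite (setv_ne _ _ (y := 40)) // ?setv_eq //.
by rewrite !setv_ne //; lia.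
Qed.

Lemma den_alive r x q : x < 30 -> q < 30 ->
  [[eAlive x q]] r = galive (2 ^ phi lam s) s Q el bt T (r x) (r q).
Proof.
move=> hx hq; apply: den_and; first by rewrite den_valid //; lia.
rewrite (@den_all _ _ _ _ _ _ _ (fun j => (j < r q) ==> ~~ gmatch s Q el bt T (r x) j)) ?MF // => j hj.
apply: den_imp; first by rewrite den_lt /= setv_eq setv_ne //; lia.
by apply: den_not; rewrite den_match ?setv_eq ?setv_ne //; lia.
Qed.

Lemma den_cons r x q j : x < 40 -> q < 40 -> j < 40 ->
  [[eCons x q j]] r = gcons s Q el bt T (r x) (r q) (r j).
Proof.
move=> hx hq hj; apply: (@den_alls _ _ _ (fun i => (el (r x) i < r j) ==> (T (r q * Q + el (r x) i) == bt (r x) i))) => i hi.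
apply: den_imp; first by rewrite den_lt den_el /= ?setv_eq // !setv_ne //; lia.
by rewrite den_eq den_tab ?den_bt ?setv_eq // !setv_ne //; lia.
Qed.

Lemma den_ok r x j c : x < 40 -> j < 40 -> [[eOk x j c]] r = gok s el bt (r x) (r j) c.
Proof.
move=> hx hj; apply: (@den_alls _ _ _ (fun i => (el (r x) i == r j) ==> (bt (r x) i == c))) => i hi.
apply: den_imp; first by rewrite den_eq den_el /= ?setv_eq // !setv_ne //; lia.
by rewrite den_eq den_bt /= ?setv_eq // !setv_ne //; lia.
Qed.

Lemma den_cnt r x j : x < 40 -> j < 40 -> [[eCnt x j]] r = gcnt s el (r x) (r j).+1.
Proof.
move=> hx hj; rewrite [LHS]den_sum MS.
apply: eq_bigr => i _; rewrite den_lt den_el ?setv_eq //= addn1 !setv_ne //; lia.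
Qed.

Lemma gcnt_le x j : gcnt s el x j <= s.
Proof.
apply: (@leq_trans (\sum_(i < s) 1)); first by apply: leq_sum => i _; exact: leq_b1.
by rewrite sum_nat_const card_ord muln1.
Qed.

Lemma den_potential r q j c : q < 20 -> j < 20 ->
  [[ePotential q j c]] r = gphi (2 ^ ((mu lam).+1 * s)) (2 ^ phi lam s) s Q el bt T (r q) (r j) c.
Proof.
move=> hq hj; rewrite [LHS]den_sum MNP.
apply: eq_bigr => P _; rewrite den_mul.
have h1 : setv r 20 P q = r q by rewrite setv_ne //; lia.
have h2 : setv r 20 P j = r j by rewrite setv_ne //; lia.
congr (_ * _).
  apply: den_and; last by rewrite den_ok ?setv_eq ?h2 //; lia.
  apply: den_and; first by rewrite den_alive ?setv_eq ?h1 //; lia.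
  by rewrite den_cons ?setv_eq ?h1 ?h2 //; lia.
rewrite (den_pw (den_cnt _ _ _)) ?setv_eq ?h2 //; try lia.
by apply: leq_trans (gcnt_le _ _) _; apply: leq_trans XNP; rewrite leq_pmull.
Qed.

Lemma den_leaf x :
  [[eLeaf]] (env0 x) =
    (gphi (2 ^ ((mu lam).+1 * s)) (2 ^ phi lam s) s Q el bt T (x %/ Q) (x %% Q) 0 <=
     gphi (2 ^ ((mu lam).+1 * s)) (2 ^ phi lam s) s Q el bt T (x %/ Q) (x %% Q) 1).
Proof.
rewrite /eLeaf !den_let den_le !den_potential // !setv_eq den_mod den_div !den_Q.
by rewrite !(@setv_ne _ 2 _ 1) // !setv_eq.
Qed.

Lemma den_hash r z v : [[eHash z v]] r = uhash lam (r z) (r v).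
Proof. by rewrite den_mod den_add den_mod den_Q /= addn1. Qed.

Lemma den_cut r z i : r i < b -> [[eCut z i]] r = ucut lam (r z) (r i).
Proof.
move=> hi; rewrite den_mod den_div den_Q (@den_pw _ _ (mu lam * (r i).+1)) //.
  by rewrite den_mul den_mu den_add /= addn1.
by apply: leq_trans XZ; rewrite (leq_trans _ (leq_addr _ _)) // leq_mul2l ltnS (ltnW hi) orbT.
Qed.

Lemma den_fun r z i : r i <= b -> [[eFun z i]] r = ufun lam s b (r z) (r i).
Proof.
move=> hi; rewrite den_mod den_div (@den_pw _ _ (mu lam * b.+1 + phi lam s * r i)).
- rewrite (den_pw (den_phi _)) //; apply: leq_trans XZ.
  by rewrite (leq_trans _ (leq_addl _ _)) // leq_pmulr.
- by rewrite den_add !den_mul den_mu den_phi den_add /= MB addn1.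
- by apply: leq_trans XZ; rewrite leq_add2l leq_mul2l hi orbT.
Qed.

Lemma ublock_le z y : ublock lam b z y <= b.
Proof.
apply: (@leq_trans (\sum_(i < b) 1)); first by apply: leq_sum => i _; exact: leq_b1.
by rewrite sum_nat_const card_ord muln1.
Qed.

Lemma den_color r z v : z < 50 -> v < 50 -> [[eColor z v]] r = ucolor lam s b T (r z) (r v).
Proof.
move=> hz hv; rewrite /eColor !den_let den_hash; set h := uhash _ _ _.
have zne y : 50 <= y -> z != y by move=> ?; apply/eqP; lia.
have -> : [[XSum 52 pB (XLt (eCut z 52) (XVar 50))]] (setv r 50 h) = ublock lam b (r z) h.
  rewrite den_sum MB; apply: eq_bigr => i _; rewrite den_lt den_cut ?setv_eq //.
  by rewrite !setv_ne ?zne // setv_eq.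
rewrite den_load den_add den_mul den_Q den_fun ?setv_eq ?ublock_le //.
by rewrite !(@setv_ne _ 51) ?zne // !setv_ne ?zne.
Qed.

Definition redp z (v : nat) := (0 < D) ==> (0 < ucolor lam s b T z v).

Lemma den_red r z v : z < 50 -> v < 50 -> [[eRed z v]] r = redp (r z) (r v).
Proof.
move=> hz hv; apply: den_imp; first by rewrite den_le den_load MD.
by rewrite den_le den_color.
Qed.

Local Notation lay := (fun u : 'I_n => M BLay u).
Local Notation rp z := (fun u : 'I_n => redp z u).
Local Notation cv z := (cval G w lay (rp z)).

Lemma den_val r z v (v' : 'I_n) : z < 40 -> v < 40 -> r v = v' ->
  rden M W r (eVal z v) = cv (r z) v'.
Proof.
move=> hz hv hv'; rewrite rden_sum MN; apply: eq_bigr => u _.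
have zne : z != 40 by apply/eqP; lia.
have vne : v != 40 by apply/eqP; lia.
rewrite rden_if rden_ld den_add den_mul den_par MN.
rewrite (@den_not _ _ _ _ _ ((M BLay v' < M BLay u) && redp (r z) u)); last first.
  apply: den_and; first by rewrite den_lt !den_load /= setv_eq setv_ne // hv'.
  by rewrite den_red // ?setv_eq ?setv_ne //; lia.
by rewrite /= setv_eq setv_ne // hv' W_edge; case: (_ && _).
Qed.

Lemma den_beats r z u v (u' v' : 'I_n) : z < 40 -> v < 40 -> u < 40 ->
  r u = u' -> r v = v' -> [[eBeats z u v]] r = beats (cv (r z)) u' v'.
Proof.
move=> hz hv hu eu ev; rewrite /beats -implybE; apply: den_imp.
  by rewrite den_leR (den_val _ _ eu) // (den_val _ _ ev).
apply: den_and; first by rewrite den_lt /= eu ev.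
by rewrite den_leR (den_val _ _ eu) // (den_val _ _ ev).
Qed.

Lemma den_rank r z v (v' : 'I_n) : z < 30 -> v < 30 -> r v = v' ->
  [[eRank z v]] r = rank (cv (r z)) (rp (r z)) v'.
Proof.
move=> hz hv ev; apply: den_sum_card => // u.
have zne : z != 30 by apply/eqP; lia.
apply: den_and; first by rewrite den_red ?setv_eq ?setv_ne //; lia.
rewrite (@den_beats _ _ _ _ u v') ?setv_eq ?setv_ne //; lia.
Qed.

Local Notation sel z := (topk (cv z) (rp z) k).

Lemma den_in r z v (v' : 'I_n) : z < 30 -> v < 30 -> r v = v' ->
  [[eIn z v]] r = (v' \in sel (r z)).
Proof.
move=> hz hv ev; rewrite inE; apply: den_and; first by rewrite den_red ?ev //; lia.
by rewrite den_lt (den_rank _ _ ev) // den_par MK.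
Qed.

Lemma den_tot r z : z < 20 ->
  rden M W r (eTot z) = (\sum_(v in sel (r z)) cv (r z) v)%R.
Proof.
move=> hz; rewrite rden_sum MN [RHS]big_mkcond; apply: eq_bigr => v _.
have zne : z != 20 by apply/eqP; lia.
rewrite rden_if (@den_in _ _ _ v) ?setv_eq //; last lia.
rewrite (@den_val _ _ _ v) ?setv_eq //; last lia.
by rewrite setv_ne //; case: (_ \in _).
Qed.

Lemma den_card r z : z < 20 -> [[eCard z]] r = (#|sel (r z)| == k).
Proof.
move=> hz; rewrite den_eq den_par MK.
have zne : z != 20 by apply/eqP; lia.
rewrite (@den_sum_card _ _ _ _ _ _ _ n (fun v => v \in sel (r z))) // => [|v].
  by congr (nat_of_bool (_ == _)); apply: eq_card => v; rewrite inE.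
by rewrite (@den_in _ _ _ v) ?setv_eq ?setv_ne //; lia.
Qed.

Definition betterp z z' := (#|sel z| == k) && ((#|sel z'| == k) ==>
  (\sum_(v in sel z') cv z' v <= \sum_(v in sel z) cv z v)%R).

Lemma den_best z :
  [[eBest]] (env0 z) = if betterp z (M BPar pBest) then z else M BPar pBest.
Proof.
rewrite /eBest !den_let den_par.
rewrite (@den_and _ _ _ _ _ _ (#|sel z| == k) ((#|sel (M BPar pBest)| == k) ==>
  (\sum_(v in sel (M BPar pBest)) cv (M BPar pBest) v <= \sum_(v in sel z) cv z v)%R)).
- rewrite -/(betterp _ _) den_add !den_mul.
  rewrite (@den_not _ _ _ _ _ (betterp z (M BPar pBest))) /= ?setv_eq //.
  rewrite !(@setv_ne _ 2) // !(@setv_ne _ 1 _ 0) // !setv_eq.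
  by case: betterp; rewrite /= !(mul0n, mul1n, add0n, addn0).
- by rewrite den_card // setv_ne.
- by apply: den_imp; rewrite ?den_card ?den_leR ?den_tot // !setv_eq // setv_ne // setv_eq.
Qed.

Lemma den_out (v : 'I_n) :
  [[XLet 1 (Par pBest) (eIn 1 0)]] (env0 v) = (v \in sel (M BPar pBest)).
Proof. by rewrite den_let den_par (@den_in _ _ _ v) // setv_eq. Qed.

End Den.

(** * Degeneracy orderings *)

Section Peeling.
Variables (n d : nat) (G : sgraph 'I_n).
Implicit Types (lay : nat -> nat).

(** The last clause counts unremoved neighbours among the later ones, so the bound for a removed
    vertex survives all further removals. *)
Definition peeled i lay := [/\ forall v : 'I_n, lay v <= i,
  #|[set v : 'I_n | lay v == 0]| = n - i,
  forall v u : 'I_n, lay v != 0 -> lay v = lay u -> v = u &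
  forall v : 'I_n, lay v != 0 ->
    #|[set u : 'I_n | ((lay u == 0) || (lay v < lay u)) && ([set v; u] \in edges G)]| <= d].

Lemma pickable_exists i lay : i < n -> peeled i lay -> exists r : 'I_n, pickable G lay r.
Proof.
move=> ilt [_ hc _ _].
have [v0] : exists v0 : 'I_n, lay v0 == 0.
  have : 0 < #|[set v : 'I_n | lay v == 0]| by rewrite hc subn_gt0.
  by rewrite card_gt0 => /set0Pn [v]; rewrite inE; exists v.
move=> h0; case: (@arg_minnP _ v0 (fun v : 'I_n => lay v == 0) (remdeg G lay) h0) => r hr hmin.
by exists r; rewrite /pickable hr; apply/forallP => u; apply/implyP => /hmin.
Qed.

Hypothesis dG : degenerate G d.

(** Degeneracy is applied to the subgraph induced by the unremoved vertices: its vertex of degree at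
    most [d] bounds the minimum. The map from [u] to [[set v; u]] turns neighbours injectively into
    incident edges. *)
Lemma pickable_deg lay (r : 'I_n) : pickable G lay r -> remdeg G lay r <= d.
Proof.
move=> /andP [hr /forallP hmin].
set U := [set v : 'I_n | lay v == 0].
set F := [set e in edges G | e \subset U].
have [||v vU hv] := dG (U := U) (F := F).
- split; first by apply/subsetP => e; rewrite inE => /andP [].
  by move=> e; rewrite inE => /andP [].
- by apply/set0Pn; exists r; rewrite inE.
rewrite inE in vU; have /implyP/(_ vU) := hmin v => h; apply: leq_trans h _.
apply: leq_trans hv.
rewrite /remdeg -(@card_in_imset _ _ (fun u => [set v; u])) => [|u u'].
  apply: subset_leq_card; apply/subsetP => e /imsetP [u]; rewrite inE => /andP [u0 uE] ->.
  rewrite !inE uE eqxx /= andbT; apply/subsetP => x; rewrite !inE => /orP [/eqP ->|/eqP ->] //.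
rewrite !inE => /andP [_ uE] /andP [_ uE'] e.
have : u \in [set v; u'] by rewrite -e !inE eqxx orbT.
rewrite !inE => /orP [/eqP uv|/eqP //].
by move: (card_edge uE); rewrite uv setUid cards1.
Qed.

Lemma peeled0 lay : (forall v, lay v = 0) -> peeled 0 lay.
Proof.
move=> h; split=> [v||v u|v]; rewrite ?h //.
rewrite (_ : [set _ | _] = setT) ?cardsT ?card_ord ?subn0 //.
by apply/setP => v; rewrite !inE h.
Qed.

Lemma peeledS i lay lay' (r : 'I_n) : i < n -> peeled i lay -> pickable G lay r ->
  (forall v : 'I_n, lay' v = if v == r then i.+1 else lay v) -> peeled i.+1 lay'.
Proof.
move=> ilt [h1 h2 h3 h4] pr hl; have dr := pickable_deg pr.
have /andP [/eqP r0 _] := pr.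
split.
- by move=> v; rewrite hl; case: (eqVneq v r) => // _; have := h1 v; lia.
- have := cardsD1 r [set v : 'I_n | lay v == 0]; rewrite h2 inE r0 eqxx /= => e.
  rewrite (_ : [set _ | _] = [set v : 'I_n | lay v == 0] :\ r); first by move: e; lia.
  by apply/setP => v; rewrite !inE hl; case: (v == r).
- move=> v u; rewrite !hl; case: (eqVneq v r) => [->|_]; case: (eqVneq u r) => [->|_] //.
  + by move=> _ e; have := h1 u; lia.
  + by move=> _ e; have := h1 v; lia.
  + exact: h3.
- move=> v; rewrite hl; case: (eqVneq v r) => [->|nv] hv.
    apply: leq_trans dr; apply: subset_leq_card; apply/subsetP => u.
    rewrite !inE hl => /andP [+ ->]; rewrite andbT; case: (eqVneq u r) => [_|_].
      by rewrite ltnn.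
    by have := h1 u; lia.
  apply: leq_trans (h4 v hv); apply: subset_leq_card; apply/subsetP => u.
  by rewrite !inE hl => /andP [+ ->]; rewrite andbT; case: (eqVneq u r) => // ->; rewrite r0.
Qed.

Lemma peeled_n lay : peeled n lay ->
  injective (fun v : 'I_n => lay v) /\ forall v : 'I_n, outdeg G lay v <= d.
Proof.
move=> [h1 h2 h3 h4].
have nz (v : 'I_n) : lay v != 0.
  move: h2; rewrite subnn => /eqP; rewrite cards_eq0 => /eqP h.
  by apply/negP => hv; have : v \in [set v : 'I_n | lay v == 0]; [by rewrite inE | by rewrite h inE].
split=> [v u|v]; first exact: h3.
apply: leq_trans (h4 v (nz v)); apply: subset_leq_card; apply/subsetP => u.
by rewrite !inE => /andP [-> ->]; rewrite orbT.
Qed.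

(** Guarantees that the search for [D] among the numbers below [n] succeeds. *)
Lemma outdeg_lt lay (v : 'I_n) : outdeg G lay v < n.
Proof.
rewrite -[X in _ < X]card_ord -cardsT; apply: proper_card; apply/properP; split.
  exact: subsetT.
by exists v; rewrite !inE ?ltnn.
Qed.

End Peeling.

Section OutNeighbourhood.
Variables (n k D : nat) (G : sgraph 'I_n) (lay : nat -> nat).
Hypothesis outD : forall v : 'I_n, outdeg G lay v <= D.

Lemma card_out_neighbours (S : {set 'I_n}) : #|S| = k ->
  #|S :|: \bigcup_(v in S) [set u : 'I_n | (lay v < lay u) && ([set v; u] \in edges G)]| <= k * D + k.
Proof.
move=> <-; apply: leq_trans (leq_card_setU _ _) _; rewrite addnC leq_add2r.
apply: (@leq_trans (\sum_(v in S) outdeg G lay v)).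
  apply: (big_ind2 (fun (A : {set 'I_n}) m => #|A| <= m)) => //; first by rewrite cards0.
  by move=> A m A' m' h h'; apply: leq_trans (leq_card_setU _ _) _; apply: leq_add.
apply: (@leq_trans (\sum_(v in S) D)); first by apply: leq_sum.
by rewrite sum_nat_const.
Qed.

End OutNeighbourhood.

(** * Asymptotics *)

(* Bounds all exponents of 2 that the algorithm needs, see [params_le].         *)
Definition Xn n := 10 * (10 * (10 * (n * n * (n * n)))).

Lemma sqr_le_pow l : l ^ 2 <= 2 ^ l.+1.
Proof.
do 3 (case: l => // l).
elim: l => // l IH; rewrite [2 ^ _]expnS; move: IH; rewrite -!mulnn; nia.
Qed.

(** [lam] is at most [log m + log L + O(1)], and Cauchy's inequality separates the squares. In
    [2 ^ O(lam ^ 2)] the first square then gives [m ^ O(log m)], while [(log L) ^ 2 = O(L)] gives a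
    power of [2 ^ L], that is, of [n]. *)
Lemma lam_sqr_bound m L t lam : 0 < L -> t <= 2 * m + L ->
  (lam = 0 \/ 2 ^ lam.-1 < t) ->
  lam.+1 ^ 2 <= 3 * (trunc_log 2 m ^ 2 + 4 * L + 9).
Proof.
move=> L0 tm hlam; set a := trunc_log 2 m; set l := (trunc_log 2 L).+1.
have ma : m < 2 ^ a.+1 by apply: trunc_log_ltn.
have Ll : L < 2 ^ l by apply: trunc_log_ltn.
have l2 : l ^ 2 <= 4 * L.
  apply: leq_trans (sqr_le_pow _) _; rewrite /l !expnS mulnA leq_mul2l.
  by rewrite trunc_logP ?orbT.
clearbody a l; have ll : lam <= a + l + 2.
  case: hlam => [-> //|h]; have : 2 ^ lam.-1 < 2 ^ (a + l + 2).
    apply: leq_trans h _; apply: leq_trans tm _.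
    have e : 2 ^ (a + l + 2) = 2 * 2 ^ a.+1 * 2 ^ l.
      by rewrite -expnS -expnD; congr (_ ^ _); lia.
    have : 0 < 2 ^ a.+1 by rewrite expn_gt0.
    rewrite e; nia.
  rewrite ltn_exp2l // => h'; clear -h'; lia.
have : lam.+1 ^ 2 <= (a + l + 3) ^ 2 by rewrite leq_sqr; lia.
have c1 := nat_Cauchy a l; have c2 := nat_Cauchy a 3; have c3 := nat_Cauchy l 3.
have -> : (a + l + 3) ^ 2 = a ^ 2 + l ^ 2 + 9 + 2 * (a * l) + 2 * (a * 3) + 2 * (l * 3).
  by rewrite -!mulnn; lia.
by case: c1 c2 c3 => c1 _ [c2 _] [c3 _]; move: c1 c2 c3; rewrite !expnS !expn0; lia.
Qed.

(** The two bounds on [t] have different tasks: the sharp one yields [2 ^ (k * d + k)], the one free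
    of a separate [k] bounds [lam] in terms of [k * d]. The three summands of [C] serve as the
    leading constant, the exponent of [n] and the exponent of [k * d]. *)
Lemma time_final c0 c1 c2 : exists C, forall n d k L t lam T,
  0 < n -> 0 < L -> 2 ^ L <= 2 * n -> t <= k * d + k + L -> t <= 2 * (k * d) + L ->
  (lam = 0 \/ 2 ^ lam.-1 < t) ->
  T <= c0 * Xn n ^ c1 * 2 ^ (t + c2 * lam.+1 ^ 2) ->
  T <= time_bound C n d k.
Proof.
pose K := c0 * 1000 ^ c1 * 2 * 2 ^ (12 * c2) * 2 ^ (27 * c2).
pose e := 4 * c1 + 1 + 12 * c2.
exists (K + e + 3 * c2) => n d k L t lam T n0 L0 hL ht1 ht2 hlam hT.
set C := _ + _; have CK : K <= C by rewrite /C; lia.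
have Ce : e <= C by rewrite /C; lia.
have C3 : 3 * c2 <= C by rewrite /C; lia.
apply: leq_trans hT _; rewrite /time_bound.
have hlam2 := lam_sqr_bound L0 ht2 hlam.
set a := trunc_log 2 (k * d) in hlam2 *.
have hX : Xn n ^ c1 = 1000 ^ c1 * n ^ (4 * c1).
  rewrite expnM -expnMn; congr (_ ^ _); rewrite /Xn !expnS expn0; lia.
have h1 : 2 ^ t <= 2 ^ (k * d + k) * (2 * n).
  apply: (@leq_trans (2 ^ (k * d + k + L))); first by rewrite leq_exp2l.
  by rewrite expnD leq_mul2l hL orbT.
have ha : 2 ^ (3 * c2 * a ^ 2) <= (k * d) ^ (C * a).
  apply: (@leq_trans ((k * d) ^ (3 * c2 * a))); last first.
    case: (posnP (k * d)) => [e0|p]; first by rewrite /a e0 trunc_log0 !muln0.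
    by rewrite leq_pexp2l // leq_mul2r C3 orbT.
  have -> : 3 * c2 * a ^ 2 = a * (3 * c2 * a) by rewrite -mulnn; lia.
  rewrite expnM; case: (posnP (k * d)) => [e0|p]; first by rewrite /a e0 trunc_log0 !muln0.
  case: (posnP (3 * c2 * a)) => [-> //|p2]; rewrite leq_exp2r //.
  by apply: trunc_logP.
have h2 : 2 ^ (c2 * lam.+1 ^ 2) <= (k * d) ^ (C * a) * ((2 * n) ^ (12 * c2)) * 2 ^ (27 * c2).
  apply: (@leq_trans (2 ^ (3 * c2 * a ^ 2 + L * (12 * c2) + 27 * c2))).
    rewrite leq_exp2l //; apply: leq_trans (leq_mul (leqnn c2) hlam2) _; lia.
  rewrite [2 ^ (_ + 27 * c2)]expnD [2 ^ (3 * c2 * a ^ 2 + _)]expnD [2 ^ (L * _)]expnM leq_mul2r; apply/orP; right.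
  apply: (leq_mul ha); case: (posnP (12 * c2)) => [-> //|p]; by rewrite leq_exp2r.
have hn : n ^ (4 * c1) * n * n ^ (12 * c2) <= n ^ C.
  by rewrite -{2}[n]expn1 -!expnD leq_pexp2l.
rewrite hX [2 ^ (t + _)]expnD.
apply: leq_trans (leq_mul (leqnn _) (leq_mul h1 h2)) _.
rewrite [(2 * n) ^ (12 * c2)]expnMn.
have -> : c0 * (1000 ^ c1 * n ^ (4 * c1)) * (2 ^ (k * d + k) * (2 * n) *
   ((k * d) ^ (C * a) * (2 ^ (12 * c2) * n ^ (12 * c2)) * 2 ^ (27 * c2))) =
  K * 2 ^ (k * d + k) * (k * d) ^ (C * a) * (n ^ (4 * c1) * n * n ^ (12 * c2)).
  rewrite /K; move: (1000 ^ c1) (n ^ (4 * c1)) (2 ^ (k * d + k)) ((k * d) ^ _) (2 ^ (12 * c2))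
    (n ^ (12 * c2)) (2 ^ (27 * c2)) => x1 x2 x3 x4 x5 x6 x7; lia.
apply: leq_mul hn; apply: leq_mul => //; apply: leq_mul => //.
Qed.

(** * The program *)

Definition store1 b e1 e2 := Seq (push 1 (NConst 0)) (store b e1 e2).

Definition eX := let n := Par pN in XMul (XConst 10) (XMul (XConst 10)
  (XMul (XConst 10) (XMul (XMul n n) (XMul n n)))).
Definition eNext := XAdd (XVar 0) (XConst 1).
Definition eDouble := XAdd (XPw (XVar 0)) (XPw (XVar 0)).
Definition eOrder := XFind 1 4 pN ePick.
Definition eD := XFind 3 4 pN (XAll 1 pN (XLe (eOutdeg 1) (XVar 3))).
Definition eL := XFind 1 4 pX (XLt (Par pN) (XPw (XVar 1))).
(** Dropping the summand [k] when [D = 0] ensures [tau <= 2 * (k * D) + L], so [lam] depends on [k]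
    only through [k * D]. The summand [L] makes [lam] large enough to hash [n <= 2 ^ L] vertices. *)
Definition eT := XAdd (XAdd (XMul (Par pK) (Par pD))
  (XMul (Par pK) (XLe (XConst 1) (Par pD)))) (Par pL).
(** The added 1 makes [lam] positive. *)
Definition eLam := XAdd (XFind 1 4 pX (XLe (Par pT) (XPw (XVar 1)))) (XConst 1).
(* With [b = 9 * lam + 12] the greedy construction, of cost about              *)
(* [2 ^ ((9 * lam + 10) * s)], stays below [2 ^ (b * s)].                      *)
Definition eB := XAdd (XMul (XConst 9) (Par pLam)) (XConst 12).
Definition eS := XAdd (XDiv (Par pT) (Par pB)) (XConst 1).
Definition eNP := XPw (XMul eMu1 (Par pS)).
Definition eF := XPw ePhi.
Definition eFQ := XPw (XAdd ePhi eMu).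
Definition eZ := XPw (XAdd (XMul eMu (XAdd (Par pB) (XConst 1))) (XMul ePhi (Par pB))).
Definition eOut := XLet 1 (Par pBest) (eIn 1 0).

Definition prog_init : cmd :=
  Seq (store1 BPar (XConst pX) eX)
 (Seq (store1 BPow (XConst 0) (XConst 1))
 (Seq (store_for pX BPow eNext eDouble)
      (store_for pN BLay eOrder eNext))).

Definition prog_params : cmd :=
  Seq (store1 BPar (XConst pD) eD)
 (Seq (store1 BPar (XConst pL) eL)
 (Seq (store1 BPar (XConst pT) eT)
 (Seq (store1 BPar (XConst pLam) eLam)
 (Seq (store1 BPar (XConst pB) eB)
 (Seq (store1 BPar (XConst pS) eS)
 (Seq (store1 BPar (XConst pNP) eNP)
 (Seq (store1 BPar (XConst pF) eF)
 (Seq (store1 BPar (XConst pFQ) eFQ)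
      (store1 BPar (XConst pZ) eZ))))))))).

Definition prog : cmd :=
  Seq prog_init
 (Seq prog_params
 (Seq (store_for pFQ BTab (XVar 0) eLeaf)
 (Seq (store_for pZ BPar (XConst pBest) eBest)
      (store_for pN BOut (XVar 0) eOut)))).

(** All pairs of address and value stored by [prog]; maxima over this fixed list give constants
    independent of the input without computing them. *)
Definition items : seq (nx * nx) :=
  [:: (XConst pX, eX); (XConst 0, XConst 1); (eNext, eDouble); (eOrder, eNext);
      (XConst pD, eD); (XConst pL, eL); (XConst pT, eT); (XConst pLam, eLam);
      (XConst pB, eB); (XConst pS, eS); (XConst pNP, eNP); (XConst pF, eF);
      (XConst pFQ, eFQ); (XConst pZ, eZ); (XVar 0, eLeaf); (XConst pBest, eBest);
      (XVar 0, eOut)].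

(** Loop invariants take this form: a loop changes one bank, described by a function, and the rest
    of the memory stays literally the same. *)
Definition withB (M : memory) (b : bank) (t : nat -> nat) : memory :=
  fun b' j => if beq b' b then t j else M b' j.

Lemma updM_withB M b t i v : updM (withB M b t) b i v = withB M b (setv t i v).
Proof.
apply/funext => b'; apply/funext => j; rewrite /updM /withB /setv.
by case: (beq b' b); case: (j == i).
Qed.

Lemma withB_id M b : withB M b (M b) = M.
Proof.
apply/funext => b'; apply/funext => j; rewrite /withB.
by case: beqP => // ->.
Qed.

Lemma updM_updM M b i v v' : updM (updM M b i v) b i v' = updM M b i v'.
Proof. by apply/funext => b'; apply/funext => j; rewrite /updM; case: (_ && _). Qed.

Lemma updM_id M b i : updM M b i (M b i) = M.
Proof.
apply/funext => b'; apply/funext => j; rewrite /updM.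
by case: beqP => //= ->; case: eqP => // ->.
Qed.

Lemma list_bound (f : nx * nx -> nat) (l : seq (nx * nx)) :
  exists m, forall p, List.In p l -> f p <= m.
Proof.
elim: l => [|p l [m IH]]; first by exists 0.
exists (maxn (f p) m) => q /= [<-|/IH h]; first exact: leq_maxl.
exact: leq_trans h (leq_maxr _ _).
Qed.

Lemma store_ct_pow A e1 e2 : 0 < A ->
  store_ct A e1 e2 <= store_ct 1 e1 e2 * A ^ maxn (ndep e1) (ndep e2).
Proof.
move=> A0; have [h _] := ct_le_pow A0.
have p d : 0 < A ^ d by rewrite expn_gt0 A0.
rewrite /store_ct !mulnDl !leq_add ?leq_pmulr //.
  by apply: leq_trans (h _) _; rewrite leq_mul2l leq_pexp2l ?leq_maxl ?orbT.
by apply: leq_trans (h _) _; rewrite leq_mul2l leq_pexp2l ?leq_maxr ?orbT.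
Qed.

Lemma total_time_le X P E Lb H K n Z t1 t2 t3 t4 t5 :
  0 < X -> 0 < P -> 0 < E -> n <= X -> 1000 <= X -> Lb <= X * H.+1 -> Z <= E ->
  t3 <= Lb * K * E -> t1 <= (X + n + 4) * (Lb * (K * P)) ->
  t2 <= 10 * (Lb * (K * P)) -> t4 <= Z.+1 * (Lb * (K * P)) ->
  t5 <= n.+1 * (Lb * (K * P)) ->
  t1 + (t2 + (t3 + (t4 + t5))) <= H.+1 * K * 30 * (X * X * P) * E.
Proof.
move=> X0 P0 E0 nX Xlarge hLb ZE h3 h1 h2 h4 h5.
set U := Lb * (K * P) in h1 h2 h4 h5.
have XE : X <= X * E by rewrite leq_pmulr.
have EX : E <= X * E by rewrite leq_pmull.
have h3' : t3 <= X * E * U.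
  apply: leq_trans h3 _; rewrite /U.
  have -> : X * E * (Lb * (K * P)) = Lb * K * E * (X * P).
    by clear; lia.
  by rewrite leq_pmulr // muln_gt0 X0.
have hU : U <= X * H.+1 * (K * P) by rewrite leq_mul2r hLb orbT.
apply: (@leq_trans (30 * (X * E) * U)); last first.
  apply: leq_trans (leq_mul (leqnn _) hU) _.
  rewrite leq_eqVlt; apply/orP; left; apply/eqP.
  by move: {hU h3' h1 h2 h4 h5 U hLb h3 ZE XE EX Xlarge X0 P0 E0 nX} (H.+1) => h; lia.
have : (X + n + 4 + 10 + Z.+1 + n.+1) * U <= 29 * (X * E) * U.
  by rewrite leq_mul2r; apply/orP; right; move: (X * E) XE EX => v; lia.
by rewrite !mulnDl; move: (X * E) h3' => v; lia.
Qed.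

(** * Execution of the program phase by phase *)

Section Execution.
Variables (R : realType) (n d k : nat) (G : sgraph 'I_n) (w : {set 'I_n} -> R).
Hypotheses (dG : degenerate G d) (w_pos : forall e, e \in edges G -> (0 < w e)%R)
  (k0 : 0 < k) (kn : k <= n).
Variables (H K DD : nat).
Hypotheses (itemsH : forall p, List.In p items -> store_md p.1 p.2 + 20 <= H)
  (itemsK : forall p, List.In p items -> store_ct 1 p.1 p.2 <= K)
  (itemsD : forall p, List.In p items -> maxn (ndep p.1) (ndep p.2) <= DD).

Let X := Xn n.
Let B := 2 ^ X.
Let Lb := X * H + 1.
Let W p : R := oapp w 0%R (edge_at G p).

Lemma n_gt0 : 0 < n. Proof. exact: leq_trans kn. Qed.

Lemma X_large : 1000 <= X.
Proof.
have n0 := n_gt0; have : 0 < n * n * (n * n) by rewrite !muln_gt0 n0.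
by rewrite /X /Xn; lia.
Qed.

Lemma X_n : 1000 * n <= X.
Proof.
have n0 := n_gt0; have : n <= n * n * (n * n) by rewrite -mulnA leq_pmulr // !muln_gt0 n0.
by rewrite /X /Xn; lia.
Qed.

Lemma X_gt0 : 0 < X. Proof. by have := X_large; lia. Qed.

Lemma B2 : 2 <= B.
Proof. by rewrite /B -[X in X <= _]expn1 leq_exp2l // X_gt0. Qed.

Lemma BHL : B ^ H < 2 ^ Lb.
Proof. by rewrite /B /Lb -expnM ltn_exp2l // addn1. Qed.

Lemma leX_B v : v <= X -> v <= B.
Proof. by move=> h; apply: leq_trans h (ltnW (ltn_expl _ _)). Qed.

Lemma pow_B v : v <= X -> 2 ^ v <= B.
Proof. by move=> h; rewrite /B leq_exp2l. Qed.

Local Notation bnd := (bounded B).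

Lemma step1 M s b e1 e2 : List.In (e1, e2) items -> rep W M s -> bnd M ->
  loops_le M X e1 e2 ->
  runs (store1 b e1 e2) s (Lb * (K * X ^ DD))
    (rep W (updM M b (nden M W (env0 0) e1) (nden M W (env0 0) e2))).
Proof.
move=> hin rp hb hl; have hH := itemsH hin.
apply: runs_weaken (store1_runs B2 BHL b rp hb hl _) _ _ => //=.
  by rewrite /= in hH; lia.
rewrite leq_mul2l; apply/orP; right; apply: leq_trans (store_ct_pow _ _ X_gt0) _.
apply: leq_mul; first exact: (itemsK hin).
by rewrite leq_pexp2l ?X_gt0 //; exact: (itemsD hin).
Qed.

Lemma step_for Inv N M s a A b e1 e2 : List.In (e1, e2) items -> a <= 20 -> 0 < A ->
  (forall i M', i <= N -> Inv i M' ->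
    [/\ bnd M', M' BPar a = N & loops_le M' A e1 e2]) ->
  (forall i M', i < N -> Inv i M' ->
    Inv i.+1 (updM M' b (nden M' W (env0 i) e1) (nden M' W (env0 i) e2))) ->
  rep W M s -> Inv 0 M ->
  runs (store_for a b e1 e2) s (N.+1 * (Lb * (K * A ^ maxn (ndep e1) (ndep e2))))
    (fun s' => exists2 M', rep W M' s' & Inv N M').
Proof.
move=> hin ha A0 h1 h2 rp I0; have hH := itemsH hin.
apply: runs_weaken (store_for_runs B2 BHL h1 h2 _ rp I0) _ _ => //=.
  by rewrite /= in hH; lia.
rewrite leq_mul2l /= leq_mul2l; apply/orP; right; apply: leq_trans (store_ct_pow _ _ A0) _.
by rewrite leq_mul2r; apply/orP; right; exact: (itemsK hin).
Qed.

Lemma step_forX Inv N M s a b e1 e2 : List.In (e1, e2) items -> a <= 20 ->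
  (forall i M', i <= N -> Inv i M' ->
    [/\ bnd M', M' BPar a = N & loops_le M' X e1 e2]) ->
  (forall i M', i < N -> Inv i M' ->
    Inv i.+1 (updM M' b (nden M' W (env0 i) e1) (nden M' W (env0 i) e2))) ->
  rep W M s -> Inv 0 M ->
  runs (store_for a b e1 e2) s (N.+1 * (Lb * (K * X ^ DD)))
    (fun s' => exists2 M', rep W M' s' & Inv N M').
Proof.
move=> hin ha h1 h2 rp I0.
apply: runs_weaken (step_for hin ha X_gt0 h1 h2 rp I0) _ _ => //.
rewrite leq_mul2l /= leq_mul2l leq_mul2l leq_pexp2l ?X_gt0 ?orbT //.
exact: (itemsD hin).
Qed.

Definition M0 : memory := fun b i => nmem (input G w k) (bcode b) i.

Record good (M : memory) : Prop := Good {
  gN : M BPar pN = n;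
  gK : M BPar pK = k;
  gX : M BPar pX = X;
  gAdj : forall p, M BAdj p = isSome (edge_at G p);
  gPow : forall i, i <= X -> M BPow i = 2 ^ i;
  gLay : peeled d G n (M BLay);
  gTab : forall j, M BTab j <= 1;
  gOut : forall j, M BOut j <= 1;
  gBnd : bnd M }.

Lemma phase_init : runs prog_init (input G w k)
   ((X + n + 4) * (Lb * (K * X ^ DD)))
   (fun s' => exists2 M, rep W M s' & good M).
Proof.
have n0 := n_gt0; have X1000 := X_n.
have B2 := B2.
have nB : n <= B by apply: leX_B; lia.
pose M1 := updM M0 BPar pX X.
pose M2 := withB M1 BPow (setv (fun=> 0) 0 1).
have b0 : bnd M0.
  move=> b i; case: b => //=; rewrite /M0 /=.
    by case: i => [|[|i]] //; apply: leq_trans kn nB.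
  by case: (edge_at G i) => [?|] /=; lia.
have b1 : bnd M1.
  by move=> b i; rewrite /M1 /updM; case: ifP => // _; apply: leX_B.
set U := Lb * _.
apply: (@runs_seq _ _ _ _ U ((X + n + 3) * U)); last by rewrite -mulSn leq_mul2r; apply/orP; right; lia.
apply: (runs_weaken (@step1 M0 _ BPar _ _ _ _ b0 _) (leqnn _)); first by left.
- by split=> //; split.
- by [].
move=> s1 rp1.
have {}rp1 : rep W M1 s1 by exact: rp1.
apply: (@runs_seq _ _ _ _ U ((X + n + 2) * U)); last by rewrite -mulSn leq_mul2r; apply/orP; right; lia.
apply: (runs_weaken (@step1 M1 _ BPow _ _ _ rp1 b1 _) (leqnn _)); first by right; left.
  by [].
move=> s2 rp2.
have {}rp2 : rep W M2 s2.
  rewrite (_ : M2 = updM M1 BPow 0 1) //.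
  rewrite -[in RHS](withB_id M1 BPow) updM_withB /M2; congr withB.
apply: (@runs_seq _ _ _ _ (X.+1 * U) (n.+1 * U)); last by rewrite -mulnDl leq_mul2r; apply/orP; right; lia.
pose I3 i (M : memory) := exists2 t, M = withB M1 BPow t &
  (forall j, j <= i -> t j = 2 ^ j) /\ (forall j, i < j -> t j = 0).
have bI3 i M : i <= X -> I3 i M -> bnd M.
  move=> hi [t -> [h1 h2]] b j; rewrite /withB; case: ifP => _; last exact: b1.
  case: (leqP j i) => hj; last by rewrite h2.
  by rewrite h1 //; apply: pow_B; lia.
apply: (runs_weaken (@step_forX I3 X M2 _ _ _ _ _ _ _ _ _ rp2 _) (leqnn _)) => //.
- by right; right; left.
- by move=> i M hi HI; split; [exact: bI3 HI | case: HI => t -> _ | ].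
- move=> i M hi [t -> [h1 h2]]; rewrite updM_withB; eexists; first by [].
  have e1 : nden (withB M1 BPow t) W (env0 i) eNext = i.+1 by rewrite /= addn1.
  have e2 : nden (withB M1 BPow t) W (env0 i) eDouble = 2 ^ i.+1.
    by rewrite /= /withB /= /env0 setv_eq h1 // expnS mul2n addnn.
  rewrite e1 e2; split=> j hj; rewrite /setv.
    by case: eqP => [->//|hne]; apply: h1; lia.
  by case: eqP => [?|hne]; [lia | apply: h2; lia].
- by exists (setv (fun=> 0) 0 1) => //; split=> [[|//]|[|j]].
move=> s3 [M3 rp3 [t3 eM3 [h3 h3']]].
have b3 : bnd M3 by apply: (bI3 X) => //; exists t3.
pose I4 i (M : memory) := exists2 t, M = withB M3 BLay t &
  peeled d G i t /\ (forall j, t j <= i).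
have bI4 i M : i <= n -> I4 i M -> bnd M.
  move=> hi [t -> [_ h2]] b j; rewrite /withB; case: ifP => _; last exact: b3.
  by apply: leq_trans (h2 j) _; apply: leq_trans nB.
apply: (runs_weaken (@step_forX I4 n M3 _ _ _ _ _ _ _ _ _ rp3 _) (leqnn _)) => //.
- by do 3 right; left.
- move=> i M hi HI; split; first exact: bI4 HI.
    by case: HI => t -> _; rewrite eM3.
  by case: HI => t -> _; rewrite eM3 /loops_le /= /withB /= /M1 /updM /= /M0 /=; lia.
- move=> i M hi [t -> [h1 h2]].
  set M' := withB _ _ _.
  have MN' : M' BPar pN = n by rewrite /M' eM3.
  have MA' p : M' BAdj p = isSome (edge_at G p) by rewrite /M' eM3.
  have [r0 hr0] := pickable_exists hi h1.
  pose pk j := if insub j is Some v then pickable G t v else false.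
  have [||g1 g2 _] := @den_find _ M' W (env0 i) 1 4 pN ePick pk isT.
  + move=> j l; rewrite MN' => hj; rewrite /pk insubT.
    exact: (@den_pick _ _ _ _ _ MA' MN' _ (Ordinal hj)).
  + by exists r0; rewrite ?MN' // /pk valK.
  rewrite -/eOrder MN' in g1 g2; set r := nden M' W (env0 i) eOrder in g1 g2 *.
  have e2 : nden M' W (env0 i) eNext = i.+1 by rewrite /= addn1.
  rewrite e2 updM_withB; eexists; first by [].
  split; last by move=> j; rewrite /setv; case: ifP => // _; have := h2 j; lia.
  rewrite /pk insubT in g2.
  apply: (peeledS dG hi h1 g2) => v; rewrite /setv.
  by rewrite -(inj_eq val_inj).
- exists (fun=> 0); last by split=> //; apply: peeled0.
  by rewrite eM3; apply/funext => b; apply/funext => j; rewrite /withB; case: b.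
move=> s4 [M4 rp4 I4n]; exists M4 => //.
have b4 := bI4 _ _ (leqnn n) I4n.
case: I4n => t4 e4 [p4 _]; split=> //; rewrite ?e4 ?eM3 //=.
Qed.

Lemma good_upd M c v : good M -> 2 < c -> v <= B -> good (updM M BPar c v).
Proof.
move=> [h1 h2 h3 h4 h5 h6 h7 h8 h9] hc hv; split=> //; rewrite /updM /=.
- by rewrite (_ : (pN == c) = false) //; case: c hc.
- by rewrite (_ : (pK == c) = false) //; case: c hc => [|[|]].
- by rewrite (_ : (pX == c) = false) //; case: c hc => [|[|[|]]].
- by move=> b i; case: ifP.
Qed.

Lemma step_par M s c e v : List.In (XConst c, e) items -> 2 < c ->
  good M -> rep W M s -> nden M W (env0 0) e = v -> v <= B ->
  all (fun a => (a == pN) || (a == pX)) (nloops e) ->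
  runs (store1 BPar (XConst c) e) s (Lb * (K * X ^ DD))
    (fun s' => rep W (updM M BPar c v) s' /\ good (updM M BPar c v)).
Proof.
move=> hin hc gM rp hv vB hl.
apply: (runs_weaken (step1 BPar hin rp (gBnd gM) _) (leqnn _)) => [|s' rp'].
  apply: sub_all hl => a /orP [/eqP ->|/eqP ->]; rewrite ?(gN gM) ?(gX gM) //.
  by have := X_n; lia.
by rewrite -hv; split=> //; apply: good_upd => //; rewrite hv.
Qed.

Record ready (M : memory) (D L t lam s b : nat) : Prop := Ready {
  yGood : good M;
  yD : M BPar pD = D;
  yLam : M BPar pLam = lam;
  yS : M BPar pS = s;
  yB : M BPar pB = b;
  yNP : M BPar pNP = 2 ^ ((mu lam).+1 * s);
  yF : M BPar pF = 2 ^ phi lam s;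
  yFQ : M BPar pFQ = 2 ^ (phi lam s + mu lam);
  yZ : M BPar pZ = 2 ^ (mu lam * b.+1 + phi lam s * b);
  yout : forall v : 'I_n, outdeg G (M BLay) v <= D;
  yDd : D <= d;
  yL0 : 0 < L;
  yL1 : n <= 2 ^ L;
  yL2 : 2 ^ L <= 2 * n;
  yt : t = k * D + k * (0 < D) + L;
  ylam0 : 0 < lam;
  ylam1 : t <= 2 ^ lam;
  ylam2 : lam.-1 = 0 \/ 2 ^ lam.-2 < t;
  yb : b = 9 * lam + 12;
  ys : s = t %/ b + 1;
  yXZ : mu lam * b.+1 + phi lam s * b <= X;
  yXNP : (mu lam).+1 * s <= X;
  ysX : s <= X;
  ybX : b <= X }.

(** With [N = n * n] the crude bounds are [mu <= 10 * N], [b <= 39 * N] and [phi <= 13 * N], so the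
    largest exponent is at most [(10 * 40 + 13 * 39) * N ^ 2 = 907 * N ^ 2]; hence the constant 1000
    in [Xn]. *)
Lemma params_le t lam s b : t <= n * n + n -> lam <= t.+1 -> b = 9 * lam + 12 ->
  s = t %/ b + 1 ->
  [/\ mu lam * b.+1 + phi lam s * b <= X, (mu lam).+1 * s <= X,
      phi lam s + mu lam <= X & [/\ b <= X, s <= X, t < X & lam <= X]].
Proof.
move=> ht hlam hb hs; have n0 := n_gt0.
pose N := n * n; have N0 : 0 < N by rewrite muln_gt0 n0.
have nN : n <= N by rewrite /N leq_pmulr.
have hX : X = 1000 * (N * N) by rewrite /X /Xn -/N; lia.
have t2 : t <= 2 * N by rewrite -/N in ht; lia.
have l3 : lam <= 3 * N by lia.
have s3 : s <= 3 * N.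
  by have := leq_div t b; rewrite hs; lia.
have b39 : b <= 39 * N by lia.
have m10 : mu lam <= 10 * N by rewrite /mu; lia.
have p13 : phi lam s <= 13 * N by rewrite /phi; lia.
have NN : N <= N * N by rewrite leq_pmulr.
have e1 : mu lam * b.+1 <= 10 * N * (40 * N) by apply: leq_mul => //; lia.
have e2 : phi lam s * b <= 13 * N * (39 * N) by apply: leq_mul.
have e3 : (mu lam).+1 * s <= 11 * N * (3 * N) by apply: leq_mul => //; lia.
rewrite hX; move: e1 e2 e3; set x1 := mu lam * b.+1; set x2 := phi lam s * b.
set x3 := _.+1 * s => e1 e2 e3.
by split; [lia|lia|lia|split; lia].
Qed.

Lemma phase_params s M : good M -> rep W M s -> runs prog_params s
   (10 * (Lb * (K * X ^ DD)))
   (fun s' => exists2 M', rep W M' s' &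
      exists D L t lam s b, ready M' D L t lam s b).
Proof.
move=> gM rp; set U := Lb * _.
have n0 := n_gt0; have X1000 := X_n.
have seqU c1 c2 (s0 : state R) m Q : runs c1 s0 U (fun s' => runs c2 s' (m * U) Q) ->
    runs (Seq c1 c2) s0 (m.+1 * U) Q.
  by move=> h; apply: runs_seq h _; rewrite mulSn.
have [inj_lay outd] := peeled_n (gLay gM).
pose pD' j := [forall v : 'I_n, outdeg G (M BLay) v <= j].
have [||D1 D2 D3] := @den_find _ M W (env0 0) 3 4 pN (XAll 1 pN (XLe (eOutdeg 1) (XVar 3))) pD' isT.
- move=> i j hi; rewrite (@den_all _ _ _ _ _ _ _ (fun v => if insub v is Some v' then
    outdeg G (M BLay) v' <= i else true)).
    rewrite (gN gM); congr nat_of_bool; apply: eq_forallb => v; rewrite valK //.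
  move=> v; rewrite (gN gM) => hv; rewrite insubT den_le.
  by rewrite (@den_outdeg _ _ _ _ _ (gAdj gM) (gN gM) _ _ (Ordinal hv)).
- exists n.-1; rewrite ?(gN gM); first by lia.
  by apply/forallP => v; have := outdeg_lt G (M BLay) v; lia.
rewrite -/eD (gN gM) in D1 D2 D3; set D := nden M W (env0 0) eD in D1 D2 D3.
have Dd : D <= d.
  by rewrite leqNgt; apply/negP => /D3 /negP; apply; apply/forallP => v; exact: outd.
apply: (seqU); apply: (runs_weaken (@step_par M _ _ _ D _ _ gM rp _ _ _) (leqnn _)) => //.
- by do 4 right; left.
- by apply: leX_B; lia.
move=> s1 [rp1 g1]; set M1 := updM _ _ _ _ in rp1 g1.
have [||L1 L2 L3] := @den_find _ M1 W (env0 0) 1 4 pX (XLt (Par pN) (XPw (XVar 1))) (fun i => n < 2 ^ i) isT.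
- by move=> i j; rewrite (gX g1) => hi; rewrite den_lt den_par (gN g1) /XPw den_load /= setv_eq (gPow g1) // ltnW.
- by exists n; rewrite ?(gX g1); [lia|exact: ltn_expl].
rewrite -/eL (gX g1) in L1 L2 L3; set L := nden M1 W (env0 0) eL in L1 L2 L3.
have Ln : L <= n by rewrite leqNgt; apply/negP => /L3; rewrite ltn_expl.
have L0 : 0 < L by case: (posnP L) => // e; move: L2; rewrite e expn0; lia.
have L2n : 2 ^ L <= 2 * n.
  have : L.-1 < L by lia.
  move/L3; rewrite -leqNgt => h.
  by rewrite -(prednK L0) expnS leq_mul2l h.
apply: (seqU); apply: (runs_weaken (@step_par M1 _ _ _ L _ _ g1 rp1 _ _ _) (leqnn _)) => //.
- by do 5 right; left.
- by apply: leX_B; lia.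
move=> s2 [rp2 g2]; set M2 := updM _ _ _ _ in rp2 g2.
pose t := k * D + k * (0 < D) + L.
have tn : t <= n * n + n.
  have h1 : k * D <= n * n.-1 by apply: leq_mul => //; lia.
  have h2 : k * (0 < D) <= n by case: (0 < D); rewrite ?muln1 ?muln0.
  have h3 : n * n = n * n.-1 + n by rewrite -mulnSr prednK.
  rewrite /t h3; lia.
have [_ _ _ [_ _ tX _]] := params_le tn (leq0n _) (erefl _) (erefl _).
apply: (seqU); apply: (runs_weaken (@step_par M2 _ _ _ t _ _ g2 rp2 _ _ _) (leqnn _)) => //.
- by do 6 right; left.
- by rewrite !den_add !den_mul !den_par den_le den_par (gK g2) /M2 /M1 /updM /=.
- by apply: leX_B; lia.
move=> s3 [rp3 g3]; set M3 := updM _ _ _ _ in rp3 g3.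
have [||l1 l2 l3] := @den_find _ M3 W (env0 0) 1 4 pX (XLe (Par pT) (XPw (XVar 1))) (fun i => t <= 2 ^ i) isT.
- move=> i j; rewrite (gX g3) => hi; rewrite den_le den_par /XPw den_load (gPow g3) /= setv_eq.
    by rewrite /M3 /updM.
  exact: ltnW.
- by exists t; rewrite ?(gX g3) // ltnW // ltn_expl.
rewrite (gX g3) in l1; set lam' := nden M3 W (env0 0) (XFind _ _ _ _) in l1 l2 l3.
pose lam := lam'.+1.
have lamt : lam <= t.+1.
  by rewrite ltnS leqNgt; apply/negP => /l3; rewrite ltnW // ltn_expl.
pose b := 9 * lam + 12; pose sz := t %/ b + 1.
have [XZ XNP XFQ [bX sX _ lX]] := params_le tn lamt (erefl b) (erefl sz).
apply: (seqU); apply: (runs_weaken (@step_par M3 _ _ _ lam _ _ g3 rp3 _ _ _) (leqnn _)) => //.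
- by do 7 right; left.
- by rewrite den_add -/lam' /= addn1.
- exact: leX_B.
move=> s4 [rp4 g4]; set M4 := updM _ _ _ _ in rp4 g4.
apply: (seqU); apply: (runs_weaken (@step_par M4 _ _ _ b _ _ g4 rp4 _ _ _) (leqnn _)) => //.
- by do 8 right; left.
- exact: leX_B.
move=> s5 [rp5 g5]; set M5 := updM _ _ _ _ in rp5 g5.
apply: (seqU); apply: (runs_weaken (@step_par M5 _ _ _ sz _ _ g5 rp5 _ _ _) (leqnn _)) => //.
- by do 9 right; left.
- exact: leX_B.
move=> s6 [rp6 g6]; set M6 := updM _ _ _ _ in rp6 g6.
apply: (seqU); apply: (runs_weaken (@step_par M6 _ _ _ (2 ^ ((mu lam).+1 * sz)) _ _ g6 rp6 _ _ _) (leqnn _)) => //.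
- by do 10 right; left.
- rewrite /eNP /XPw den_load (_ : nden _ _ _ _ = (mu lam).+1 * sz) ?(gPow g6) //.
  by rewrite den_mul (@den_mu1 _ _ _ lam) // den_par.
- exact: pow_B.
move=> s7 [rp7 g7]; set M7 := updM _ _ _ _ in rp7 g7.
have phiX : phi lam sz <= X by move: XFQ; lia.
apply: (seqU); apply: (runs_weaken (@step_par M7 _ _ _ (2 ^ phi lam sz) _ _ g7 rp7 _ _ _) (leqnn _)) => //.
- by do 11 right; left.
- by rewrite /eF /XPw den_load (@den_phi _ _ _ lam sz) // (gPow g7).
- exact: pow_B.
move=> s8 [rp8 g8]; set M8 := updM _ _ _ _ in rp8 g8.
apply: (seqU); apply: (runs_weaken (@step_par M8 _ _ _ (2 ^ (phi lam sz + mu lam)) _ _ g8 rp8 _ _ _) (leqnn _)) => //.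
- by do 12 right; left.
- by rewrite /eFQ /XPw den_load den_add (@den_phi _ _ _ lam sz) // (@den_mu _ _ _ lam) // (gPow g8).
- exact: pow_B.
move=> s9 [rp9 g9]; set M9 := updM _ _ _ _ in rp9 g9.
rewrite mul1n.
apply: (runs_weaken (@step_par M9 _ _ _ (2 ^ (mu lam * b.+1 + phi lam sz * b)) _ _ g9 rp9 _ _ _) (leqnn _)) => //.
- by do 13 right; left.
- rewrite /eZ /XPw den_load den_add !den_mul (@den_phi _ _ _ lam sz) // (@den_mu _ _ _ lam) //.
  by rewrite den_add !den_par [nden _ _ _ (XConst 1)]/= addn1 (gPow g9).
- exact: pow_B.
move=> s10 [rp10 g10]; exists (updM M9 BPar pZ (2 ^ (mu lam * b.+1 + phi lam sz * b))) => //.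
exists D, L, t, lam, sz, b; split=> //.
- by move=> v; move/forallP: D2; exact.
- exact: ltnW.
- by rewrite /lam; apply: leq_trans l2 _; rewrite leq_exp2l.
- case: (posnP lam') => [|h]; first by left.
  by right; rewrite /lam /= ltnNge; apply: l3; lia.
Qed.

Lemma ready_withB M D L t lam s b c f : ready M D L t lam s b ->
  (c = BTab \/ c = BOut) -> (forall j, f j <= 1) -> ready (withB M c f) D L t lam s b.
Proof.
have B2 := B2.
move=> [[? ? ? ? ? ? ? ? hb] ? ? ? ? ? ? ? ? ? ? ? ? ? ? ? ? ? ? ? ? ? ? ?] hc hf.
have hbnd : bnd (withB M c f).
  by move=> c' j; rewrite /withB; case: ifP => // _; apply: leq_trans (hf j) _; lia.
by case: hc hbnd => -> hbnd.
Qed.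

Lemma ready_best M D L t lam s b v : ready M D L t lam s b -> v <= B ->
  ready (updM M BPar pBest v) D L t lam s b.
Proof.
move=> [gM ? ? ? ? ? ? ? ? ? ? ? ? ? ? ? ? ? ? ? ? ? ? ?] hv.
by split=> //; exact: good_upd.
Qed.

(** * Table, search and output for fixed parameters *)

Section Ready.
Variables (D L t lam s b : nat).
Local Notation rdy M := (ready M D L t lam s b).
Local Notation Q := (2 ^ mu lam).
Local Notation gp T y c := (gphi (2 ^ ((mu lam).+1 * s)) (2 ^ phi lam s) s Q
  (uel lam) (ubt lam) T (y %/ Q) (y %% Q) c).

Lemma s_gt0 M : rdy M -> 0 < s.
Proof. by move=> rM; rewrite (ys rM) addn1. Qed.

Lemma b_gt0 M : rdy M -> 0 < b.
Proof. by move=> rM; rewrite (yb rM) addnS. Qed.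

(** The loops over constraints and rows have exponential length, so a separate bound replaces [X].
    The exponent 3 is the nesting depth of [eLeaf]. *)
Lemma phase_leaf M st : rdy M -> rep W M st ->
  runs (store_for pFQ BTab (XVar 0) eLeaf) st
    ((2 ^ (phi lam s + mu lam)).+1 *
      (Lb * (K * (2 ^ ((mu lam).+1 * s + phi lam s)) ^ 3)))
    (fun st' => exists2 M', rep W M' st' & rdy M' /\ ugreedy lam s (M' BTab)).
Proof.
move=> rM rp.
pose greedy_upto x (f : nat -> nat) := forall y, y < x -> f y = (gp f y 0 <= gp f y 1).
pose I x (M' : memory) := exists2 f, M' = withB M BTab f & (forall j, f j <= 1) /\
   (greedy_upto x f).
have Q0 : 0 < Q by rewrite expn_gt0.
have rI x M' : I x M' -> rdy M'.
  by move=> [f -> [h _]]; apply: ready_withB => //; left.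
have hin : List.In (XVar 0, eLeaf) items by do 14 right; left.
have hl : all (fun a => a \in [:: pNP; pF; pS]) (nloops (XVar 0) ++ nloops eLeaf) by [].
have A0 : 0 < 2 ^ ((mu lam).+1 * s + phi lam s) by rewrite expn_gt0.
apply: (runs_weaken (@step_for I _ M st pFQ _ BTab _ _ hin isT A0 _ _ rp _) _) => //.
- move=> x M' _ HI; have r' := rI _ _ HI; split; first exact: (gBnd (yGood r')).
    exact: (yFQ r').
  apply: sub_all hl => a; rewrite !inE => /or3P [] /eqP ->.
  + by rewrite (yNP r') leq_exp2l // leq_addr.
  + by rewrite (yF r') leq_exp2l // leq_addl.
  + rewrite (yS r'); apply: leq_trans (ltnW (ltn_expl s (ltnSn 1))) _.
    by rewrite leq_exp2l // mulSn -addnA leq_addr.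
- move=> x M' hx HI; have r' := rI _ _ HI.
  have e1 : nden M' W (env0 x) (XVar 0) = x by [].
  rewrite e1 (den_leaf _ (gN (yGood r')) (gK (yGood r')) (gPow (yGood r')) (yLam r') (yS r') (yB r')
    (yF r') (yNP r') (yD r') (yXZ r') (yXNP r') (b_gt0 r') (s_gt0 r')).
  case: HI => f -> [h1 h2]; rewrite updM_withB; eexists; first by [].
  set v := nat_of_bool _.
  have ext y c : y <= x -> gp (setv f x v) y c = gp f y c.
    move=> hy; apply: gphi_ext; [exact: uel_lt|by rewrite ltn_mod|].
    move=> j; rewrite -divn_eq => hj; rewrite setv_ne //; lia.
  split; first by move=> j; rewrite /setv; case: ifP => // _; exact: leq_b1.
  move=> y; rewrite ltnS leq_eqVlt => /orP [/eqP ->|hy].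
    by rewrite setv_eq !ext.
  by rewrite !ext ?(ltnW hy) // setv_ne ?h2 //; lia.
- exists (M BTab); first by rewrite withB_id.
  by split=> //; exact: (gTab (yGood rM)).
- move=> st' [M' rp' HI]; exists M' => //; split; first exact: rI HI.
  case: HI => f -> [_ hf] r j hr hj.
  have := hf (r * Q + j); rewrite divnMDl // (divn_small hj) addn0 modnMDl (modn_small hj); apply.
  by rewrite expnD; nia.
Qed.

Local Notation EZ := (mu lam * b.+1 + phi lam s * b).
Local Notation red M z := (fun u : 'I_n => redp M lam s b D z u).
Local Notation val M z := (cval G w (fun u : 'I_n => M BLay u) (red M z)).
Local Notation sel M z := (topk (val M z) (red M z) k).
Local Notation tot M z := (\sum_(v in sel M z) val M z v)%R.

Definition best_upto (M : memory) (Z v : nat) := forall z, z < Z -> #|sel M z| = k ->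
  #|sel M v| = k /\ (tot M z <= tot M v)%R.

Lemma best_upto_step M z v : best_upto M z v ->
  best_upto M z.+1 (if betterp k G w M lam s b D z v then z else v).
Proof.
move=> h z'; rewrite ltnS leq_eqVlt => /orP [/eqP ->|hz] cz; rewrite /betterp.
  rewrite cz eqxx /=; case: ifPn => //; rewrite negb_imply => /andP [/eqP -> ].
  by rewrite -ltNge => /ltW.
have [cv le] := h z' hz cz; case: ifP => // /andP [/eqP -> ]; rewrite cv eqxx /= => le'.
by split=> //; exact: le_trans le le'.
Qed.

Lemma loops_X M e1 e2 : rdy M ->
  all (fun a => a \in [:: pN; pB]) (nloops e1 ++ nloops e2) -> loops_le M X e1 e2.
Proof.
move=> rM; apply: sub_all => a; rewrite !inE => /orP [] /eqP ->.
  by rewrite (gN (yGood rM)); have := X_n; lia.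
by rewrite (yB rM); exact: (ybX rM).
Qed.

Lemma phase_best M st : rdy M -> rep W M st ->
  runs (store_for pZ BPar (XConst pBest) eBest) st
    ((2 ^ EZ).+1 * (Lb * (K * X ^ DD)))
    (fun st' => exists2 M', rep W M' st' & exists v,
       [/\ M' = updM M BPar pBest v, rdy M' & best_upto M (2 ^ EZ) v]).
Proof.
move=> rM rp.
pose I z (M' : memory) := exists2 v, M' = updM M BPar pBest v & v <= B /\ best_upto M z v.
have rI z M' : I z M' -> rdy M' by move=> [v -> [h _]]; apply: ready_best.
have hin : List.In (XConst pBest, eBest) items by do 15 right; left.
have hl : all (fun a => a \in [:: pN; pB]) (nloops (XConst pBest) ++ nloops eBest) by [].
apply: (runs_weaken (@step_forX I _ M st pZ BPar _ _ hin isT _ _ rp _) (leqnn _)) => //.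
- move=> z M' _ HI; have r' := rI _ _ HI.
  by split; [exact: (gBnd (yGood r')) | exact: (yZ r') | exact: loops_X].
- move=> z M' hz HI; have r' := rI _ _ HI.
  have e1 : nden M' W (env0 z) (XConst pBest) = pBest by [].
  rewrite e1 (den_best (fun p => erefl) (gN (yGood r')) (gK (yGood r')) (gPow (yGood r')) (yLam r') (yS r') (yB r')
    (yF r') (yNP r') (yD r') (yXZ r') (yXNP r') (b_gt0 r') (s_gt0 r')).
  case: HI => v -> [h1 h2]; rewrite updM_updM; eexists; first by [].
  split; last exact: best_upto_step h2.
  case: ifP => // _; rewrite ltnW // (leq_trans hz) // leq_exp2l //; exact: (yXZ rM).
- exists (M BPar pBest); first by rewrite updM_id.
  by split=> //; exact: (gBnd (yGood rM)).
move=> st' [M' rp' HI]; exists M' => //; have r' := rI _ _ HI.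
by case: HI => v e [_ h]; exists v.
Qed.

Lemma phase_out M st : rdy M -> rep W M st ->
  runs (store_for pN BOut (XVar 0) eOut) st (n.+1 * (Lb * (K * X ^ DD)))
    (fun st' => output n st' = sel M (M BPar pBest)).
Proof.
move=> rM rp.
pose I x (M' : memory) := exists2 f, M' = withB M BOut f & (forall j, f j <= 1) /\
   forall v : 'I_n, v < x -> f v = (v \in sel M (M BPar pBest)).
have rI x M' : I x M' -> rdy M'.
  by move=> [f -> [h _]]; apply: ready_withB => //; right.
have hin : List.In (XVar 0, eOut) items by do 16 right; left.
have hl : all (fun a => a \in [:: pN; pB]) (nloops (XVar 0) ++ nloops eOut) by [].
apply: (runs_weaken (@step_forX I _ M st pN BOut _ _ hin isT _ _ rp _) (leqnn _)) => //.
- move=> z M' _ HI; have r' := rI _ _ HI.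
  by split; [exact: (gBnd (yGood r')) | exact: (gN (yGood r')) | exact: loops_X].
- move=> x M' hx HI; have r' := rI _ _ HI.
  have e1 : nden M' W (env0 x) (XVar 0) = x by [].
  rewrite e1 (den_out (fun p => erefl) (gN (yGood r')) (gK (yGood r')) (gPow (yGood r')) (yLam r') (yS r') (yB r')
    (yF r') (yNP r') (yD r') (yXZ r') (yXNP r') (b_gt0 r') (s_gt0 r') (Ordinal hx)).
  case: HI => f -> [h1 h2]; rewrite updM_withB; eexists; first by [].
  split=> [j|v hv]; rewrite /setv; first by case: ifP => // _; exact: leq_b1.
  case: eqP => [e|hne]; last by apply: h2; lia.
  by rewrite (_ : v = Ordinal hx) //; apply: val_inj.
- exists (M BOut); first by rewrite withB_id.
  by split=> //; exact: (gOut (yGood rM)).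
move=> st' [M' [[ag _] _] [f eM [_ hf]]]; apply/setP => v.
rewrite [LHS]inE -[2]/(bcode BOut) ag eM /withB /= hf //.
by case: (_ \in _).
Qed.

Lemma code_covers M (S : {set 'I_n}) : rdy M -> ugreedy lam s (M BTab) -> #|S| = k ->
  exists2 z, z < 2 ^ EZ & (forall v, v \in S -> red M z v) /\
    (forall v u, v \in S -> [set v; u] \in edges G -> M BLay v < M BLay u ->
       u \notin S -> ~~ red M z u).
Proof.
move=> rM gr Sk.
pose N v := [set u : 'I_n | (M BLay (nat_of_ord v) < M BLay u) && ([set v; u] \in edges G)].
case: (posnP D) => [D0|D0].
  (* All vertices are red and no vertex has later neighbours, so any code would do. *)
  exists 0; first by rewrite expn_gt0.
  split=> [v _|v u _ e l _]; first by rewrite /redp D0.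
  have := yout rM v; rewrite D0 leqn0 cards_eq0 => /eqP e0.
  by have : u \in set0; [rewrite -e0 inE l e | rewrite inE].
pose U := (\bigcup_(v in S) N v) :\: S.
have tE := yt rM; have bE := yb rM; have sE := ys rM.
have b0 := b_gt0 rM.
have ts : t <= b * s by rewrite sE mulnC addn1 ltnW // ltn_ceil.
have s2 : s <= 2 ^ lam.+1.
  have := leq_div t b; have := ylam1 rM; rewrite sE expnS.
  have : 0 < 2 ^ lam by rewrite expn_gt0.
  lia.
have cU : #|S :|: U| <= t.
  apply: leq_trans (_ : k * D + k <= t); last by rewrite tE D0 muln1; lia.
  apply: leq_trans (card_out_neighbours (yout rM) Sk); apply: subset_leq_card.
  by apply: setUS; exact: subsetDl.
have dis : [disjoint S & U].
  by rewrite -setI_eq0; apply/eqP/setP => v; rewrite !inE; case: (v \in S); rewrite ?andbF.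
have Lt : L <= 2 ^ lam by apply: leq_trans (ylam1 rM); rewrite tE leq_addl.
have [z hz [z1 z2]] := ucolor_universal (ylam0 rM) s2 gr (yL1 rM) Lt (ylam1 rM) ts
  (s_gt0 rM) cU dis.
exists z => //; split=> [v vS|v u vS e l nu]; rewrite /redp D0 /=.
  by rewrite z1.
rewrite z2 // inE nu; apply/bigcupP; exists v => //.
by rewrite inE l e.
Qed.

Lemma best_max_cover M v : rdy M -> ugreedy lam s (M BTab) ->
  best_upto M (2 ^ EZ) v -> max_cover G w k (sel M v).
Proof.
move=> rM gr hb.
(* Some [k]-element set is needed, whichever it is: its code selects [k] vertices, so the winning
   code does too. *)
have cS : #|[set v : 'I_n | v < k]| = k.
  rewrite -sum1dep_card big_mkcond -[RHS](sum_ltn_min kn).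
  by apply: eq_bigr => i _; case: (i < k).
have [z hz [z1 _]] := code_covers rM gr cS.
have [cv _] := hb z hz (card_topk _ z1 cS).
apply: (@max_cover_of_best _ _ _ _ _ _ _ (fun z => red M z) (2 ^ EZ) k v cv).
- by have [h _] := peeled_n (gLay (yGood rM)).
- by move=> e /w_pos /ltW.
- by move=> z' hz' cz'; have [] := hb z' hz' cz'.
- by move=> S Sk; exact: code_covers.
Qed.

(** The coefficients of [s] are [b] and [9 * lam + 10 <= b], and [s * b <= t + b]. The first
    exponent exceeds [t] by at most [45 * lam ^ 2 + 117 * lam + 73], whose coefficients add up to
    235; the second excess is smaller. *)
Lemma exponents M : rdy M ->
  EZ <= t + 235 * lam ^ 2 /\
  (phi lam s + mu lam).+1 + ((mu lam).+1 * s + phi lam s) * 3 <= t + 235 * lam ^ 2.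
Proof.
move=> rM; have b0 := b_gt0 rM.
have sb : s * b <= t + b by rewrite (ys rM) mulnDl mul1n leq_add2r leq_trunc_div.
have l0 := ylam0 rM.
have l1 : lam <= lam * lam by rewrite leq_pmulr.
move: sb; rewrite (yb rM) /phi /mu -mulnn => sb; split; lia.
Qed.

End Ready.

Lemma prog_runs : exists t s, exec prog (input G w k) t s /\
  max_cover G w k (output n s) /\
  exists L tau lam, [/\ 0 < L, 2 ^ L <= 2 * n, tau <= k * d + k + L, tau <= 2 * (k * d) + L &
    (lam = 0 \/ 2 ^ lam.-1 < tau) /\
    t <= (H.+1 * K * 30) * Xn n ^ (DD + 2) * 2 ^ (tau + 235 * lam.+1 ^ 2)].
Proof.
have n0 := n_gt0; have X1000 := X_n; have X0 := X_gt0.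
have [t1 [s1 [x1 ht1 [M1 rp1 g1]]]] := phase_init.
have [t2 [s2 [x2 ht2 [M2 rp2 [D [L [tau [lam [s [b r2]]]]]]]]]] := phase_params g1 rp1.
have [t3 [s3 [x3 ht3 [M3 rp3 [r3 gr]]]]] := phase_leaf r2 rp2.
have [t4 [s4 [x4 ht4 [M4 rp4 [v [eM4 r4 hb]]]]]] := phase_best r3 rp3.
have [t5 [s5 [x5 ht5 out]]] := phase_out r4 rp4.
have mc : max_cover G w k (output n s5).
  by rewrite out eM4; apply: best_max_cover r3 gr hb.
exists (t1 + (t2 + (t3 + (t4 + t5)))), s5; split.
  exact: ExecSeq x1 (ExecSeq x2 (ExecSeq x3 (ExecSeq x4 x5))).
(* The predecessor undoes the 1 added in [eLam]; with it the logarithmic bound takes the form that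
   [time_final] expects. *)
split=> //; exists L, tau, lam.-1.
have tE := yt r2; have Dd := yDd r2.
have kDd : k * D <= k * d by rewrite leq_mul2l Dd orbT.
split.
- exact: (yL0 r2).
- exact: (yL2 r2).
- by rewrite tE; case: (0 < D); rewrite ?muln1 ?muln0; lia.
- rewrite tE; case: (posnP D) => [->|D0]; rewrite ?muln0 ?muln1; first lia.
  have : k <= k * D by rewrite leq_pmulr.
  lia.
split; first exact: (ylam2 r2).
rewrite (prednK (ylam0 r2)).
have [e1 e2] := exponents r2.
set E := tau + _ in e1 e2 *.
have Lb_le : Lb <= X * H.+1 by rewrite /Lb mulnS; lia.
have l1 : 2 ^ (mu lam * b.+1 + phi lam s * b) <= 2 ^ E by rewrite leq_exp2l.
have l2 : (2 ^ (phi lam s + mu lam)).+1 * (2 ^ ((mu lam).+1 * s + phi lam s)) ^ 3 <= 2 ^ E.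
  apply: (@leq_trans (2 ^ (phi lam s + mu lam).+1 * 2 ^ (((mu lam).+1 * s + phi lam s) * 3))).
    rewrite expnM leq_mul2r; apply/orP; right.
    have : 0 < 2 ^ (phi lam s + mu lam) by rewrite expn_gt0.
    by rewrite expnS; lia.
  by rewrite -expnD leq_exp2l.
have E0 : 0 < 2 ^ E by rewrite expn_gt0.
have Y0 : 0 < X ^ DD by rewrite expn_gt0 X0.
move: ht3 ht4; set F := 2 ^ (phi lam s + mu lam) in l2 *.
set A := (2 ^ _) ^ 3 in l2 *; set Z := 2 ^ (mu lam * _ + _) in l1 * => ht3 ht4.
have h3 : t3 <= Lb * K * 2 ^ E.
  apply: leq_trans ht3 _.
  by rewrite mulnCA -[Lb * K * _]mulnA leq_mul2l mulnCA leq_mul2l l2 !orbT.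
have nX : n <= X by lia.
have -> : X ^ (DD + 2) = X * X * X ^ DD by rewrite addn2 !expnS mulnA.
exact: (total_time_le X0 Y0 E0 nX X_large Lb_le l1 h3 ht1 ht2 ht4 ht5).
Qed.

End Execution.

Theorem theorem1 (R : realType) :
  exists (prog : cmd) (C : nat),
    forall (n d k : nat) (G : sgraph 'I_n) (w : {set 'I_n} -> R),
      degenerate G d ->
      (forall e : {set 'I_n}, e \in edges G -> (0 < w e)%R) ->
      0 < k -> k <= n ->
      exists (t : nat) (s : state R),
        exec prog (input G w k) t s /\
        t <= time_bound C n d k /\
        max_cover G w k (output n s).
Proof.
have [H hH] := list_bound (fun p => store_md p.1 p.2 + 20) items.
have [K hK] := list_bound (fun p => store_ct 1 p.1 p.2) items.
have [DD hDD] := list_bound (fun p => maxn (ndep p.1) (ndep p.2)) items.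
have [C hC] := time_final (H.+1 * K * 30) (DD + 2) 235.
exists prog, C => n d k G w dG w_pos k0 kn.
have [t [s [xs [mc [L [tau [lam [h1 h2 h3 h4 [h5 h6]]]]]]]]] :=
  prog_runs dG w_pos k0 kn hH hK hDD.
exists t, s; split=> //; split=> //.
exact: hC (leq_trans k0 kn) h1 h2 h3 h4 h5 h6.
Qed.
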